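(* Assume that $\overline F\in\mathcal{RV}_{(-1/\gamma_1)}$ and $\overline G\in\mathcal{RV}_{(-1/\gamma_2)}$ with $\gamma_1,\gamma_2>0$, and let $k=k_n$ be an integer sequence satisfying $1<k<n$, $k\to\infty$ and $k/n\to0$ as $n\to\infty$. Assume that there exist constants $\tau_1,\tau_2<0$ and functions $A_1^*,A_2^*$, tending to zero and not changing sign near infinity, such that for any $x>0$ $$\lim_{t\to\infty}\frac{U_F(tx)/U_F(t)-x^{\gamma_1}}{A_1^*(t)}=x^{\gamma_1}\frac{x^{\tau_1}-1}{\tau_1},\qquad \lim_{t\to\infty}\frac{U_G(tx)/U_G(t)-x^{\gamma_2}}{A_2^*(t)}=x^{\gamma_2}\frac{x^{\tau_2}-1}{\tau_2},$$ and that $\sqrt k A_j(h)=O(1)$ for $j=1,2$, as $n\to\infty$, where $A_1(t):=A_1^*(1/\overline F(t))$ and $A_2(t):=A_2^*(1/\overline G(t))$. Assume further that $\sqrt kA_1(h)\to\lambda_1$ as $n\to\infty$. Then $$\sqrt k(\widehat\gamma_1-\gamma_1)\overset{d}{\to}\mathcal N\left(\frac{\lambda_1}{1-p\tau_1},\frac{\gamma_1^2}{p}\right),\quad\text{as }n\to\infty,$$ where $\mathcal N(m,d^2)$ designates the normal distribution with mean $m$ and variance $d^2$.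
   Context: $X$ and $Y$ are independent non-negative continuous random variables, defined on a probability space $(\Omega,\mathcal A,\mathbb P)$, with cumulative distribution functions (cdf's) $F$ and $G$ respectively. $Z:=\min(X,Y)$ has cdf $H$, and $\delta:=\mathbf 1(X\le Y)$. For a cdf $K$, $\overline K:=1-K$, $K^{\leftarrow}$ is the quantile function of $K$, and $U_K(t):=K^{\leftarrow}(1-1/t)$, $t\ge1$. $\overline F\in\mathcal{RV}_{(-1/\gamma_1)}$ means $\lim_{t\to\infty}\overline F(tx)/\overline F(t)=x^{-1/\gamma_1}$ for all $x>0$ (similarly for $\overline G$). Set $\gamma:=\gamma_1\gamma_2/(\gamma_1+\gamma_2)$, $p:=\gamma/\gamma_1$, and $h=h_n:=U_H(n/k)$. $(Z_1,\delta_1),\dots,(Z_n,\delta_n)$ are i.i.d. copies of $(Z,\delta)$; $Z_{1:n}\le\dots\le Z_{n:n}$ are the order statistics of $Z_1,\dots,Z_n$, and $\delta_{[i:n]}:=\delta_j$ if $Z_{i:n}=Z_j$. Hill's estimator of $\gamma$ is $\widehat\gamma^H:=k^{-1}\sum_{i=1}^k\log Z_{n-i+1:n}-\log Z_{n-k:n}$, the estimator of $p$ is $\widehat p:=k^{-1}\sum_{i=1}^k\delta_{[n-i+1:n]}$, and the adapted Hill estimator of $\gamma_1$ is $\widehat\gamma_1:=\widehat\gamma^H/\widehat p$. *)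

(* Defs.v *)
From HB Require Import structures.
From mathcomp Require Import all_boot all_order all_algebra.
From mathcomp Require Import all_classical all_reals all_analysis.
From mathcomp Require Import measurable_realfun.

Set Implicit Arguments.
Unset Strict Implicit.
Unset Printing Implicit Defensive.

Import Order.TTheory GRing.Theory Num.Theory.
Import numFieldNormedType.Exports.

Local Open Scope classical_set_scope.
Local Open Scope ring_scope.

Section independence.
Context {d d' d'' : measure_display} {T : measurableType d}
  {T1 : measurableType d'} {T2 : measurableType d''} {R : realType}.
Variable P : probability T R.

Definition independent_RV (X : {RV P >-> T1}) (Y : {RV P >-> T2}) : Prop :=
  forall (A : set T1) (B : set T2), measurable A -> measurable B ->
    P (X @^-1` A `&` Y @^-1` B) = (P (X @^-1` A) * P (Y @^-1` B))%E.

Definition mutually_independent (W : nat -> {RV P >-> T1}) : Prop :=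
  forall (J : seq nat) (A : nat -> set T1),
    uniq J -> (forall j, measurable (A j)) ->
    P (\bigcap_(j in [set` J]) (W j @^-1` A j)) =
    (\prod_(j <- J) P (W j @^-1` A j))%E.

Definition same_distribution (V W : {RV P >-> T1}) : Prop :=
  forall A : set T1, measurable A -> distribution P V A = distribution P W A.

Definition iid_copies (W : nat -> {RV P >-> T1}) (V : {RV P >-> T1}) : Prop :=
  mutually_independent W /\ forall i, same_distribution (W i) V.

End independence.

Arguments independent_RV {d d' d'' T T1 T2 R} P X Y.
Arguments mutually_independent {d d' T T1 R} P W.
Arguments same_distribution {d d' T T1 R} P V W.
Arguments iid_copies {d d' T T1 R} P W V.

Section weak_convergence.
Context {d : measure_display} {T : measurableType d} {R : realType}.

(* The functions are not bundled as random variables, so their measurability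
   is part of the property; the cdfs converge at every continuity point of the
   cdf of the limit law. *)
Definition cvg_in_distribution (P : probability T R) (V : nat -> T -> R)
    (Q : probability (measurableTypeR R) R) : Prop :=
  (forall n, measurable_fun setT (V n)) /\
  (forall x : R, {for x, continuous (fun y : R => Q `]-oo, y]%classic)} ->
    P (V n @^-1` `]-oo, x]%classic) @[n --> \oo] --> Q `]-oo, x]%classic).

End weak_convergence.

Section tails.
Context {R : realType}.
Implicit Types (K U A f : R -> R).

Definition survival K : R -> R := fun t => 1 - K t.

(* For a cdf K this is meaningful for 0 < s < 1; if the set is empty or not
   bounded below, inf returns 0. *)
Definition quantile K (s : R) : R := inf [set x | s <= K x].

Definition tail_quantile K (t : R) : R := quantile K (1 - t^-1).

Definition regularly_varying f (a : R) : Prop :=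
  forall x : R, 0 < x -> f (t * x) / f t @[t --> +oo] --> x `^ a.

Definition constant_sign_near_infinity A : Prop :=
  (\forall t \near +oo, 0 <= A t) \/ (\forall t \near +oo, A t <= 0).

Definition second_order_condition U (gamma tau : R) A : Prop :=
  [/\ A t @[t --> +oo] --> (0 : R),
      constant_sign_near_infinity A &
      forall x : R, 0 < x ->
        (U (t * x) / U t - x `^ gamma) / A t @[t --> +oo] -->
        x `^ gamma * ((x `^ tau - 1) / tau)].

End tails.

Section cdf.
Context {d : measure_display} {T : measurableType d} {R : realType}.
Variable P : probability T R.

Definition rcdf (X : {RV P >-> R}) (t : R) : R := fine (cdf X t).

Definition continuous_RV (X : {RV P >-> R}) : Prop := continuous (rcdf X).

End cdf.

Arguments rcdf {d T R} P X t.
Arguments continuous_RV {d T R} P X.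

Section censoring.
Context {d : measure_display} {T : measurableType d} {R : realType}.
Variables X Y : {mfun T >-> R}.

Definition observed_time (w : T) : R := Num.min (X w) (Y w).

Definition censoring_indicator (w : T) : R := \1_[set v | X v <= Y v] w.

Lemma measurable_observed_time : measurable_fun setT observed_time.
Proof. exact: measurable_minr. Qed.

Lemma measurable_censoring_indicator : measurable_fun setT censoring_indicator.
Proof.
apply: measurable_indic.
have mX : measurable_fun setT (X : T -> R) by [].
have mY : measurable_fun setT (Y : T -> R) by [].
have := measurable_fun_ler mX mY measurableT (Y := [set true]) I.
by rewrite setTI.
Qed.

HB.instance Definition _ :=
  isMeasurableFun.Build _ _ _ _ observed_time measurable_observed_time.

HB.instance Definition _ :=
  isMeasurableFun.Build _ _ _ _ censoring_indicator
    measurable_censoring_indicator.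

Definition observation (w : T) : R * R :=
  (observed_time w, censoring_indicator w).

Lemma measurable_observation : measurable_fun setT observation.
Proof.
apply: measurable_fun_pair => /=.
exact: measurable_observed_time.
exact: measurable_censoring_indicator.
Qed.

HB.instance Definition _ :=
  isMeasurableFun.Build _ _ _ _ observation measurable_observation.

End censoring.

(* A sample of size n is given by the first n terms of a sequence. *)
Section estimators.
Context {R : realType}.
Implicit Types (z delta : nat -> R) (n k i : nat).

(* 1 <= i <= n *)
Definition order_stat z n i : R := nth 0 (sort <=%R (mkseq z n)) i.-1.

(* In case of ties among the z j, the choice of j is immaterial in the
   applications: ties have probability zero when the z j are i.i.d. with a
   continuous cdf. *)
Definition concomitant z delta n i : R :=
  if [pick j : 'I_n | order_stat z n i == z j] is Some j then delta j else 0.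

Definition hill z n k : R :=
  k%:R^-1 * (\sum_(1 <= i < k.+1) ln (order_stat z n (n - i + 1)%N))
  - ln (order_stat z n (n - k)%N).

Definition uncensored_proportion z delta n k : R :=
  k%:R^-1 * \sum_(1 <= i < k.+1) concomitant z delta n (n - i + 1)%N.

(* Conventions without effect in the limit: ln is 0 at 0, and the quotient is 0
   when all the k concomitants vanish. *)
Definition adapted_hill z delta n k : R :=
  hill z n k / uncensored_proportion z delta n k.

End estimators.

(* Main.v *)
Require Import Defs.
From HB Require Import structures.
From mathcomp Require Import all_boot all_order all_algebra.
From mathcomp Require Import all_classical all_reals all_analysis.
From mathcomp Require Import measurable_realfun.
From mathcomp Require Import ring lra.
From mathcomp Require Import zify.
Set Implicit Arguments.
Unset Strict Implicit.
Unset Printing Implicit Defensive.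
Import Order.TTheory GRing.Theory Num.Theory.
Import numFieldNormedType.Exports.
Local Open Scope classical_set_scope.
Local Open Scope ring_scope.

(** Write s and sY for the survival functions of the lifetime X and of the
    censoring time Y. The threshold t is the (k+1)-st largest observation, which
    has exactly k exceedances because ties are null events. Cross-multiplying by
    the uncensored proportion, which tends to p > 0, turns the event that
    sqrt k (gamma1_hat - gamma1) <= v into an inequality for
    sqrt k (Hill - gamma1 * proportion), a normalised sum over the exceedances.
    For each exceedance Z with indicator delta,

      ln Z - ln t - gamma1 delta =
        gamma1 (ln (s t / s Z) - delta)
        + ((ln Z + gamma1 ln s Z) - (ln t + gamma1 ln s t)).

    The first summand is gamma1 times a score: the cumulative hazard run since t
    minus the uncensored death. For a deterministic level z the score has mean
    exactly 0, and its second moment is the probability of an uncensored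
    observation beyond z (score_mean, score_sqr_mean), which is asymptotically p
    times the probability of any observation beyond z (uncensored_mass_ratio).
    A central limit theorem for triangular arrays (triangular_clt), proved by
    Lindeberg replacement, therefore gives a normal limit of variance
    gamma1^2 p at the deterministic level h. Replacing h by t is harmless:
    t lies within O(1/sqrt k) of h on the scale of the survival function
    (level_tightness), on which the score sums, being differences of two
    monotone functions of the level, vary by o(sqrt k) (score_sum_modulus).

    The second summand is the bias. The second-order condition makes
    ln z + gamma1 ln s z converge to a constant at the precise rate
    (A1 h / tau1) (s z / s h)^(-tau1), uniformly over the tail
    (tail_expansion), and a law of large numbers for the powers of s Z / s h
    turns the sum into lambda1 p / (1 - p tau1) (bias_random_level). Dividing by
    the uncensored proportion, in the form of Slutsky's theorem
    (slutsky_event), gives the mean and the variance of the limit. *)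

(** * Expectations of bounded and dominated functions *)

Section expectation_toolkit.
Context {d : measure_display} {T : measurableType d} {R : realType}.
Variable m : probability T R.
Implicit Types f g : T -> R.

Lemma integrable_bounded f (C : R) : measurable_fun setT f ->
  (forall x, `|f x| <= C) -> m.-integrable setT (EFin \o f).
Proof.
move=> mf fC; apply: measurable_bounded_integrable => //.
  by rewrite (le_lt_trans (probability_le1 _ _)) ?ltry.
exists C; split; first exact: num_real.
by move=> y Cy x _ /=; exact: le_trans (fC x) (ltW Cy).
Qed.

Lemma integrable_dominated f g : measurable_fun setT f ->
  (forall x, `|f x| <= g x) -> m.-integrable setT (EFin \o g) ->
  m.-integrable setT (EFin \o f).
Proof.
move=> mf fg; apply: le_integrable => //; first exact/measurable_EFinP.
by move=> x _ /=; rewrite lee_fin (le_trans (fg x))// ler_norm.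
Qed.

Lemma integrableDr f g : m.-integrable setT (EFin \o f) ->
  m.-integrable setT (EFin \o g) ->
  m.-integrable setT (EFin \o (fun x => f x + g x)).
Proof. by move=> fi gi; exact: (integrableD measurableT fi gi). Qed.

Lemma integrableBr f g : m.-integrable setT (EFin \o f) ->
  m.-integrable setT (EFin \o g) ->
  m.-integrable setT (EFin \o (fun x => f x - g x)).
Proof. by move=> fi gi; exact: (integrableB measurableT fi gi). Qed.

Lemma integrableZr (r : R) f : m.-integrable setT (EFin \o f) ->
  m.-integrable setT (EFin \o (fun x => r * f x)).
Proof. by move=> fi; exact: (integrableZl measurableT r fi). Qed.

Lemma integrable_cstr (r : R) : m.-integrable setT (EFin \o (fun=> r)).
Proof. exact: (@integrable_bounded _ `|r|). Qed.

Lemma Rintegral_cst1 (r : R) : (\int[m]_x r)%R = r.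
Proof.
rewrite Rintegral_cst//; transitivity (r * fine (1%:E : \bar R)).
  by congr (_ * fine _); exact: probability_setT.
by rewrite mulr1.
Qed.

Lemma integrable_measurable f : m.-integrable setT (EFin \o f) ->
  measurable_fun setT f.
Proof. by move=> /measurable_int /measurable_EFinP. Qed.

Lemma Rintegral_indic (A : set T) : measurable A ->
  (\int[m]_x \1_A x)%R = fine (m A).
Proof. by move=> mA; rewrite /Rintegral integral_indic// setIT. Qed.

Lemma Rintegral_fine f : m.-integrable setT (EFin \o f) ->
  (\int[m]_x (f x)%:E)%E = ((\int[m]_x f x)%R)%:E.
Proof. by move=> mf; rewrite /Rintegral fineK//; exact: integrable_fin_num. Qed.

Lemma markov_Rintegral f (e : R) : 0 < e -> m.-integrable setT (EFin \o f) ->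
  (forall x, 0 <= f x) ->
  (m [set x | e <= f x]%R <= (e^-1 * \int[m]_x f x)%:E)%E.
Proof.
move=> e0 intf f0.
have mf := integrable_measurable intf.
have mA : measurable [set x | e <= f x].
  by rewrite -[X in measurable X]setTI; exact: measurable_fun_le.
rewrite -[X in (X <= _)%E]fineK ?fin_num_measure// lee_fin.
have i0 : m.-integrable setT (EFin \o \1_[set x | e <= f x]).
  apply: (@integrable_bounded _ 1) => // x.
  by rewrite indicE; case: (_ \in _); rewrite ?normr0 ?normr1.
rewrite -Rintegral_indic// mulrC ler_pdivlMr// -RintegralZr//.
have i1 : m.-integrable setT
    (EFin \o (fun x => \1_[set x | e <= f x] x * e)).
  apply: (@integrable_bounded _ e) => [|x]; first exact: measurable_funM.
  by rewrite indicE; case: (_ \in _);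
    rewrite ?mul0r ?mul1r ?normr0 ?(ltW e0) ?gtr0_norm.
apply: le_Rintegral => // x _.
by rewrite indicE; case: (boolP (_ \in _)); rewrite ?mul0r ?mul1r// inE.
Qed.

End expectation_toolkit.

(** * Independence and sums of independent variables *)

Section independent_pair.
Context {d d1 d2 : measure_display} {Omega : measurableType d}
  {T1 : measurableType d1} {T2 : measurableType d2} {R : realType}.
Variables (P : probability Omega R).
Variables (X : {RV P >-> T1}) (Y : {RV P >-> T2}).
Hypothesis XY : independent_RV P X Y.

Lemma measurable_pairing : measurable_fun setT (fun w => (X w, Y w)).
Proof. exact: measurable_fun_pair. Qed.

Let XYm : {mfun Omega >-> (T1 * T2)%type} :=
  HB.pack (fun w => (X w, Y w))
    (isMeasurableFun.Build _ _ _ _ _ measurable_pairing).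

(** The law of an independent pair is the product of the marginal laws, so that
    Tonelli's theorem applies. *)
Lemma independent_ge0_integral (f : T1 * T2 -> \bar R) :
  measurable_fun setT f -> (forall z, 0 <= f z)%E ->
  (\int[P]_w f (X w, Y w) =
   \int[distribution P X]_x \int[distribution P Y]_y f (x, y))%E.
Proof.
move=> mf f0.
rewrite -(fubini_tonelli1 (m1 := distribution P X) (m2 := distribution P Y) f)//.
rewrite (eq_measure_integral (distribution P XYm)).
  by rewrite ge0_integral_distribution.
by move=> A mA _; apply: product_measure_unique => // B C mB mC; exact: XY.
Qed.

Lemma independent_RintegralM (g : T1 -> R) (h : T2 -> R) :
  measurable_fun setT g -> measurable_fun setT h ->
  P.-integrable setT (EFin \o (fun w => g (X w))) ->
  P.-integrable setT (EFin \o (fun w => h (Y w))) ->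
  P.-integrable setT (EFin \o (fun w => g (X w) * h (Y w))) /\
  (\int[P]_w (g (X w) * h (Y w)))%R =
  (\int[P]_w g (X w) * \int[P]_w h (Y w))%R.
Proof.
move=> mg mh ig ih.
have mgh : measurable_fun setT (fun z : T1 * T2 => (g z.1 * h z.2)%:E).
  apply/measurable_EFinP; apply: measurable_funM; exact: measurableT_comp.
have igX : (distribution P X).-integrable setT (EFin \o g).
  by apply: integrable_pushforward => //; exact/measurable_EFinP.
have ihY : (distribution P Y).-integrable setT (EFin \o h).
  by apply: integrable_pushforward => //; exact/measurable_EFinP.
have igh : (distribution P X \x distribution P Y)%E.-integrable setT
    (fun z : T1 * T2 => (g z.1 * h z.2)%:E).
  apply/integrable12ltyP => //=.
  under eq_integral => x _ do
    (under eq_integral do rewrite normrM EFinM;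
     rewrite ge0_integralZl//; last by apply/measurable_EFinP/measurableT_comp).
  rewrite ge0_integralZr//; last 2 first.
  - exact/measurable_EFinP/measurableT_comp.
  - exact: integral_ge0.
  rewrite lte_mul_pinfty//.
  - exact: integral_ge0.
  - by have /integrableP[_] := igX; rewrite ge0_fin_numE//; exact: integral_ge0.
  - by have /integrableP[_] := ihY.
have ighP : P.-integrable setT (EFin \o (fun w => g (X w) * h (Y w))).
  apply/integrableP; split.
    apply/measurable_EFinP; apply: measurable_funM; exact: measurableT_comp.
  rewrite (independent_ge0_integral (f := fun z => `|(g z.1 * h z.2)%:E|%E))//;
    last by apply/measurableT_comp.
  by move/(integrable12ltyP (distribution P X) (distribution P Y) mgh) : igh.
split => //.
rewrite [RHS](_ : _ = (\int[distribution P X]_x g x *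
    \int[distribution P Y]_y h y)%R); last first.
  congr (_ * _)%R; rewrite /Rintegral integral_distribution//;
    exact/measurable_EFinP.
apply: EFin_inj; rewrite EFinM -!Rintegral_fine//.
transitivity (\int[distribution P XYm]_z (g z.1 * h z.2)%:E)%E.
  by rewrite integral_distribution.
rewrite -(eq_measure_integral (distribution P XYm)
  (m1 := (distribution P X \x distribution P Y)%E)); last first.
  by move=> A mA _; apply: product_measure_unique => // B C mB mC; exact: XY.
rewrite -integral12_prod_meas1// /fubini_F/=.
under eq_integral => x _.
  under eq_integral do rewrite EFinM.
  rewrite integralZl//.
over.
by rewrite Rintegral_fine// integralZr.
Qed.

End independent_pair.

Section past_sums.
Context {d d' : measure_display} {Omega : measurableType d}
  {T1 : measurableType d'} {R : realType}.
Variables (P : probability Omega R) (W : nat -> {RV P >-> T1}).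
Hypothesis Windep : mutually_independent P W.

Let past (n : nat) : set (set Omega) :=
  [set E | exists2 A : nat -> set T1, (forall j, measurable (A j)) &
    E = \bigcap_(j in [set` iota 0 n]) (W j @^-1` A j)].

Let past_measurable n : past n `<=` d.-measurable.
Proof.
move=> _ [A mA ->]; apply: fin_bigcap_measurable => [|j _]; first exact: finite_seq.
by rewrite -[X in measurable X]setTI; exact: measurable_funP.
Qed.

Let past_setI n : setI_closed (past n).
Proof.
move=> _ _ [A mA ->] [B mB ->]; exists (fun j => A j `&` B j).
  by move=> j; exact: measurableI.
by rewrite bigcapI.
Qed.

(** Mutual independence speaks of rectangles only; these are closed under
    intersection, so that two finite measures agreeing on them agree on the
    sigma-algebra of the past, to which the partial sum belongs. *)
Lemma past_sum_independent (f : T1 -> R) (n : nat) (A : set R) (B : set T1) :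
  measurable_fun setT f -> measurable A -> measurable B ->
  P ((fun w => \sum_(j < n) f (W j w)) @^-1` A `&` W n @^-1` B) =
  (P ((fun w => (\sum_(j < n) f (W j w))%R) @^-1` A) * P (W n @^-1` B))%E.
Proof.
move=> mf mA mB.
have mWB : measurable (W n @^-1` B).
  by rewrite -[X in measurable X]setTI; exact: measurable_funP.
have r0 : 0 <= fine (P (W n @^-1` B)) by exact: fine_ge0.
pose m1 := mrestr P mWB.
pose m2 := mscale (NngNum r0) P.
have pastT : past n setT.
  by exists (fun=> setT) => //; apply/esym; rewrite -subTset => w _ j _.
have m12 E : <<s past n >> E -> m1 E = m2 E.
  apply: (g_sigma_algebra_measure_unique (past n)
    (@past_measurable n) (fun=> setT)) => //.
  - by rewrite bigcup_const//.
  - move=> _ [C mC ->];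
    change (P (\bigcap_(j in [set` iota 0 n]) (W j @^-1` C j) `&` W n @^-1` B) =
      ((fine (P (W n @^-1` B)))%:E *
      P (\bigcap_(j in [set` iota 0 n]) (W j @^-1` C j)))%E).
    pose C' j := if j == n then B else C j.
    have mC' j : measurable (C' j) by rewrite /C'; case: ifP.
    have inC j : (j < n)%N -> C' j = C j by rewrite /C'; case: ltngtP.
    have memi a j : (j \in iota 0 a) = (j < a)%N by rewrite mem_iota.
    have E1 : \bigcap_(j in [set` iota 0 n]) (W j @^-1` C j) =
        \bigcap_(j in [set` iota 0 n]) (W j @^-1` C' j).
      by apply: eq_bigcapr => j; rewrite /mkset memi => /inC ->.
    have E2 : \bigcap_(j in [set` iota 0 n]) (W j @^-1` C j) `&` W n @^-1` B
        = \bigcap_(j in [set` iota 0 n.+1]) (W j @^-1` C' j).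
      rewrite E1; apply/seteqP; split => w.
        move=> [wC wB] j; rewrite /mkset memi ltnS leq_eqVlt.
        case/orP => [/eqP->|jn]; first by rewrite /preimage /mkset /C' eqxx.
        by apply: wC; rewrite /mkset memi.
      move=> wC; split=> [j|].
        by rewrite /mkset memi => jn; apply: wC; rewrite /mkset memi ltnW.
      by have := wC n; rewrite /mkset memi ltnSn /C' /preimage/= eqxx; exact.
    rewrite E2 E1 !Windep ?iota_uniq// -[in LHS]addn1 iotaD add0n big_cat/= big_seq1.
    by rewrite /C' eqxx fineK ?fin_num_measure// muleC.
  - by move=> _; rewrite /m1 /mrestr (le_lt_trans (probability_le1 _ _)) ?ltry//;
      exact: measurableI.
have mS : <<s past n >> ((fun w => \sum_(j < n) f (W j w)) @^-1` A).
  have : measurable_fun [set: g_sigma_algebraType (past n)]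
      (fun w : g_sigma_algebraType (past n) => \sum_(j < n) f (W j w)).
    apply: measurable_sum => j _ C mC; rewrite setTI.
    apply: sub_sigma_algebra.
    exists (fun i => if i == j :> nat then f @^-1` C else setT).
      by move=> i; case: ifP => // _; rewrite -[X in measurable X]setTI; exact: mf.
    apply/seteqP; split => w /=.
      by move=> Cw i _; case: ifP => // /eqP ->.
    by move=> /(_ j); rewrite /= eqxx mem_iota add0n ltn_ord; exact.
  by move=> /(_ measurableT _ mA); rewrite setTI.
transitivity (m2 ((fun w => \sum_(j < n) f (W j w)) @^-1` A)).
  exact: m12.
rewrite /m2/= /mscale/=.
by rewrite fineK ?fin_num_measure// muleC.
Qed.

End past_sums.

Section iid_sums.
Context {d d' : measure_display} {Omega : measurableType d}
  {T1 : measurableType d'} {R : realType}.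
Variables (P : probability Omega R) (W : nat -> {RV P >-> T1}).
Variable Q : probability T1 R.
Hypothesis Windep : mutually_independent P W.
Hypothesis Wlaw : forall j A, measurable A -> distribution P (W j) A = Q A.
Implicit Types f h : T1 -> R.

Lemma integrable_sqr_integrable f : measurable_fun setT f ->
  Q.-integrable setT (EFin \o (fun x => f x ^+ 2)) ->
  Q.-integrable setT (EFin \o f).
Proof.
move=> mf if2; apply: (@integrable_dominated _ _ _ Q _ (fun x => 1 + f x ^+ 2)) => //.
  move=> x; have : 0 <= (`|f x| - 1) ^+ 2 by exact: sqr_ge0.
  rewrite sqrrB real_normK ?num_real// => ?.
  have : 0 <= f x ^+ 2 by exact: sqr_ge0.
  have := normr_ge0 (f x); lra.
by apply: integrableDr => //; exact: integrable_cstr.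
Qed.

Lemma iid_integrable f j : measurable_fun setT f ->
  Q.-integrable setT (EFin \o f) ->
  P.-integrable setT (EFin \o (fun w => f (W j w))).
Proof.
move=> mf /integrableP[_ fi]; apply/integrableP; split.
  by apply/measurable_EFinP; exact: measurableT_comp.
rewrite -(ge0_integral_distribution (W j) (f := fun x => `|(f x)%:E|%E))//;
  last first.
  by apply/measurableT_comp => //; exact/measurable_EFinP.
by rewrite (eq_measure_integral Q)// => A mA _; exact: Wlaw.
Qed.

Lemma iid_Rintegral f j : measurable_fun setT f ->
  Q.-integrable setT (EFin \o f) ->
  (\int[P]_w f (W j w))%R = (\int[Q]_x f x)%R.
Proof.
move=> mf fi; have := iid_integrable j mf fi => fiP.
rewrite /Rintegral [in RHS](eq_measure_integral (distribution P (W j))).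
  by rewrite integral_distribution//; exact/measurable_EFinP.
by move=> A mA _; apply/esym; exact: Wlaw.
Qed.

Lemma measurable_iid_sum f n : measurable_fun setT f ->
  measurable_fun setT (fun w => \sum_(j < n) f (W j w)).
Proof. by move=> mf; apply: measurable_sum => j; exact: measurableT_comp. Qed.

(** The factorisation that kills the linear and the quadratic terms in
    Lindeberg's replacement argument. *)
Lemma past_sum_RintegralM f n (g : R -> R) h :
  measurable_fun setT f -> measurable_fun setT g -> measurable_fun setT h ->
  P.-integrable setT (EFin \o (fun w => g (\sum_(j < n) f (W j w)))) ->
  Q.-integrable setT (EFin \o h) ->
  P.-integrable setT (EFin \o (fun w => g (\sum_(j < n) f (W j w)) * h (W n w)))
  /\ (\int[P]_w (g (\sum_(j < n) f (W j w)) * h (W n w)))%R =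
     (\int[P]_w g (\sum_(j < n) f (W j w)) * \int[Q]_x h x)%R.
Proof.
move=> mf mg mh ig ih.
pose S : {mfun Omega >-> R} := HB.pack (fun w => \sum_(j < n) f (W j w))
  (isMeasurableFun.Build _ _ _ _ _ (measurable_iid_sum n mf)).
have SW : independent_RV P (S : {RV P >-> R}) (W n).
  by move=> A B mA mB; exact: past_sum_independent.
have [ii ->] := independent_RintegralM SW mg mh ig (iid_integrable n mh ih).
by rewrite iid_Rintegral.
Qed.

Lemma iid_sum_sqr f n : measurable_fun setT f ->
  Q.-integrable setT (EFin \o (fun x => f x ^+ 2)) ->
  (\int[Q]_x f x)%R = 0 ->
  P.-integrable setT (EFin \o (fun w => (\sum_(j < n) f (W j w)) ^+ 2)) /\
  (\int[P]_w (\sum_(j < n) f (W j w)) ^+ 2)%R =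
  n%:R * (\int[Q]_x f x ^+ 2)%R.
Proof.
move=> mf if2 f0.
have fi := integrable_sqr_integrable mf if2.
have mf2 : measurable_fun setT (fun x => f x ^+ 2) by exact: measurable_funX.
elim: n => [|n [IHi IHE]].
  have E : (fun w : Omega => (\sum_(j < 0) f (W j w)) ^+ 2) = fun=> 0.
    by apply/funext => w; rewrite big_ord0 expr0n.
  by rewrite E Rintegral_cst1 mul0r; split => //; exact: integrable_cstr.
pose S w := \sum_(j < n) f (W j w).
have E : (fun w => (\sum_(j < n.+1) f (W j w)) ^+ 2) =
  fun w => (S w ^+ 2 + 2 * (S w * f (W n w))) + f (W n w) ^+ 2.
  by apply/funext => w; rewrite big_ord_recr/= sqrrD -/(S w) mulr_natl.
have mS : measurable_fun setT S by exact: measurable_iid_sum.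
have iS : P.-integrable setT (EFin \o S).
  apply: (@integrable_dominated _ _ _ P _ (fun x => 1 + S x ^+ 2)) => //.
    move=> x; have : 0 <= (`|S x| - 1) ^+ 2 by exact: sqr_ge0.
    rewrite sqrrB real_normK ?num_real// => ?.
    have : 0 <= S x ^+ 2 by exact: sqr_ge0.
    have := normr_ge0 (S x); lra.
  by apply: integrableDr => //; exact: integrable_cstr.
have [iSf ESf] := past_sum_RintegralM (g := id) mf (@measurable_id _ _ _) mf iS fi.
have i2 := iid_integrable n mf2 if2.
have i3 := integrableZr 2 iSf.
have i4 := integrableDr IHi i3.
rewrite E; split; first exact: integrableDr.
rewrite RintegralD// RintegralD// RintegralZl// ESf f0 mulr0 mulr0 addr0.
by rewrite (iid_Rintegral n mf2 if2) IHE -natr1 mulrDl mul1r.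
Qed.

(** Chebyshev's inequality; the second moment bounds the variance. *)
Lemma iid_sum_deviation f n (e : R) : 0 < e -> measurable_fun setT f ->
  Q.-integrable setT (EFin \o (fun x => f x ^+ 2)) ->
  (P [set w | (e <= `|\sum_(j < n) f (W j w) - n%:R * \int[Q]_x f x|)%R]
  <= (n%:R * (\int[Q]_x f x ^+ 2) / e ^+ 2)%:E)%E.
Proof.
move=> e0 mf if2.
have fi := integrable_sqr_integrable mf if2.
set a := (\int[Q]_x f x)%R.
pose g x := f x - a.
have mg : measurable_fun setT g by exact: measurable_funB.
have gE : (fun x => g x ^+ 2) = fun x => (f x ^+ 2 - (2 * a) * f x) + a ^+ 2.
  by apply/funext => x; rewrite /g; ring.
have i1 := integrableZr (2 * a) fi.
have i2 := integrableBr if2 i1.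
have i3 := integrable_cstr Q (a ^+ 2).
have ig2 : Q.-integrable setT (EFin \o (fun x => g x ^+ 2)).
  by rewrite gE; exact: integrableDr.
have g0 : (\int[Q]_x g x)%R = 0.
  by rewrite RintegralB// ?Rintegral_cst1 ?subrr//; exact: integrable_cstr.
have g2 : (\int[Q]_x g x ^+ 2)%R <= (\int[Q]_x f x ^+ 2)%R.
  rewrite [X in Rintegral _ _ X]gE RintegralD// RintegralB// RintegralZl//.
  rewrite Rintegral_cst1 -/a; have := sqr_ge0 a; lra.
have [iS ES] := iid_sum_sqr n mg ig2 g0.
have e20 : 0 < e ^+ 2 by rewrite exprn_gt0.
rewrite (_ : [set w | _] = [set w | (e ^+ 2 <= (\sum_(j < n) g (W j w)) ^+ 2)%R]).
  apply: le_trans (markov_Rintegral e20 iS _) _ => [w|]; first exact: sqr_ge0.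
  rewrite ES lee_fin mulrC ler_wpM2r ?invr_ge0 ?(ltW e20)//.
  by rewrite ler_wpM2l.
apply/funext => w; rewrite /mkset.
rewrite big_split/= sumrN sumr_const card_ord -[a *+ n]mulr_natl.
rewrite -[in RHS](real_normK (x := \sum_(j < n) f (W j w) - n%:R * a)) ?num_real//.
by rewrite ler_sqr ?nnegrE ?(ltW e0).
Qed.

End iid_sums.

(** * The Gaussian distribution function *)

Section gaussian_cdf.
Context {R : realType}.
Local Notation mu := (@lebesgue_measure R).

Definition phi (x : R) : R := normal_pdf 0 1 x.

Definition Phi (x : R) : R := (\int[mu]_(t in `]-oo, x]) phi t)%R.

Lemma phiE x : phi x = normal_peak 1 * expR (- x ^+ 2 / 2).
Proof.
by rewrite /phi normal_pdfE ?oner_neq0// /normal_fun subr0 expr1n.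
Qed.

Lemma normal_cdf_Phi (x : R) : normal_prob 0 1 `]-oo, x] = (Phi x)%:E.
Proof.
rewrite /Phi /Rintegral -/(normal_prob 0 1 `]-oo, x]) fineK//.
exact: fin_num_measure.
Qed.

Lemma is_derive_Phi (x : R) : is_derive x (1 : R) Phi (phi x).
Proof.
have [d D] : derivable Phi x 1 /\ (Phi^`())%classic x = phi x.
  apply: (@continuous_FTC1 _ _ _ _ (x + 1)).
  - by rewrite ltrDl.
  - by apply: integrableS (integrable_normal_pdf 0 1) => //.
  - by rewrite ltNyr.
  - by apply: continuous_normal_pdf; rewrite oner_neq0.
apply: DeriveDef; first exact: d.
by rewrite -D derive1E.
Qed.

Lemma is_derive_phi (x : R) : is_derive x (1 : R) phi (- x * phi x).
Proof.
have -> : phi = fun x => normal_peak 1 * expR (- x ^+ 2 / 2).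
  by apply/funext => y; rewrite phiE.
apply: is_derive_eq.
by rewrite /GRing.scale/=; field.
Qed.


Lemma phi_ge0 x : 0 <= phi x. Proof. exact: normal_pdf_ge0. Qed.

(** The Gaussian density beats the cubic polynomials that appear in the
    derivatives of Phi up to order three. *)
Lemma cubic_phi_bounded : exists2 C : R, 0 < C & forall x,
  (1 + `|x|) ^+ 3 * phi x <= C.
Proof.
pose c := normal_peak (1 : R).
have c0 : 0 < c by apply: normal_peak_gt0; rewrite oner_neq0.
exists (64 * c); first by rewrite mulr_gt0.
move=> x; rewrite phiE mulrCA [leLHS]mulrC ler_pM2r//.
set t := `|x|; have t0 : 0 <= t by exact: normr_ge0.
rewrite -(real_normK (num_real x)) -/t mulNr expRN -ler_pdivlMr ?invr_gt0 ?expR_gt0//.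
rewrite invrK.
have e0 : 0 <= 1 + t ^+ 2 / 4 by rewrite addr_ge0// divr_ge0// sqr_ge0.
have E : (1 + t ^+ 2 / 4) ^+ 2 <= expR (t ^+ 2 / 2).
  rewrite (_ : t ^+ 2 / 2 = 2%:R * (t ^+ 2 / 4)); last by field.
  by rewrite expRM_natl ler_sqr ?nnegrE ?expR_ge0// expR_ge1Dx.
apply: (le_trans (y := 64 * (1 + t ^+ 2 / 4) ^+ 2)); last first.
  by rewrite ler_pM2l.
have [t1|t1] := leP t 1.
  apply: (le_trans (y := 64)).
    have : (1 + t) ^+ 3 <= 2 ^+ 3 by rewrite lerXn2r ?nnegrE; lra.
    lra.
  rewrite ler_peMr// exprn_ege1//; have := sqr_ge0 t; lra.
have : (1 + t) ^+ 3 <= (2 * t) ^+ 3 by rewrite lerXn2r ?nnegrE; lra.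
have : t ^+ 3 <= t ^+ 4.
  by rewrite exprS [leRHS]exprS ler_wpM2l// ler_eXn2l// ltW.
have := sqr_ge0 t; nra.
Qed.

End gaussian_cdf.

Section taylor.
Context {R : realType}.
Implicit Types f : R -> R.

Lemma mean_value_bound f f1 (D : set R) (B a b : R) : is_interval D ->
  (forall x, D x -> is_derive x (1 : R) f (f1 x)) ->
  (forall x, D x -> `|f1 x| <= B) -> D a -> D b ->
  `|f b - f a| <= B * `|b - a|.
Proof.
move=> iD df fB.
wlog ab : a b / a <= b => [H Da Db|Da Db].
  by have [/H|/ltW /H] := leP a b; [exact|rewrite distrC [`|b - a|]distrC; exact].
have Dab x : x \in `[a, b] -> D x.
  by rewrite in_itv/= => axb; exact: (iD a b).
have dfo x : x \in `]a, b[ -> is_derive x (1 : R) f (f1 x).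
  by move=> /subset_itv_oo_cc/Dab; exact: df.
have [|x xab ->] := MVT_segment ab dfo.
  by apply: derivable_within_continuous => x /Dab/df.
by rewrite normrM ler_wpM2r// fB//; exact: Dab.
Qed.

Lemma taylor_first_order f f1 f2 (D : set R) (B a b : R) : is_interval D ->
  (forall x, D x -> is_derive x (1 : R) f (f1 x)) ->
  (forall x, D x -> is_derive x (1 : R) f1 (f2 x)) ->
  (forall x, D x -> `|f2 x| <= B) -> D a -> D b ->
  `|f b - f a - f1 a * (b - a)| <= B * (b - a) ^+ 2.
Proof.
move=> iD df df1 fB Da Db.
pose E : set R := D `&` [set x | `|x - a| <= `|b - a|].
pose g y := f y - f1 a * y.
have iE : is_interval E.
  move=> x y [Dx xa] [Dy ya] z xzy; split; first exact: (iD x y).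
  move: xa ya xzy; rewrite /mkset !ler_norml; lra.
have := @mean_value_bound g (fun y => f1 y - f1 a) E (B * `|b - a|) a b iE.
rewrite /g => H.
have -> : f b - f a - f1 a * (b - a) = f b - f1 a * b - (f a - f1 a * a) by ring.
rewrite -[X in _ <= _ * X]real_normK ?num_real// expr2 mulrA.
apply: H => [x [Dx _]|x [Dx xa]||].
- have := df _ Dx => ?; apply: is_derive_eq.
  by rewrite /GRing.scale/= mulr1.
- apply: (le_trans (mean_value_bound iD df1 fB Da Dx)).
  by apply: ler_wpM2l => //; exact: le_trans (normr_ge0 _) (fB _ Da).
- by split => //=; rewrite subrr normr0.
- by split => /=.
Qed.

Lemma taylor_second_order f f1 f2 f3 (B a b : R) :
  (forall x, is_derive x (1 : R) f (f1 x)) ->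
  (forall x, is_derive x (1 : R) f1 (f2 x)) ->
  (forall x, is_derive x (1 : R) f2 (f3 x)) ->
  (forall x, `|f3 x| <= B) ->
  `|f b - f a - f1 a * (b - a) - f2 a / 2 * (b - a) ^+ 2| <= B * `|b - a| ^+ 3.
Proof.
move=> df df1 df2 fB.
pose E : set R := [set x | `|x - a| <= `|b - a|].
pose g y := f y - f1 a * y - f2 a / 2 * (y - a) ^+ 2.
have iE : is_interval E.
  by move=> x y xa ya z; move: xa ya; rewrite /E /mkset !ler_norml; lra.
have iT : is_interval [set: R] by [].
have := @mean_value_bound g (fun y => f1 y - f1 a - f2 a * (y - a)) E
   (B * `|b - a| ^+ 2) a b iE.
rewrite /g => H.
rewrite (_ : f b - f a - _ - _ = f b - f1 a * b - f2 a / 2 * (b - a) ^+ 2 -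
  (f a - f1 a * a - f2 a / 2 * (a - a) ^+ 2)); last by ring.
rewrite (_ : B * _ = B * `|b - a| ^+ 2 * `|b - a|); last by ring.
apply: H => [x _|x xa||].
- have := df x => ?; apply: is_derive_eq.
  by rewrite /GRing.scale/=; field.
- apply: (le_trans (taylor_first_order iT (fun x _ => df1 x) (fun x _ => df2 x)
    (fun x _ => fB x) I I)).
  rewrite -[(x - a) ^+ 2]real_normK ?num_real//; apply: ler_wpM2l.
    exact: le_trans (normr_ge0 _) (fB a).
  by rewrite lerXn2r ?nnegrE.
- by rewrite /E /mkset subrr normr0.
- by rewrite /E /mkset.
Qed.

End taylor.

Section heat.
Context {R : realType}.

(** For a normal variable N, u(b, a) = Phi(a / b) is the probability that
    b N <= a and solves the heat equation in the variance b^2: moving the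
    argument by a centred x of variance th has, up to third order, the same
    effect as adding th to the variance. Here b = 1, by scaling. *)
Lemma heat_step : exists2 C : R, 0 < C & forall v x th : R, 0 <= th <= 1 ->
  `|Phi (v - x) - Phi (v / Num.sqrt (1 + th)) + phi v * x
    + v * phi v / 2 * (x ^+ 2 - th)| <= C * (`|x| ^+ 3 + th ^+ 2).
Proof.
have [C C0 HC] := @cubic_phi_bounded R.
exists (9 * C); first by rewrite mulr_gt0.
move=> v x th /andP[th0 th1].
have cub (y : R) k : (k <= 3)%N -> `|y| ^+ k * phi y <= C.
  move=> k3; apply: le_trans (HC y); rewrite ler_wpM2r ?phi_ge0//.
  apply: (@le_trans _ _ ((1 + `|y|) ^+ k)).
    by rewrite lerXn2r ?nnegrE ?addr_ge0// lerDr.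
  by rewrite ler_weXn2l// lerDl.
have dphi2 (y : R) : is_derive y (1 : R) (fun y => - y * phi y)
    ((y ^+ 2 - 1) * phi y).
  have := is_derive_phi y => ?; apply: is_derive_eq.
  by rewrite /GRing.scale/=; ring.
have space : `|Phi (v - x) - Phi v - phi v * ((v - x) - v)
    - (- v * phi v) / 2 * ((v - x) - v) ^+ 2| <= C * `|(v - x) - v| ^+ 3.
  apply: (taylor_second_order _ _ (@is_derive_Phi R) (@is_derive_phi R) dphi2) => y.
  rewrite normrM (ger0_norm (phi_ge0 y)); apply: le_trans (HC y).
  rewrite ler_wpM2r ?phi_ge0// (le_trans (ler_normB _ _))// normr1 normrX.
  have := normr_ge0 y; set t := `|y| => t0.
  have := exprn_ge0 3 t0; nra.
pose r : R := (Num.sqrt (1 + th))^-1.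
have q2 : Num.sqrt (1 + th) ^+ 2 = 1 + th by rewrite sqr_sqrtr//; lra.
have q1 : 1 <= Num.sqrt (1 + th).
  by rewrite -[leLHS]sqrtr1 ler_wsqrtr//; lra.
have q0 : 0 < Num.sqrt (1 + th) by lra.
have rq : r * Num.sqrt (1 + th) = 1 by rewrite mulVf// gt_eqF.
have r1 : r <= 1 by rewrite invf_le1.
have r0 : 0 < r by rewrite invr_gt0.
have r12 : 2^-1 <= r by rewrite lef_pV2 ?posrE//; nra.
have time : `|Phi (v * r) - Phi (v * 1) - (v * phi (v * 1)) * (r - 1)|
    <= (8 * C) * (r - 1) ^+ 2.
  pose D : set R := [set s | 2^-1 <= s <= 1].
  have dm (s : R) : is_derive s (1 : R) ( *%R v) v.
    by apply: is_derive_eq; rewrite /GRing.scale/= mulr1.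
  apply: (@taylor_first_order _ (fun s => Phi (v * s)) (fun s => v * phi (v * s))
    (fun s => v * (v * (- (v * s) * phi (v * s)))) D) => //.
  - by move=> s t; rewrite /D /mkset => ? ? u; lra.
  - move=> s _; have := is_derive1_comp (is_derive_Phi (v * s)) (dm s).
    by rewrite mulrC.
  - move=> s _; have ? := is_derive1_comp (is_derive_phi (v * s)) (dm s).
    apply: is_derive_eq; rewrite /GRing.scale/=; ring.
  - move=> s; rewrite /D /mkset => /andP[s2 s1].
    rewrite !normrM normrN (ger0_norm (phi_ge0 _)).
    have vs : `|v| <= 2 * `|v * s|.
      rewrite normrM (ger0_norm (_ : 0 <= s)); last lra.
      have := normr_ge0 v; nra.
    have := cub (v * s) 3%N isT; move=> H.
    apply: (@le_trans _ _ (8 * (`|v * s| ^+ 3 * phi (v * s)))); last by rewrite ler_pM2l.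
    have h0 := normr_ge0 v; have h1 := normr_ge0 (v * s).
    rewrite [leLHS](_ : _ = `|v| * `|v| * (`|v * s| * phi (v * s))); last by ring.
    rewrite [leRHS](_ : _ = (8 * (`|v * s| * `|v * s|)) * (`|v * s| * phi (v * s)));
      last by ring.
    apply: ler_wpM2r; first by rewrite mulr_ge0// phi_ge0.
    by nra.
  - by rewrite /D /mkset; lra.
  - by rewrite /D /mkset r12 r1.
have rth : `|r - 1 + th / 2| <= th ^+ 2 /\ `|r - 1| <= th.
  set q := Num.sqrt _ in q2 q1 q0 rq.
  have E : r - 1 + th / 2 = (q - 1) ^+ 2 * ((q + 2) / 2 * r).
    have -> : th = q ^+ 2 - 1 by lra.
    have -> : r = q^-1 by [].
    by field; rewrite gt_eqF.
  have q12 : q - 1 <= th / 2 by nra.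
  split; last by rewrite ler0_norm; nra.
  rewrite E ger0_norm; last first.
    by rewrite mulr_ge0 ?sqr_ge0// mulr_ge0 ?(ltW r0)//; lra.
  have : (q + 2) / 2 * r <= 2 by nra.
  have : (q - 1) ^+ 2 <= th ^+ 2 / 4 by nra.
  have : 0 <= (q + 2) / 2 * r by rewrite mulr_ge0 ?(ltW r0)//; lra.
  have := sqr_ge0 (q - 1); nra.
move: rth => [rth rth2].
rewrite !mulr1 in time; rewrite -/r.
rewrite (_ : _ + _ = (Phi (v - x) - Phi v - phi v * ((v - x) - v)
    - (- v * phi v) / 2 * ((v - x) - v) ^+ 2)
   - (Phi (v * r) - Phi v - (v * phi v) * (r - 1))
   - (v * phi v) * (r - 1 + th / 2)); last by field.
apply: (le_trans (ler_normB _ _)).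
apply: (le_trans (lerD (ler_normB _ _) (lexx _))).
have vphi : `|v * phi v| <= C.
  by rewrite normrM (ger0_norm (phi_ge0 _)); have := cub v 1%N isT; rewrite expr1.
have e1 : (v - x) - v = - x by ring.
rewrite e1 normrN in space; rewrite e1.
have p1 : `|v * phi v * (r - 1 + th / 2)| <= C * th ^+ 2.
  by rewrite normrM ler_pM.
have p2 : (r - 1) ^+ 2 <= th ^+ 2.
  by rewrite -[leLHS]real_normK ?num_real// lerXn2r ?nnegrE.
have := exprn_ge0 3 (normr_ge0 x).
nra.
Qed.

End heat.

(** * The central limit theorem for triangular arrays *)

Section Phi_bounds.
Context {R : realType}.
Implicit Types x y : R.

Lemma Phi_ge0 x : 0 <= Phi x.
Proof. by rewrite -lee_fin -normal_cdf_Phi. Qed.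

Lemma Phi_le1 x : Phi x <= 1.
Proof. by rewrite -lee_fin -normal_cdf_Phi; exact: probability_le1. Qed.

Lemma normr_Phi_le1 x : `|Phi x| <= 1.
Proof. by rewrite ger0_norm ?Phi_ge0 ?Phi_le1. Qed.

Lemma Phi_nondecreasing x y : x <= y -> Phi x <= Phi y.
Proof.
move=> xy; rewrite -lee_fin -!normal_cdf_Phi; apply: le_measure; rewrite ?inE//.
by apply: subset_itvl; rewrite bnd_simp.
Qed.

Lemma continuous_Phi : continuous (@Phi R).
Proof.
move=> x; apply/differentiable_continuous/derivable1_diffP.
by have [] := is_derive_Phi x.
Qed.

Lemma measurable_Phi : measurable_fun setT (@Phi R).
Proof. by apply: nondecreasing_measurable => // x y; exact: Phi_nondecreasing. Qed.

Lemma cvg_Phi_pinfty : Phi x @[x --> +oo] --> (1 : R).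
Proof.
have mid : measurable_fun setT (fun x : measurableTypeR R => (x : R)).
  exact: measurable_id.
pose X : {mfun measurableTypeR R >-> R} :=
  HB.pack (fun x : measurableTypeR R => (x : R)) (isMeasurableFun.Build _ _ _ _ _ mid).
have := cvg_cdfy1 (X : {RV (normal_prob (0 : R) 1) >-> R}).
rewrite (_ : cdf _ = EFin \o @Phi R); last first.
  by apply/funext => x; rewrite /= -normal_cdf_Phi.
by move/fine_cvgP => [].
Qed.

Lemma cvg_Phi_ninfty : Phi x @[x --> -oo] --> (0 : R).
Proof.
have mid : measurable_fun setT (fun x : measurableTypeR R => (x : R)).
  exact: measurable_id.
pose X : {mfun measurableTypeR R >-> R} :=
  HB.pack (fun x : measurableTypeR R => (x : R)) (isMeasurableFun.Build _ _ _ _ _ mid).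
have := cvg_cdfNy0 (X : {RV (normal_prob (0 : R) 1) >-> R}).
rewrite (_ : cdf _ = EFin \o @Phi R); last first.
  by apply/funext => x; rewrite /= -normal_cdf_Phi.
by move/fine_cvgP => [].
Qed.

End Phi_bounds.

Section lindeberg.
Context {d d' : measure_display} {Omega : measurableType d}
  {T1 : measurableType d'} {R : realType}.
Variables (P : probability Omega R) (W : nat -> {RV P >-> T1}).
Variable Q : probability T1 R.
Hypothesis Windep : mutually_independent P W.
Hypothesis Wlaw : forall j A, measurable A -> distribution P (W j) A = Q A.

Lemma integrable_cube_sqr (f : T1 -> R) : measurable_fun setT f ->
  Q.-integrable setT (EFin \o (fun x => `|f x| ^+ 3)) ->
  Q.-integrable setT (EFin \o (fun x => f x ^+ 2)).
Proof.
move=> mf f3; apply: (@integrable_dominated _ _ _ Q _ (fun x => 1 + `|f x| ^+ 3)).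
- exact: measurable_funX.
- move=> x; rewrite normrX; have := normr_ge0 (f x); set t := `|f x| => t0.
  have [t1|t1] := leP t 1.
    have : t ^+ 2 <= 1 by rewrite exprn_ile1.
    have := exprn_ge0 3 t0; lra.
  have : t ^+ 2 <= t ^+ 3 by rewrite ler_eXn2l// ltW.
  lra.
- by apply: integrableDr => //; exact: integrable_cstr.
Qed.

(** One summand at a time is exchanged for Gaussian variance, each exchange
    costing what heat_step allows; the initial variance b^2 keeps the test
    function smooth. *)
Lemma lindeberg_replacement : exists2 C : R, 0 < C &
  forall (f : T1 -> R) (a b : R) (n : nat),
  measurable_fun setT f ->
  Q.-integrable setT (EFin \o (fun x => `|f x| ^+ 3)) ->
  (\int[Q]_x f x)%R = 0 -> 0 < b -> (\int[Q]_x f x ^+ 2)%R <= b ^+ 2 ->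
  `|(\int[P]_w Phi ((a - \sum_(j < n) f (W j w)) / b))%R -
    Phi (a / Num.sqrt (b ^+ 2 + n%:R * \int[Q]_x f x ^+ 2))| <=
  C * n%:R * ((\int[Q]_x `|f x| ^+ 3)%R / b ^+ 3 +
              (\int[Q]_x f x ^+ 2)%R ^+ 2 / b ^+ 4).
Proof.
have [C C0 HC] := @heat_step R.
have [C' C'0 HC'] := @cubic_phi_bounded R.
exists C => // f a b n mf f3 f0.
have f2 := integrable_cube_sqr mf f3.
have f1 := integrable_sqr_integrable mf f2.
set tau := (\int[Q]_x f x ^+ 2)%R; set m3 := (\int[Q]_x `|f x| ^+ 3)%R.
have tau0 : 0 <= tau by apply: Rintegral_ge0 => x _; exact: sqr_ge0.
have m30 : 0 <= m3 by apply: Rintegral_ge0 => x _; exact: exprn_ge0.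
elim: n b => [|n IHn] b b0 taub.
  rewrite mul0r addr0 mulr0 mul0r sqrtr_sqr (gtr0_norm b0).
  under eq_Rintegral do rewrite big_ord0 subr0.
  by rewrite Rintegral_cst1 subrr normr0.
pose S w := \sum_(j < n) f (W j w).
have mS : measurable_fun setT S by exact: (measurable_iid_sum W n mf).
pose v (s : R) := (a - s) / b.
have mv : measurable_fun setT v.
  by apply: measurable_funM => //; exact: measurable_funB.
pose th := tau / b ^+ 2.
have b20 : 0 < b ^+ 2 by rewrite exprn_gt0.
have th0 : 0 <= th by rewrite divr_ge0// ltW.
have th1 : th <= 1 by rewrite ler_pdivrMr// mul1r.
pose b' := Num.sqrt (b ^+ 2 + tau).
have b'E : b' = b * Num.sqrt (1 + th).
  rewrite /b'; have -> : b ^+ 2 + tau = b ^+ 2 * (1 + th).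
    by rewrite /th; field; rewrite gt_eqF.
  by rewrite sqrtrM ?sqr_ge0// sqrtr_sqr gtr0_norm.
have b'0 : 0 < b' by rewrite sqrtr_gt0; lra.
have bb' : b <= b' by rewrite /b' -[leLHS]gtr0_norm// -sqrtr_sqr ler_wsqrtr//; lra.
have b'2 : b' ^+ 2 = b ^+ 2 + tau by rewrite sqr_sqrtr//; lra.
have taub' : tau <= b' ^+ 2 by rewrite b'2; lra.
have := IHn b' b'0 taub'; rewrite b'2 => IH.
pose x (z : T1) := f z / b.
have mx : measurable_fun setT x by exact: measurable_funM.
pose h2 (z : T1) := (b ^- 2) * f z ^+ 2 - th.
have mphi : measurable_fun setT (@phi R) by exact: measurable_normal_pdf.
have mphiv : measurable_fun setT (fun s => phi (v s)) by exact: measurableT_comp.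
have mvphiv : measurable_fun setT (fun s => v s * phi (v s) / 2).
  by apply: measurable_funM => //; exact: measurable_funM.
have mh2 : measurable_fun setT h2.
  by apply: measurable_funB => //; apply: measurable_funM => //; exact: measurable_funX.
have ix : Q.-integrable setT (EFin \o x).
  have := integrableZr b^-1 f1; apply: eq_integrable => // z _.
  by rewrite /= mulrC.
have ih2 : Q.-integrable setT (EFin \o h2).
  by apply: integrableBr; [exact: integrableZr|exact: integrable_cstr].
have ex : (\int[Q]_z x z)%R = 0 by rewrite RintegralZr// f0 mul0r.
have eh2 : (\int[Q]_z h2 z)%R = 0.
  rewrite RintegralB//; last 2 first.
  - exact: integrableZr.
  - exact: integrable_cstr.
  by rewrite RintegralZl// Rintegral_cst1 -/tau /th mulrC subrr.
have cub (y : R) k : (k <= 3)%N -> `|y| ^+ k * phi y <= C'.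
  move=> k3; apply: le_trans (HC' y); rewrite ler_wpM2r ?phi_ge0//.
  apply: (@le_trans _ _ ((1 + `|y|) ^+ k)).
    by rewrite lerXn2r ?nnegrE ?addr_ge0// lerDr.
  by rewrite ler_weXn2l// lerDl.
have i1 : P.-integrable setT (EFin \o (fun w => phi (v (S w)))).
  apply: (@integrable_bounded _ _ _ P _ C').
    by apply: (measurableT_comp mphiv).
  move=> w; rewrite ger0_norm ?phi_ge0//.
  by have := cub (v (S w)) 0%N isT; rewrite expr0 mul1r.
have i2 : P.-integrable setT (EFin \o (fun w => v (S w) * phi (v (S w)) / 2)).
  apply: (@integrable_bounded _ _ _ P _ C').
    by apply: (measurableT_comp mvphiv).
  move=> w; rewrite normrM [X in X * _]normrM (ger0_norm (phi_ge0 _)) (ger0_norm (_ : 0 <= 2^-1))//.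
  have := cub (v (S w)) 1%N isT; rewrite expr1.
  have : 0 <= `|v (S w)| * phi (v (S w)) by rewrite mulr_ge0// phi_ge0.
  lra.
have [j1 e1] := past_sum_RintegralM Windep Wlaw mf mphiv mx i1 ix.
have [j2 e2] := past_sum_RintegralM Windep Wlaw mf mvphiv mh2 i2 ih2.
rewrite ex mulr0 in e1; rewrite eh2 mulr0 in e2.
have mPhi (c e : R) (g : Omega -> R) : measurable_fun setT g ->
    P.-integrable setT (EFin \o (fun w => Phi ((c - g w) / e))).
  move=> mg; apply: (@integrable_bounded _ _ _ P _ 1) => [|w].
    apply: (measurableT_comp measurable_Phi).
    by apply: measurable_funM => //; exact: measurable_funB.
  exact: normr_Phi_le1.
have k1 := mPhi a b _ (measurable_iid_sum W n.+1 mf).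
have k2 := mPhi a b' _ mS.
pose E w := (Phi ((a - \sum_(j < n.+1) f (W j w)) / b) - Phi ((a - S w) / b'))
  + phi (v (S w)) * x (W n w) + v (S w) * phi (v (S w)) / 2 * h2 (W n w).
have l1 := integrableBr k1 k2.
have l2 := integrableDr l1 j1.
have iE : P.-integrable setT (EFin \o E) by exact: (integrableDr l2 j2).
have EE : (\int[P]_w E w)%R =
    (\int[P]_w Phi ((a - \sum_(j < n.+1) f (W j w)) / b))%R -
    (\int[P]_w Phi ((a - S w) / b'))%R.
  by rewrite (RintegralD measurableT l2 j2) (RintegralD measurableT l1 j1)
    (RintegralB measurableT k1 k2) e1 e2 !addr0.
have Ele w : `|E w| <= C * (`|x (W n w)| ^+ 3 + th ^+ 2).
  have := HC (v (S w)) (x (W n w)) th; rewrite th0 th1 => /(_ isT).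
  rewrite /E /S big_ord_recr/= -/(S w) (_ : (a - _) / b = v (S w) - x (W n w)).
    rewrite (_ : h2 _ = x (W n w) ^+ 2 - th).
      by rewrite (_ : (a - S w) / b' = v (S w) / Num.sqrt (1 + th))// b'E /v invfM mulrA.
    by rewrite /h2 /x expr_div_n mulrC.
  by rewrite /v /x; field; rewrite gt_eqF.
have x3 z : `|x z| ^+ 3 = (b ^- 3) * `|f z| ^+ 3.
  by rewrite /x normrM normfV (gtr0_norm b0) exprMn exprVn mulrC.
have mf3 : measurable_fun setT (fun z => `|f z| ^+ 3).
  by apply: measurable_funX; exact: measurableT_comp.
have if3 := iid_integrable Wlaw n mf3 f3.
have step : `|(\int[P]_w E w)%R| <= C * (m3 / b ^+ 3 + th ^+ 2).
  have n1 := integrableZr (b ^- 3) if3.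
  have n2 := integrableDr n1 (integrable_cstr P (th ^+ 2)).
  have n3 := integrableZr C n2.
  apply: (le_trans (le_normr_Rintegral measurableT iE)).
  apply: (@le_trans _ _ (\int[P]_w (C * (b ^- 3 * `|f (W n w)| ^+ 3 + th ^+ 2)))%R).
    apply: le_Rintegral => //.
    - by move: iE => /integrable_norm; apply: eq_integrable.
    - by move=> w _; rewrite -x3.
  rewrite (RintegralZl _ measurableT n2).
  rewrite (RintegralD measurableT n1 (integrable_cstr P (th ^+ 2))).
  rewrite (RintegralZl _ measurableT if3) Rintegral_cst1.
  by rewrite (iid_Rintegral Wlaw n mf3 f3) -/m3 (mulrC (b ^- 3)).
rewrite -natr1.
rewrite (_ : b ^+ 2 + _ = b ^+ 2 + tau + n%:R * tau); last by ring.
have th2 : th ^+ 2 = tau ^+ 2 / b ^+ 4.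
  by rewrite /th expr_div_n -exprM.
rewrite th2 in step; rewrite EE in step.
have mono : m3 / b' ^+ 3 + tau ^+ 2 / b' ^+ 4 <= m3 / b ^+ 3 + tau ^+ 2 / b ^+ 4.
  by apply: lerD; apply: ler_wpM2l; rewrite ?sqr_ge0// lef_pV2 ?posrE ?exprn_gt0//;
    rewrite lerXn2r ?nnegrE// ltW.
have IH' : `|(\int[P]_w Phi ((a - S w) / b'))%R -
    Phi (a / Num.sqrt (b ^+ 2 + tau + n%:R * tau))| <=
    C * n%:R * (m3 / b ^+ 3 + tau ^+ 2 / b ^+ 4).
  by apply: (le_trans IH); rewrite ler_wpM2l// mulr_ge0// ltW.
set B := m3 / b ^+ 3 + _ in step IH' *.
rewrite (_ : C * _ * B = C * n%:R * B + C * B); last by ring.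
rewrite -(subrKA ((\int[P]_w Phi ((a - S w) / b'))%R)).
by rewrite (le_trans (ler_normD _ _))// addrC lerD.
Qed.

End lindeberg.

Lemma cvg_near_eq {R : realType} {T : Type} {F : set_system T} {FF : Filter F}
    (f g : T -> R) (l l' : R) :
  f x @[x --> F] --> l -> l = l' -> (\forall x \near F, f x = g x) ->
  g x @[x --> F] --> l'.
Proof. by move=> fl <- fg; apply: cvg_trans fl; exact: near_eq_cvg. Qed.

Section triangular_clt.
Context {d d' : measure_display} {Omega : measurableType d}
  {T1 : measurableType d'} {R : realType}.
Variables (P : probability Omega R) (W : nat -> {RV P >-> T1}).
Variable Q : probability T1 R.
Hypothesis Windep : mutually_independent P W.
Hypothesis Wlaw : forall j A, measurable A -> distribution P (W j) A = Q A.
Variables (f : nat -> T1 -> R) (s : R).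
Hypothesis s0 : 0 < s.
Hypothesis mf : forall n, measurable_fun setT (f n).
Hypothesis f3 : \forall n \near \oo,
  Q.-integrable setT (EFin \o (fun x => `|f n x| ^+ 3)).
Hypothesis f0 : \forall n \near \oo, (\int[Q]_x f n x)%R = 0.
Hypothesis lyapunov : n%:R * (\int[Q]_x `|f n x| ^+ 3)%R @[n --> \oo] --> (0 : R).
Hypothesis var : n%:R * (\int[Q]_x f n x ^+ 2)%R @[n --> \oo] --> s ^+ 2.

Let S n w : R := \sum_(j < n) f n (W j w).

Let mS n : measurable_fun setT (S n).
Proof. exact: (measurable_iid_sum W n (mf n)). Qed.

Let cvg_invn : (n%:R^-1 : R) @[n --> \oo] --> (0 : R).
Proof.
apply/gtr0_cvgV0; last exact: cvgr_idn.
by near=> n; rewrite ltr0n; near: n; exact: nbhs_infty_gt.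
Unshelve. all: by end_near. Qed.

Let tau_cvg0 : (\int[Q]_x f n x ^+ 2)%R @[n --> \oo] --> (0 : R).
Proof.
apply: (cvg_near_eq (cvgM cvg_invn var)); first by rewrite mul0r.
near=> n; rewrite /= mulrA mulVf ?mul1r// pnatr_eq0 -lt0n.
by near: n; exact: nbhs_infty_gt.
Unshelve. all: by end_near. Qed.

Let smooth_cvg (a b : R) : 0 < b ->
  (\int[P]_w Phi ((a - S n w) / b))%R @[n --> \oo] -->
  Phi (a / Num.sqrt (b ^+ 2 + s ^+ 2)).
Proof.
move=> b0; have [C C0 HC] := lindeberg_replacement Windep Wlaw.
pose tau n := (\int[Q]_x f n x ^+ 2)%R.
pose m3 n := (\int[Q]_x `|f n x| ^+ 3)%R.
have main : Phi (a / Num.sqrt (b ^+ 2 + n%:R * tau n)) @[n --> \oo] -->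
    Phi (a / Num.sqrt (b ^+ 2 + s ^+ 2)).
  apply: continuous_cvg; first exact: continuous_Phi.
  apply: cvgMl_tmp; apply: cvgV.
    by rewrite gt_eqF// sqrtr_gt0 addr_gt0 ?exprn_gt0.
  apply: continuous_cvg; first exact: sqrt_continuous.
  by apply: cvgD; [exact: cvg_cst|exact: var].
have err : C * n%:R * (m3 n / b ^+ 3 + tau n ^+ 2 / b ^+ 4) @[n --> \oo] --> (0 : R).
  have H1 : C / b ^+ 3 * (n%:R * m3 n) @[n --> \oo] --> C / b ^+ 3 * 0.
    exact: cvgMl_tmp.
  have H2 : C / b ^+ 4 * (n%:R * tau n * tau n) @[n --> \oo] -->
      C / b ^+ 4 * (s ^+ 2 * 0).
    by apply: cvgMl_tmp; exact: cvgM.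
  apply: (cvg_near_eq (cvgD H1 H2)); first by rewrite !mulr0 addr0.
  near=> n.
  by rewrite /= -/(tau n) -/(m3 n); field; rewrite gt_eqF.
have diff : (\int[P]_w Phi ((a - S n w) / b))%R -
    Phi (a / Num.sqrt (b ^+ 2 + n%:R * tau n)) @[n --> \oo] --> (0 : R).
  apply/norm_cvg0P.
  apply: (squeeze_cvgr _ (cvg_cst (0 : R)) err).
  near=> n; rewrite normr_ge0/=; apply: HC => //; near: n => //.
  have b20 : 0 < b ^+ 2 by rewrite exprn_gt0.
  by apply: (filterS _ (cvgr_lt (0 : R) tau_cvg0 (b ^+ 2) b20)) => n /ltW.
apply: (cvg_near_eq (cvgD diff main)); first by rewrite add0r.
by near=> n; rewrite /= subrK.
Unshelve. all: by end_near. Qed.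

Let mev n y : measurable [set w | S n w <= y].
Proof. by rewrite -[X in measurable X]setTI; exact: measurable_fun_le. Qed.

Let sandwich3 (e L p U1 U2 E1 E2 q1 q0 : R) :
  `|L - U1| <= e / 3 -> `|L - U2| <= e / 3 -> `|0 - q1| <= e / 3 ->
  `|0 - q0| <= e / 3 -> `|U1 - E1| <= e / 3 -> `|U2 - E2| <= e / 3 ->
  E2 - q0 <= p -> p <= E1 + q1 -> `|L - p| <= e.
Proof.
by rewrite !ler_norml => /andP[? ?] /andP[? ?] /andP[? ?] /andP[? ?] /andP[? ?]
  /andP[? ?] ? ?; apply/andP; split; lra.
Qed.

(** Lyapunov's theorem. The indicator of S <= y is bracketed between
    Phi ((y - eta - S) / eta^2) and Phi ((y + eta - S) / eta^2), up to a term
    Phi (- 1 / eta): a bandwidth eta^2 much smaller than the shift eta makes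
    the smoothing error vanish with eta. *)
Lemma triangular_clt (y : R) :
  fine (P [set w | \sum_(j < n) f n (W j w) <= y]) @[n --> \oo] --> Phi (y / s).
Proof.
have iPhi a b n : P.-integrable setT (EFin \o (fun w => Phi ((a - S n w) / b))).
  apply: (@integrable_bounded _ _ _ P _ 1) => [|w]; last exact: normr_Phi_le1.
  apply: (measurableT_comp measurable_Phi).
  by apply: measurable_funM => //; exact: measurable_funB.
have i1 n : P.-integrable setT (EFin \o \1_[set w | S n w <= y]).
  apply: (@integrable_bounded _ _ _ P _ 1) => [|w]; first exact: measurable_indic.
  by rewrite indicE; case: (_ \in _); rewrite ?normr0 ?normr1.
have ub n eta : 0 < eta -> fine (P [set w | S n w <= y]) <=
    (\int[P]_w Phi ((y + eta - S n w) / eta ^+ 2))%R + (1 - Phi (eta^-1)).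
  move=> eta0; rewrite -Rintegral_indic//.
  rewrite -[X in _ <= _ + X](Rintegral_cst1 P).
  rewrite -RintegralD//; last exact: integrable_cstr.
  apply: le_Rintegral => // [|w _].
    by apply: integrableDr; [exact: iPhi|exact: integrable_cstr].
  rewrite indicE; case: (boolP (_ \in _)) => [|_].
    rewrite inE/= => Sy; rewrite addrCA lerDl subr_ge0.
    apply: Phi_nondecreasing; rewrite ler_pdivlMr ?exprn_gt0// expr2 mulKf ?gt_eqF//.
    lra.
  by rewrite addr_ge0 ?Phi_ge0// subr_ge0 Phi_le1.
have lb n eta : 0 < eta ->
    (\int[P]_w Phi ((y - eta - S n w) / eta ^+ 2))%R - Phi (- eta^-1) <=
    fine (P [set w | S n w <= y]).
  move=> eta0; rewrite -Rintegral_indic//.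
  rewrite -[X in _ - X <= _](Rintegral_cst1 P).
  rewrite -RintegralB//; last exact: integrable_cstr.
  apply: le_Rintegral => // [|w _].
    by apply: integrableBr; [exact: iPhi|exact: integrable_cstr].
  rewrite indicE; case: (boolP (_ \in _)) => [_|].
    by have := Phi_le1 ((y - eta - S n w) / eta ^+ 2); have := Phi_ge0 (- eta^-1);
      rewrite /=; lra.
  rewrite notin_setE/= => /negP; rewrite -ltNge => Sy; rewrite subr_le0.
  apply: Phi_nondecreasing; rewrite ler_pdivrMr ?exprn_gt0// expr2 mulNr mulKf ?gt_eqF//.
  lra.
apply/cvgrPdist_le => e e0.
have e3 : 0 < e / 3 by lra.
have eta_cvg : eta @[eta --> (0:R)^'+] --> (0 : R) by exact: cvg_at_right_filter.
have lim_arg (c : R) : Phi ((y + c * eta) / Num.sqrt ((eta ^+ 2) ^+ 2 + s ^+ 2))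
    @[eta --> (0:R)^'+] --> Phi (y / s).
  apply: continuous_cvg; first exact: continuous_Phi.
  apply: cvgM.
    rewrite -[X in _ --> X]addr0; apply: cvgD; first exact: cvg_cst.
    by rewrite -[X in _ --> X](mulr0 c); apply: cvgMl_tmp; exact: eta_cvg.
  apply: cvgV; first by rewrite gt_eqF.
  rewrite -[X in _ --> X](gtr0_norm s0) -sqrtr_sqr.
  apply: continuous_cvg; first exact: sqrt_continuous.
  rewrite -[X in _ --> X]add0r; apply: cvgD; last exact: cvg_cst.
  have c2 := cvgM eta_cvg eta_cvg.
  by apply: (cvg_near_eq (cvgM (c2 _) (c2 _))); rewrite ?mulr0//; near=> eta.
have invy : eta^-1 @[eta --> (0:R)^'+] --> +oo.
  apply/gtr0_cvgV0; first by near=> eta; rewrite invr_gt0.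
  by apply: (cvg_near_eq eta_cvg) => //; near=> eta; rewrite invrK.
have P1 : 1 - Phi eta^-1 @[eta --> (0:R)^'+] --> (0 : R).
  rewrite -[X in _ --> X](subrr 1); apply: cvgB; first exact: cvg_cst.
  exact: (cvg_comp _ _ invy cvg_Phi_pinfty).
have P0 : Phi (- eta^-1) @[eta --> (0:R)^'+] --> (0 : R).
  have invNy : (- (fun eta : R => eta^-1)) eta @[eta --> (0:R)^'+] --> -oo.
    exact/cvgNrNy.
  exact: (cvg_comp _ _ invNy cvg_Phi_ninfty).
have [eta [eta0 h1 h2 h3 h4]] : exists eta : R, [/\ 0 < eta,
    `|Phi (y / s) - Phi ((y + 1 * eta) / Num.sqrt ((eta ^+ 2) ^+ 2 + s ^+ 2))| <= e / 3,
    `|Phi (y / s) - Phi ((y + -1 * eta) / Num.sqrt ((eta ^+ 2) ^+ 2 + s ^+ 2))| <= e / 3,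
    `|0 - (1 - Phi eta^-1)| <= e / 3 & `|0 - Phi (- eta^-1)| <= e / 3].
  near ((0 : R)^'+) => eta; exists eta; split => //.
  - near: eta; move/cvgrPdist_le : (lim_arg 1); exact.
  - near: eta; move/cvgrPdist_le : (lim_arg (-1)); exact.
  - near: eta; move/cvgrPdist_le : P1; exact.
  - near: eta; move/cvgrPdist_le : P0; exact.
rewrite mul1r in h1; rewrite mulN1r in h2.
have b0 : 0 < eta ^+ 2 by rewrite exprn_gt0.
have K1 := @smooth_cvg (y + eta) _ b0.
have K2 := @smooth_cvg (y - eta) _ b0.
move/cvgrPdist_le : K1 => /(_ _ e3) K1; move/cvgrPdist_le : K2 => /(_ _ e3) K2.
apply: filterS2 K1 K2 => n k1 k2.
have := ub n _ eta0; have := lb n _ eta0.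
exact: (sandwich3 h1 h2 h3 h4 k1 k2).
Unshelve. all: by end_near. Qed.

End triangular_clt.

Section normal_cdf.
Context {R : realType}.
Local Notation mu := (@lebesgue_measure R).

Let is_derive_normal_cdf (m s x : R) : s != 0 ->
  is_derive x (1 : R) (fun y => \int[mu]_(t in `]-oo, y]) normal_pdf m s t)%R
    (normal_pdf m s x).
Proof.
move=> s0; pose F y := (\int[mu]_(t in `]-oo, y]) normal_pdf m s t)%R.
have [d D] : derivable F x 1 /\ (F^`())%classic x = normal_pdf m s x.
  apply: (@continuous_FTC1 _ _ _ _ (x + 1)).
  - by rewrite ltrDl.
  - by apply: integrableS (integrable_normal_pdf m s) => //.
  - by rewrite ltNyr.
  - exact: continuous_normal_pdf.
apply: DeriveDef; first exact: d.
by rewrite -D derive1E.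
Qed.

Lemma normal_cdf_standardize (m s x : R) : 0 < s ->
  normal_prob m s `]-oo, x] = (Phi ((x - m) / s))%:E.
Proof.
move=> s0; have sn0 : s != 0 by rewrite gt_eqF.
pose F y := (\int[mu]_(t in `]-oo, y]) normal_pdf m s t)%R.
have FE y : normal_prob m s `]-oo, y] = (F y)%:E.
  rewrite /F /Rintegral -/(normal_prob m s `]-oo, y]) fineK//.
  exact: fin_num_measure.
rewrite FE; congr EFin; apply/eqP; rewrite -subr_eq0.
pose G y := F y - Phi ((y - m) / s).
have dG y : is_derive y (1 : R) G 0.
  have ? := is_derive_normal_cdf m y sn0.
  have d1 : is_derive y (1 : R) (fun y => (y - m) / s) (s^-1).
    by apply: is_derive_eq; rewrite /GRing.scale/=; ring.
  have ? := @is_derive1_comp _ (@Phi R) (fun y => (y - m) / s) _ _ _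
    (is_derive_Phi ((y - m) / s)) d1.
  have peak : normal_peak s = normal_peak 1 * s^-1.
    rewrite /normal_peak expr1n mul1r -invfM; congr (_^-1).
    rewrite -mulrnAr sqrtrM ?sqr_ge0// sqrtr_sqr (gtr0_norm s0).
    by rewrite mulrC.
  apply: is_derive_eq.
  rewrite phiE normal_pdfE// /normal_fun peak.
  rewrite (_ : - (y - m) ^+ 2 / (s ^+ 2 *+ 2) = - ((y - m) / s) ^+ 2 / 2).
    by ring.
  by rewrite -[s ^+ 2 *+ 2]mulr_natr; field.
have iT : is_interval [set: R] by [].
have Gc a b : G a = G b.
  have := mean_value_bound iT (fun y _ => dG y) (B := 0)
    (fun y _ => _) (a := b) (b := a) I I.
  rewrite normr0 => /(_ (fun=> lexx _)); rewrite mul0r normr_le0 subr_eq0.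
  by move/eqP.
have mid : measurable_fun setT (fun x : measurableTypeR R => (x : R)).
  exact: measurable_id.
pose X : {mfun measurableTypeR R >-> R} :=
  HB.pack (fun x : measurableTypeR R => (x : R)) (isMeasurableFun.Build _ _ _ _ _ mid).
have F0 : F y @[y --> -oo] --> (0 : R).
  have := cvg_cdfNy0 (X : {RV (normal_prob m s) >-> R}).
  rewrite (_ : cdf _ = EFin \o F); last by apply/funext => y; rewrite /= -FE.
  by move/fine_cvgP => [].
have P0 : Phi ((y - m) / s) @[y --> -oo] --> (0 : R).
  apply: (cvg_comp _ _ _ cvg_Phi_ninfty).
  apply/cvgrNyPle => A; near=> y; rewrite ler_pdivrMr// lerBlDr.
  near: y; apply: nbhs_ninfty_le; exact: num_real.
have G0 : G y @[y --> -oo] --> (0 : R).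
  by apply: (cvg_near_eq (cvgB F0 P0)); rewrite ?subrr//; near=> y.
have Gx : G y @[y --> -oo] --> G x.
  by apply: (cvg_near_eq (cvg_cst (G x))) => //; near=> y.
by rewrite -/(G x) (cvg_unique _ Gx G0).
Unshelve. all: by end_near. Qed.

End normal_cdf.

(** * Second-order regular variation *)

Section uniform_convergence.
Context {R : realType}.
Local Notation mu := (@lebesgue_measure R).

Lemma lebesgue_measure_shift (c : R) (A : set R) : measurable A ->
  mu ((fun x => x + c) @^-1` A) = mu A.
Proof.
move=> mA.
have mshift : measurable_fun setT
    ((fun x => x + c) : measurableTypeR R -> measurableTypeR R).
  exact: measurable_funD.
pose S : {mfun measurableTypeR R >-> measurableTypeR R} :=
  HB.pack ((fun x => x + c) : measurableTypeR R -> measurableTypeR R)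
    (isMeasurableFun.Build _ _ _ _ _ mshift).
transitivity (pushforward mu S A); first by [].
apply/esym/lebesgue_measure_unique => //= _ [[a b]] _ <-.
rewrite /pushforward/= (_ : _ @^-1` _ = `]a - c, b - c]%classic).
  by rewrite !lebesgue_measure_itv/= !lte_fin ltrD2r -!EFinB opprB addrA subrK.
by apply/seteqP; split => x /=; rewrite !in_itv/= ltrBlDr lerBrDr.
Qed.

(** When the increments of K tend to 0, these sets increase with n to the whole
    interval. *)
Let small (K : R -> R) (e : R) (u : nat -> R) (n : nat) : set R :=
  `[0, 2] `&` \bigcap_(m in [set m | (n <= m)%N])
     [set y | `|K (y + u m) - K (u m)| <= e].

Let measurable_small (K : R -> R) e u n : measurable_fun setT K -> measurable (small K e u n).
Proof.
move=> mK; apply: measurableI => //; apply: bigcap_measurableType => m _.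
rewrite -[X in measurable X]setTI; apply: measurable_fun_le => //.
apply: measurableT_comp => //; apply: measurable_funB => //.
by apply: (measurableT_comp mK); exact: measurable_funD.
Qed.

Let large_small (K : R -> R) e u : measurable_fun setT K -> 0 < e ->
  (forall y, K (y + u n) - K (u n) @[n --> \oo] --> (0 : R)) ->
  \forall n \near \oo, (mu (small K e u n) > (3 / 2)%:E)%E.
Proof.
move=> mK e0 Ku.
have ndF : nondecreasing_seq (small K e u).
  move=> m n mn; apply/subsetPset => y [y2 ym]; split => // i /= ni.
  by apply: ym; rewrite /=; exact: leq_trans ni.
have UF : \bigcup_n small K e u n = `[0, 2]%classic.
  apply/seteqP; split => [y [n _ []]//|y y2].
  have /cvgrPdist_le /(_ _ e0) [n _ Hn] := Ku y.
  exists n => //; split => // m /= nm; rewrite -[X in X <= _]normrN -sub0r.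
  exact: Hn.
have mF n := measurable_small e u n mK.
have m2 : mu `[0, 2]%classic = 2%:E.
  by rewrite lebesgue_measure_itv/= lte_fin ltr0n/= sube0.
have : mu (small K e u n) @[n --> \oo] --> (2%:E : \bar R).
  rewrite -m2 -UF; apply: nondecreasing_cvg_mu => //.
  by rewrite UF; exact: measurable_itv.
move=> /fine_cvgP[fF cF].
have lt2 : 3 / 2 < 2 :> R by lra.
apply: filterS2 fF (cvgr_gt (2:R) cF (3 / 2) lt2) => n fn /=.
by rewrite -lte_fin /= fineK.
Qed.

(** The uniform convergence theorem of slow variation. If it failed along
    u n + s n, the points close to which K changes little from u n, and those
    close to which it changes little from u n + s n, would fill more than 3/2 of
    two intervals of length 2 whose union has length at most 3; they meet, and a
    common point compares K (u n) with K (u n + s n). *)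
Lemma uniform_increment_convergence (K : R -> R) : measurable_fun setT K ->
  (forall s, K (u + s) - K u @[u --> +oo] --> (0 : R)) ->
  forall e, 0 < e ->
  \forall u \near +oo, forall s, 0 <= s <= 1 -> `|K (u + s) - K u| <= e.
Proof.
move=> mK Ks e e0; apply: contrapT => nH.
have H n : exists us : R * R, [/\ n%:R <= us.1, 0 <= us.2 <= 1 &
    `|K (us.1 + us.2) - K us.1| > e].
  apply: contrapT => Hn; apply: nH; exists n%:R; split; first exact: num_real.
  move=> u nu s s01; rewrite leNgt; apply/negP => lt; apply: Hn.
  by exists (u, s); split => //=; exact: ltW.
have {H} [us Hus] := choice H.
pose u n := (us n).1; pose s n := (us n).2.
pose us' n := u n + s n.
have uy : u n @[n --> \oo] --> +oo.
  apply: (@ger_cvgy _ _ _ _ (fun n : nat => n%:R : R)); last exact: cvgr_idn.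
  by near=> n; have [] := Hus n.
have usy : us' n @[n --> \oo] --> +oo.
  apply: (@ger_cvgy _ _ _ _ u); last exact: uy.
  by near=> n; have [_ /andP[s0 _] _] := Hus n; rewrite /us' lerDl.
have e20 : 0 < e / 2 by rewrite divr_gt0.
have lim v : v n @[n --> \oo] --> +oo -> forall y : R,
    K (y + v n) - K (v n) @[n --> \oo] --> (0 : R).
  move=> vy y; apply: (cvg_near_eq (cvg_comp _ _ vy (Ks y))) => //.
  by near=> n => /=; rewrite [y + _]addrC.
have V := large_small mK e20 (lim _ uy); have V' := large_small mK e20 (lim _ usy).
near \oo => n.
have Vn : (mu (small K (e / 2) u n) > (3 / 2)%:E)%E by near: n.
have V'n : (mu (small K (e / 2) us' n) > (3 / 2)%:E)%E by near: n.
have [nu s01 big] := Hus n; rewrite -/(u n) -/(s n) in s01 big.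
set A := small K (e / 2) u n in Vn.
set B := small K (e / 2) us' n in V'n.
have mA : measurable A by exact: measurable_small.
have mB : measurable B by exact: measurable_small.
pose B' := (fun x => x - s n) @^-1` B.
have mB' : measurable B'.
  rewrite -[X in measurable X]setTI.
  have : measurable_fun setT (fun x : R => x - s n) by exact: measurable_funB.
  by apply.
have AB' : A `&` B' !=set0.
  apply: contrapT => /nonemptyPn AB0.
  have : (mu (A `|` B') <= mu `[0%R, 3%R]%classic)%E.
    apply: le_measure; rewrite ?inE//; first exact: measurableU.
    have /andP[sn0 sn1] := s01.
    by move=> y [[/= + _]|[/= + _]]; rewrite !in_itv/= => /andP[y0 y2];
      apply/andP; split; lra.
  have BB' : mu B' = mu B by rewrite /B' (lebesgue_measure_shift (- s n)).
  have m3 : mu `[0, 3]%classic = 3%:E.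
    by rewrite lebesgue_measure_itv/= lte_fin ltr0n/= sube0.
  have AB : mu (A `|` B') = (mu A + mu B')%E by apply: measureU.
  rewrite AB BB' m3 leNgt => /negP; apply.
  rewrite (_ : 3 = 3 / 2 + 3 / 2); last by lra.
  by rewrite EFinD lteD.
case: AB' => y [[_ Ay] [_ By]].
have := Ay n (leqnn n); have := By n (leqnn n); rewrite /mkset /=.
rewrite /us' (_ : y - s n + (u n + s n) = y + u n); last by ring.
move=> h1 h2; move: big; rewrite ltNge => /negP; apply.
rewrite (_ : K _ - K _ = (K (y + u n) - K (u n)) - (K (y + u n) - K (u n + s n)));
  last by ring.
by rewrite (le_trans (ler_normB _ _))// [leRHS]splitr lerD.
Unshelve. all: by end_near. Qed.

End uniform_convergence.

Section second_order.
Context {R : realType}.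
Implicit Types (f A : R -> R).

Lemma powR_expR (x r : R) : 0 < x -> x `^ r = expR (r * ln x).
Proof. by move=> x0; rewrite /powR gt_eqF. Qed.

Lemma cvg_mulr_pinfty (x : R) : 0 < x -> t * x @[t --> +oo] --> +oo.
Proof.
move=> x0; apply/cvgryPge => a; near=> t; rewrite -ler_pdivrMr//.
Unshelve. all: by end_near. Qed.

Lemma doubling_increment f A (tau : R) : tau < 0 ->
  (\forall t \near +oo, 0 < A t) ->
  (forall x, 0 < x ->
    (f (t * x) - f t) / A t @[t --> +oo] --> (x `^ tau - 1) / tau) ->
  (f (t * 2 * 2) - f (t * 2)) / A t @[t --> +oo] --> 2 `^ tau * ((2 `^ tau - 1) / tau).
Proof.
move=> tau0 A0 fA.
have c2 := fA _ (ltr0Sn R 1); have c4 := fA 4 (ltr0Sn _ _).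
apply: (cvg_near_eq (cvgB c4 c2)).
  rewrite (_ : 4 = 2 * 2); last by rewrite -natrM.
  by rewrite powRM//; field; rewrite lt_eqF.
by near=> t; rewrite -mulrA -natrM -mulrBl; congr (_ / _); ring.
Unshelve. all: by end_near. Qed.

(** The increments of f along t, 2 t, 4 t, ... are asymptotically geometric of
    ratio q = 2^tau < 1. Adding to f its predicted remaining increments,
    (f (2 t) - f t) / (1 - q), leaves a function e with increments o(A t),
    whose limit L along such a sequence is therefore approached within o(A t);
    L does not depend on the sequence because f has increments tending to 0. *)
Lemma second_order_limit_pos f A (tau : R) : tau < 0 ->
  A t @[t --> +oo] --> (0 : R) -> (\forall t \near +oo, 0 < A t) ->
  (forall x, 0 < x ->
    (f (t * x) - f t) / A t @[t --> +oo] --> (x `^ tau - 1) / tau) ->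
  exists L : R, (f t - L) / A t @[t --> +oo] --> tau^-1.
Proof.
move=> tau0 Acvg A0 fA.
pose q : R := 2 `^ tau.
have q0 : 0 < q by exact: powR_gt0.
have q1 : q < 1.
  by rewrite /q powR_expR// -[ltRHS]expR0 ltr_expR nmulr_rlt0// ln_gt0// ltr1n.
pose c2 := (q - 1) / tau.
have c20 : 0 < c2 by rewrite /c2 ltr_ndivlMr// mul0r subr_lt0.
pose d t := f (t * 2) - f t.
pose e t := f t + d t / (1 - q).
have dA : d t / A t @[t --> +oo] --> c2 by exact: (fA 2).
have d2A : d (t * 2) / A t @[t --> +oo] --> q * c2 by exact: doubling_increment.
have q10 : 1 - q != 0 by rewrite gt_eqF// subr_gt0.
have eA : (e (t * 2) - e t) / A t @[t --> +oo] --> (0 : R).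
  have H : d t / A t + (d (t * 2) / A t - d t / A t) / (1 - q) @[t --> +oo] -->
      c2 + (q * c2 - c2) / (1 - q).
    by apply: cvgD => //; apply: cvgMr_tmp; exact: cvgB.
  apply: (cvg_near_eq H); first by field.
  by near=> t; rewrite /e /d; ring.
(* for t large, the increments of e are negligible against those of f, so that
   e - eps f and e + eps f are monotone along the doubling sequences *)
have bound (eps : R) : 0 < eps -> \forall t \near +oo,
    [/\ 0 < d t, `|d t / A t - c2| <= c2 / 2 & `|e (t * 2) - e t| <= eps * d t].
  move=> eps0.
  have h1 : 0 < c2 / 2 by rewrite divr_gt0.
  have h2 : 0 < eps * (c2 / 2) by rewrite mulr_gt0.
  move/cvgrPdist_le : (dA) => /(_ _ h1) H1; move/cvgrPdist_le : (eA) => /(_ _ h2) H2.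
  apply: filterS3 A0 H1 H2 => t At; rewrite distrC => k1.
  rewrite sub0r normrN normrM normfV (gtr0_norm At) ler_pdivrMr// => k2.
  have k3 : c2 / 2 * A t <= d t.
    rewrite -ler_pdivlMr//; move: k1; rewrite ler_norml => /andP[+ _]; lra.
  split => //.
    by apply: lt_le_trans k3; rewrite mulr_gt0.
  by apply: (le_trans k2); rewrite -mulrA ler_wpM2l// ltW.
pose dbl (t : R) (j : nat) : R := t * 2 ^+ j.
have dblS t j : dbl t j.+1 = dbl t j * 2 by rewrite /dbl exprSr mulrA.
have dblge t j : 0 < t -> t <= dbl t j.
  by move=> t_gt0; rewrite /dbl ler_peMr ?(ltW t_gt0)// exprn_ege1// ler1n.
have dbly t : 0 < t -> dbl t j @[j --> \oo] --> +oo.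
  move=> t_gt0; apply: (@ger_cvgy _ _ _ _ (fun j : nat => j%:R * t)).
    near=> j; rewrite /dbl mulrC ler_pM2l// -natrX ler_nat ltnW//; exact: ltn_expl.
  exact: (cvg_comp _ _ cvgr_idn (cvg_mulr_pinfty t_gt0)).
have iter (eps t : R) : 0 < eps -> 0 < t ->
    (forall u, t <= u -> 0 < d u /\ `|e (u * 2) - e u| <= eps * d u) ->
    forall j, [/\ f (dbl t j) <= f (dbl t j.+1),
      (1 - eps) * f (dbl t j) + d (dbl t j) / (1 - q) <=
        (1 - eps) * f t + d t / (1 - q) &
      (1 + eps) * f t + d t / (1 - q) <=
        (1 + eps) * f (dbl t j) + d (dbl t j) / (1 - q)].
  move=> eps0 t_gt0 H; elim=> [|j [_ IH1 IH2]].
    have [dt _] := H t (lexx _).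
    by rewrite dblS (_ : dbl t 0%N = t) ?/dbl ?expr0 ?mulr1//; split => //;
      rewrite -subr_ge0 ltW.
  have [+ +] := H _ (dblge t j t_gt0); have [+ _] := H _ (dblge t j.+1 t_gt0).
  rewrite -[f _ <= _]subr_ge0 [dbl t j.+2]dblS -/(d (dbl t j.+1)) dblS.
  set v := dbl t j in IH1 IH2 *; move=> dv2 dv.
  have fv2 : f (v * 2) = f v + d v by rewrite /d; ring.
  rewrite /e fv2 ler_norml => /andP[k1 k2]; split; first exact: ltW.
    by rewrite mulrDr; lra.
  by rewrite mulrDr; lra.
have thr (eps : R) : 0 < eps -> exists2 t : R, 0 < t & forall u, t <= u ->
    [/\ 0 < A u, 0 < d u, `|d u / A u - c2| <= c2 / 2
      & `|e (u * 2) - e u| <= eps * d u].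
  move=> eps0; have [t [tr tH]] := bound _ eps0; have [t' [t'r t'H]] := A0.
  exists (Num.max (Num.max t t') 0 + 1); first by rewrite ltr_wpDl// le_max lexx orbT.
  move=> u tu; have u1 : t < u.
    by apply: lt_le_trans tu; rewrite ltr_pwDr// !le_max lexx.
  have u2 : t' < u.
    by apply: lt_le_trans tu; rewrite ltr_pwDr// !le_max lexx orbT.
  by have [] := tH u u1; split => //; exact: t'H.
have conv (eps t : R) : 0 < eps -> eps < 1 -> 0 < t ->
    (forall u, t <= u -> 0 < d u /\ `|e (u * 2) - e u| <= eps * d u) ->
    exists L : R, f (dbl t j) @[j --> \oo] --> L.
  move=> eps0 eps1 t_gt0 H; have I := iter _ _ eps0 t_gt0 H.
  apply/cvg_ex; apply: nondecreasing_is_cvgn.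
    by apply/nondecreasing_seqP => j; have [] := I j.
  exists (((1 - eps) * f t + d t / (1 - q)) / (1 - eps)) => _ [j _ <-].
  rewrite ler_pdivlMr ?subr_gt0// mulrC; have [_ + _] := I j.
  apply: le_trans; rewrite lerDl divr_ge0// ?subr_ge0 ?(ltW q1)//.
  by have [dj _] := H _ (dblge t j t_gt0); rewrite -subr_ge0 ltW.
have h2 : 0 < 2^-1 :> R by rewrite invr_gt0.
have h21 : 2^-1 < 1 :> R by rewrite invf_lt1// ltr1n.
have [t1 t10 H1] := thr _ h2.
have [L HL] := conv _ _ h2 h21 t10 (fun u tu => let: And4 _ b _ c := H1 u tu in conj b c).
have {}HL t : 0 < t -> f (dbl t j) @[j --> \oo] --> L.
  move=> t_gt0; pose x := t / t1; have x0 : 0 < x by rewrite divr_gt0.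
  have Z : A (dbl t1 j) * ((f (dbl t1 j * x) - f (dbl t1 j)) / A (dbl t1 j))
     @[j --> \oo] --> 0 * ((x `^ tau - 1) / tau).
    apply: cvgM; first exact: (cvg_comp _ _ (dbly _ t10) Acvg).
    exact: (cvg_comp _ _ (dbly _ t10) (fA x x0)).
  apply: (cvg_near_eq (cvgD HL Z)); first by rewrite mul0r addr0.
  near=> j; have [Aj _ _ _] := H1 _ (dblge t1 j t10).
  rewrite /= mulrC divfK ?gt_eqF// addrC subrK; congr f.
  by rewrite /dbl /x; field; rewrite gt_eqF.
exists L.
have lim_diff : (f t - L) / A t + (d t / A t) / (1 - q) @[t --> +oo] --> (0 : R).
  apply/cvgrPdist_le => eps eps0.
  pose c := 2 * (3 / 2 * c2) / (1 - q).
  have c0 : 0 < c by rewrite /c divr_gt0 ?subr_gt0// mulr_gt0// mulr_gt0.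
  pose et := Num.min 2^-1 (eps / c).
  have et0 : 0 < et by rewrite lt_min h2 divr_gt0.
  have et2 : et <= 2^-1 by rewrite ge_min lexx.
  have etc : et * c <= eps by rewrite -ler_pdivlMr// ge_min lexx orbT.
  have [tt tt0 Ht] := thr _ et0.
  exists tt; split; first exact: num_real.
  move=> t /ltW ttt.
  have t_gt0 : 0 < t by exact: lt_le_trans ttt.
  have H u : t <= u -> 0 < d u /\ `|e (u * 2) - e u| <= et * d u.
    by move=> tu; have [] := Ht u (le_trans ttt tu).
  have I := iter _ _ et0 t_gt0 H.
  have [At dt k1 _] := Ht t ttt.
  have fL := HL t t_gt0.
  have dj0 : d (dbl t j) @[j --> \oo] --> (0 : R).
    have fS : f (dbl t j.+1) @[j --> \oo] --> L by rewrite (@cvg_shiftS _ (fun j => f (dbl t j))).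
    apply: (cvg_near_eq (cvgB fS fL)); first by rewrite subrr.
    by near=> j; rewrite dblS.
  have up : (1 - et) * L <= (1 - et) * f t + d t / (1 - q).
    have l1 : (1 - et) * f (dbl t j) + d (dbl t j) / (1 - q) @[j --> \oo] -->
        (1 - et) * L + 0 / (1 - q).
      by apply: cvgD; [exact: cvgMl_tmp|exact: cvgMr_tmp].
    rewrite mul0r addr0 in l1.
    apply: (ler_cvg_to l1 (cvg_cst _)).
    by near=> j; have [] := I j.
  have dn : (1 + et) * f t + d t / (1 - q) <= (1 + et) * L.
    have l1 : (1 + et) * f (dbl t j) + d (dbl t j) / (1 - q) @[j --> \oo] -->
        (1 + et) * L + 0 / (1 - q).
      by apply: cvgD; [exact: cvgMl_tmp|exact: cvgMr_tmp].
    rewrite mul0r addr0 in l1.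
    apply: (ler_cvg_to (cvg_cst _) l1).
    by near=> j; have [] := I j.
  have dd0 : 0 < d t / (1 - q) by rewrite divr_gt0// subr_gt0.
  have D2 : L - f t <= 2 * (d t / (1 - q)) by nra.
  have D0 : 0 <= L - f t by nra.
  have D1 : `|(f t - L) + d t / (1 - q)| <= et * (2 * (d t / (1 - q))).
    rewrite ler_norml; apply/andP; split; nra.
  have E1 : (f t - L) / A t + d t / A t / (1 - q) = ((f t - L) + d t / (1 - q)) / A t.
    by field; rewrite q10 gt_eqF.
  rewrite sub0r normrN E1 normrM normfV (gtr0_norm At) ler_pdivrMr//.
  apply: (le_trans D1); apply: (@le_trans _ _ (et * c * A t)); last by rewrite ler_pM2r.
  rewrite -mulrA ler_pM2l// /c.
  have dA2 : d t <= 3 / 2 * c2 * A t.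
    rewrite -ler_pdivrMr//; move: k1; rewrite ler_norml => /andP[_]; lra.
  rewrite (_ : 2 * (3 / 2 * c2) / (1 - q) * A t = 2 * ((3 / 2 * c2 * A t) / (1 - q)));
    last by field.
  by rewrite ler_pM2l// ler_pM2r// invr_gt0 subr_gt0.
have dAq : d t / A t / (1 - q) @[t --> +oo] --> c2 / (1 - q) by exact: cvgMr_tmp.
apply: (cvg_near_eq (cvgB lim_diff dAq)).
  by rewrite /c2; field; rewrite q10 lt_eqF.
by near=> t; rewrite /= addrK.
Unshelve. all: by end_near. Qed.

End second_order.

Section second_order_uniform.
Context {R : realType}.
Implicit Types (f A U : R -> R).

Lemma second_order_nonzero f A (tau : R) : tau < 0 ->
  (forall x, 0 < x ->
    (f (t * x) - f t) / A t @[t --> +oo] --> (x `^ tau - 1) / tau) ->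
  \forall t \near +oo, A t != 0.
Proof.
move=> tau0 fA.
have c20 : 0 < (2 `^ tau - 1) / tau.
  rewrite ltr_ndivlMr// mul0r subr_lt0 powR_expR// -[ltRHS]expR0 ltr_expR.
  by rewrite nmulr_rlt0// ln_gt0// ltr1n.
apply: filterS (cvgr_gt _ (fA 2 (ltr0Sn R 1)) _ c20) => t.
by apply: contraTneq => ->; rewrite invr0 mulr0 ltxx.
Qed.

Lemma second_order_limit f A (tau : R) : tau < 0 ->
  A t @[t --> +oo] --> (0 : R) -> constant_sign_near_infinity A ->
  (forall x, 0 < x ->
    (f (t * x) - f t) / A t @[t --> +oo] --> (x `^ tau - 1) / tau) ->
  exists L : R, (f t - L) / A t @[t --> +oo] --> tau^-1.
Proof.
move=> tau0 Acvg sA fA; have An0 := second_order_nonzero tau0 fA.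
have [A_ge0|A_le0] := sA.
  apply: second_order_limit_pos fA => //; apply: filterS2 An0 A_ge0 => t.
  by rewrite lt0r => -> ->.
have [L HL] : exists L : R, (- f t - L) / (- A t) @[t --> +oo] --> tau^-1.
  apply: (@second_order_limit_pos _ (fun t => - f t) (fun t => - A t)) => //.
  - by rewrite -oppr0; exact: cvgN.
  - by apply: filterS2 An0 A_le0 => t At; rewrite oppr_gt0 lt_neqAle At.
  - move=> x x0; apply: (cvg_near_eq (fA x x0)) => //; near=> t.
    by rewrite invrN mulrN -mulNr; congr (_ / _); ring.
exists (- L); apply: (cvg_near_eq HL) => //; near=> t.
by rewrite invrN mulrN -mulNr; congr (_ / _); ring.
Unshelve. all: by end_near. Qed.

Lemma ln_linear_approx (y : R) : `|y| <= 2^-1 -> `|ln (1 + y) - y| <= 2 * y ^+ 2.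
Proof.
rewrite ler_norml => /andP[y1 y2].
have p0 : 0 < 1 + y by lra.
have up : ln (1 + y) <= y by apply: le_ln1Dx; lra.
have r0 : 0 < (1 + y)^-1 by rewrite invr_gt0.
have ry : (1 + y) * (1 + y)^-1 = 1 by rewrite divff// gt_eqF.
set r := (1 + y)^-1 in r0 ry *.
have dn : - ln (1 + y) <= - (y * r).
  rewrite -lnV ?posrE// -/r [X in ln X](_ : r = 1 + - (y * r)); last by lra.
  by apply: le_ln1Dx; rewrite ltrN2; lra.
have r2 : r <= 2 by nra.
have yr : y * r = y - y ^+ 2 * r by nra.
have := sqr_ge0 y; rewrite yr in dn.
rewrite ler_norml => y20; apply/andP; split; nra.
Qed.

(** Taking logarithms turns the multiplicative condition on U into an additive
    one, as ln (1 + y) - y is of second order. *)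
Lemma second_order_log U A (gamma tau : R) : tau < 0 ->
  (\forall t \near +oo, 0 < U t) -> second_order_condition U gamma tau A ->
  forall x, 0 < x ->
    ((ln (U (t * x)) - gamma * ln (t * x)) - (ln (U t) - gamma * ln t)) / A t
    @[t --> +oo] --> (x `^ tau - 1) / tau.
Proof.
move=> tau0 U0 [Acvg _ UA] x x0.
have An0 : \forall t \near +oo, A t != 0.
  have c20 : 0 < 2 `^ gamma * ((2 `^ tau - 1) / tau).
    rewrite mulr_gt0 ?powR_gt0// ltr_ndivlMr// mul0r subr_lt0 powR_expR//.
    by rewrite -[ltRHS]expR0 ltr_expR nmulr_rlt0// ln_gt0// ltr1n.
  apply: filterS (cvgr_gt _ (UA 2 (ltr0Sn R 1)) _ c20) => t.
  by apply: contraTneq => ->; rewrite invr0 mulr0 ltxx.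
have xg : 0 < x `^ gamma by exact: powR_gt0.
pose y t := U (t * x) / U t / x `^ gamma - 1.
have yA : y t / A t @[t --> +oo] --> (x `^ tau - 1) / tau.
  apply: (cvg_near_eq (cvgMr_tmp (b := (x `^ gamma)^-1) (UA x x0))).
    by rewrite mulrAC divff ?mul1r ?gt_eqF.
  apply: filterS An0 => t At; rewrite /y mulrAC; congr (_ / _).
  by rewrite mulrBl divff// gt_eqF.
have y0 : y t @[t --> +oo] --> (0 : R).
  apply: (cvg_near_eq (cvgM Acvg yA)); first by rewrite mul0r.
  by apply: filterS An0 => t At /=; rewrite mulrC divfK.
have err : (ln (1 + y t) - y t) / A t @[t --> +oo] --> (0 : R).
  apply/norm_cvg0P.
  have h : 2 * (`|y t| * `|y t / A t|) @[t --> +oo] --> 2 * (`|0 : R| * `|(x `^ tau - 1) / tau|).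
    by apply: cvgMl_tmp; apply: cvgM; exact: cvg_norm.
  rewrite normr0 mul0r mulr0 in h.
  apply: (squeeze_cvgr _ (cvg_cst (0 : R)) h).
  have e0 : 0 < 2^-1 :> R by rewrite invr_gt0.
  move/cvgrPdist_le : (y0) => /(_ _ e0); apply: filterS2 An0 => t At.
  rewrite sub0r normrN => /ln_linear_approx le2; rewrite normr_ge0/=.
  rewrite !normrM normfV !mulrA ler_wpM2r ?invr_ge0//.
  by apply: (le_trans le2); rewrite -[y t ^+ 2]real_normK ?num_real// expr2 mulrA.
have Utx : \forall t \near +oo, 0 < U (t * x).
  exact: (cvg_mulr_pinfty x0 U0).
apply: (cvg_near_eq (cvgD err yA)); first by rewrite add0r.
near=> t.
have t0 : 0 < t by near: t; exact: nbhs_pinfty_gt.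
have u0 : 0 < U t by near: t.
have u1 : 0 < U (t * x) by near: t.
rewrite /= -mulrDl subrK; congr (_ / _).
rewrite /y addrC subrK ln_div ?posrE ?divr_gt0// ln_div ?posrE// ln_powR lnM ?posrE//.
by ring.
Unshelve. all: by end_near. Qed.

Let logscale (g : R -> R) (tau : R) (u : R) : R := ln `|g (expR u)| - tau * u.

(** Uniformity in x for a function of regular variation of negative index:
    on the logarithmic scale the increments over unit intervals are uniformly
    small, and chaining them costs a factor expR (e1 * s), which the decay
    expR (tau * s) absorbs. *)
Lemma potter_negative (g : R -> R) (tau : R) : tau < 0 ->
  measurable_fun setT (fun u => g (expR u)) ->
  (\forall t \near +oo, 0 < g t) \/ (\forall t \near +oo, g t < 0) ->
  (forall x, 0 < x -> g (t * x) / g t @[t --> +oo] --> x `^ tau) ->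
  forall eps, 0 < eps -> \forall t \near +oo, forall x, 2^-1 <= x ->
    `|g (t * x) / g t - x `^ tau| <= eps.
Proof.
move=> tau0 mg sg gx eps eps0.
pose K := logscale g tau.
have mK : measurable_fun setT K.
  apply: measurable_funB; last exact: measurable_funM.
  apply: (measurableT_comp (@measurable_ln R)).
  exact: measurableT_comp.
have gratio x : 0 < x -> \forall t \near +oo, 0 < g (t * x) / g t.
  move=> x0; case: sg => sg.
    have sgx : \forall t \near +oo, 0 < g (t * x) by exact: (cvg_mulr_pinfty x0 sg).
    by apply: filterS2 sg sgx => t *; rewrite divr_gt0.
  have sgx : \forall t \near +oo, g (t * x) < 0 by exact: (cvg_mulr_pinfty x0 sg).
  by apply: filterS2 sg sgx => t ? ?; rewrite nmulr_rgt0// invr_lt0.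
have expRy : (expR u : R) @[u --> +oo] --> +oo.
  apply: (@ger_cvgy _ _ _ _ (fun u : R => u)); last exact: cvg_id.
  by near=> u; have := expR_ge1Dx u; lra.
have Ks s : K (u + s) - K u @[u --> +oo] --> (0 : R).
  have e0 := expR_gt0 s.
  have h : ln (g (t * expR s) / g t) - tau * s @[t --> +oo] --> (0 : R).
    rewrite (_ : 0 = ln (expR s `^ tau) - tau * s); last first.
      by rewrite ln_powR expRK subrr.
    apply: cvgB; last exact: cvg_cst.
    by apply: continuous_cvg; [exact/continuous_ln/powR_gt0|exact: gx].
  apply: (cvg_near_eq (cvg_comp _ _ expRy h)) => //.
  have gr : \forall u \near +oo, 0 < g (expR u * expR s) / g (expR u).
    exact: (expRy _ (gratio _ e0)).
  apply: filterS gr => u r0.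
  have gu : g (expR u) != 0.
    by apply: contraTneq r0 => ->; rewrite invr0 mulr0 ltxx.
  have gus : g (expR u * expR s) != 0.
    by apply: contraTneq r0 => ->; rewrite mul0r ltxx.
  rewrite /= /K /logscale -[in LHS](gtr0_norm r0) normrM normfV ln_div ?posrE ?normr_gt0//.
  by rewrite expRD; ring.
pose kappa := - tau / 2.
have kappa0 : 0 < kappa by rewrite divr_gt0// oppr_gt0.
pose e1 := Num.min kappa (eps * kappa * expR (- (4 * kappa))).
have e10 : 0 < e1 by rewrite lt_min kappa0/= mulr_gt0 ?expR_gt0// mulr_gt0.
have e1k : e1 <= kappa by rewrite ge_min lexx.
have e1e : e1 * (kappa^-1 * expR (4 * kappa)) <= eps.
  have h : e1 <= eps * kappa * expR (- (4 * kappa)) by rewrite ge_min lexx orbT.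
  have h' : 0 <= kappa^-1 * expR (4 * kappa).
    by rewrite mulr_ge0 ?expR_ge0// invr_ge0 ltW.
  apply: (le_trans (ler_wpM2r h' h)).
  rewrite [leLHS](_ : _ = eps * (kappa * kappa^-1) * (expR (- (4 * kappa)) * expR (4 * kappa)));
    last by ring.
  by rewrite -expRD addrC subrr expR0 divff ?gt_eqF// !mulr1.
have [u0 [u0r U0]] := uniform_increment_convergence mK Ks e10.
have chain n u s : u0 < u -> 0 <= s <= n%:R -> `|K (u + s) - K u| <= e1 * (s + 1).
  elim: n u s => [|n IHn] u s u0u /andP[s0 sn].
    rewrite (_ : s = 0); last by apply/eqP; rewrite eq_le s0 sn.
    by rewrite addr0 subrr normr0 mulr_ge0// ltW// add0r.
  have [s1|s1] := leP s 1.
    apply: (le_trans (U0 u u0u s _)); first by rewrite s0.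
    by rewrite ler_peMr ?(ltW e10)// lerDr.
  have h1 : `|K (u + 1 + (s - 1)) - K (u + 1)| <= e1 * (s - 1 + 1).
    apply: IHn; first by rewrite ltr_wpDr.
    by rewrite subr_ge0 (ltW s1)/= lerBlDr natr1.
  have h2 : `|K (u + 1) - K u| <= e1 by apply: U0 => //; rewrite ler01 lexx.
  rewrite (_ : u + s = u + 1 + (s - 1)); last by ring.
  rewrite -(subrKA (K (u + 1))) (le_trans (ler_normD _ _))//.
  rewrite (_ : e1 * (s + 1) = e1 * (s - 1 + 1) + e1); last by ring.
  exact: lerD.
have full u s : u0 + 1 < u -> -1 <= s -> `|K (u + s) - K u| <= e1 * (s + 2).
  move=> u0u s1; have [s0|s0] := leP 0 s.
    have [n sn] : exists n : nat, s <= n%:R.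
      by exists (Num.bound s); rewrite ltW// archi_boundP.
    apply: (le_trans (chain n _ _ _ _)); rewrite ?s0//; first by lra.
    by rewrite ler_pM2l// lerD2l ler1n.
  have := U0 (u + s) _ (- s) _; rewrite addrK distrC => h.
  apply: (le_trans (h _ _)); first by lra.
    by apply/andP; split; lra.
  by rewrite ler_peMr ?(ltW e10)//; lra.
have [t1 [t1r T1]] : \forall t \near +oo, forall s, t <= s -> g s != 0 /\
    0 < g s / g t.
  case: sg => [[t1 [t1r sg]]|[t1 [t1r sg]]]; exists t1; split => // t tt1 s ts.
    have gs := sg s (lt_le_trans tt1 ts).
    by rewrite gt_eqF// divr_gt0// sg.
  have gs := sg s (lt_le_trans tt1 ts).
  by rewrite lt_eqF// nmulr_rgt0// invr_lt0 sg.
exists (Num.max (2 * Num.max t1 0) (expR (u0 + 1))); split; first exact: num_real.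
move=> t; rewrite gt_max => /andP[tt1 tu0] x x2.
have t0 : 0 < t.
  by apply: le_lt_trans tt1; rewrite mulr_ge0// le_max lexx orbT.
have x0 : 0 < x by apply: lt_le_trans x2; rewrite invr_gt0.
pose t' := t / 2.
have t't : t' <= t by rewrite ler_pdivrMr// ler_peMr ?(ltW t0)// ler1n.
have t't1 : t1 < t'.
  rewrite ltr_pdivlMr// mulrC; apply: le_lt_trans tt1.
  by rewrite ler_pM2l// le_max lexx.
have t'tx : t' <= t * x by rewrite ler_pM2l.
have [gt0 rt] := T1 t' t't1 t t't; have [gtx0 rtx] := T1 t' t't1 _ t'tx.
have ratio0 : 0 < g (t * x) / g t.
  rewrite (_ : _ / _ = (g (t * x) / g t') / (g t / g t')); first exact: divr_gt0.
  have [gt'0 _] := T1 t' t't1 t' (lexx _).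
  by field; rewrite gt0 gt'0.
pose u := ln t; pose s := ln x.
have tE : t = expR u by rewrite /u lnK.
have xE : x = expR s by rewrite /s lnK.
have s1 : -1 <= s.
  rewrite -ler_expR -xE; apply: le_trans x2.
  rewrite expRN lef_pV2 ?posrE ?expR_gt0//.
  by apply: le_trans (expR_ge1Dx 1).
have u0u : u0 + 1 < u by rewrite -ltr_expR -tE.
have := full _ _ u0u s1; set del := K (u + s) - K u => Hdel.
have -> : g (t * x) / g t = expR (tau * s) * expR del.
  rewrite -expRD /del /K /logscale [expR (u + s)]expRD -xE -tE.
  rewrite [X in expR X](_ : _ = ln `|g (t * x)| - ln `|g t|); last by ring.
  rewrite -ln_div ?posrE ?normr_gt0// -normfV -normrM lnK ?posrE ?normr_gt0 ?gt_eqF//.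
  by rewrite gtr0_norm.
have -> : x `^ tau = expR (tau * s) by rewrite powR_expR.
rewrite -{2}[expR (tau * s)]mulr1 -mulrBr normrM (gtr0_norm (expR_gt0 _)).
have edel : `|expR del - 1| <= `|del| * expR `|del|.
  have h1 := expR_ge1Dx del; have h2 := expR_ge1Dx (- del).
  have ede : expR (- del) * expR del = 1 by rewrite -expRD addrC subrr expR0.
  have [d0|d0] := leP 0 del.
    have := ler_wpM2r (expR_ge0 del) h2; rewrite ede mulrDl mul1r mulNr => h3.
    rewrite (ger0_norm d0) ger0_norm ?subr_ge0; first by rewrite lerBlDr -lerBlDl.
    by apply: le_trans h1; rewrite lerDl.
  have h3 : expR del <= 1 by rewrite -[leRHS]expR0 ler_expR ltW.
  rewrite ler0_norm ?subr_le0// opprB (@le_trans _ _ `|del|)//.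
    by rewrite ltr0_norm// lerBlDl -lerBlDr opprK.
  by rewrite ler_peMr// -[leLHS]expR0 ler_expR.
pose m := kappa * (s + 2).
have m0 : 0 <= m by rewrite mulr_ge0 ?ltW//; lra.
have dm : `|del| <= m.
  by apply: (le_trans Hdel); rewrite ler_wpM2r//; lra.
have tauk : tau = - (2 * kappa) by rewrite /kappa; field.
have expm : expR (tau * s) * expR `|del| <= expR (- m) * expR (4 * kappa).
  rewrite -!expRD ler_expR tauk; move: dm; rewrite /m; lra.
have mexp : m * expR (- m) <= 1.
  rewrite expRN ler_pdivrMr ?expR_gt0// mul1r.
  have := expR_ge1Dx m; lra.
apply: (le_trans (ler_wpM2l (expR_ge0 _) edel)).
rewrite mulrCA.
apply: (le_trans (ler_wpM2l (normr_ge0 _) expm)).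
apply: (le_trans (ler_wpM2r _ Hdel)); first by rewrite mulr_ge0// expR_ge0.
apply: le_trans e1e.
rewrite (_ : e1 * (s + 2) = e1 * (kappa^-1 * m)); last first.
  by rewrite /m; field; rewrite gt_eqF.
rewrite [leLHS](_ : _ = (e1 * (kappa^-1 * expR (4 * kappa))) * (m * expR (- m)));
  last by ring.
by rewrite ler_piMr// mulr_ge0 ?(ltW e10)// mulr_ge0 ?expR_ge0// invr_ge0 ltW.
Unshelve. all: by end_near. Qed.

End second_order_uniform.

(** * Quantiles and the second-order expansion of the tail *)

Section quantile_theory.
Context {R : realType}.

(** The properties of a cdf used below: it is kept abstract because the lemmas
    are applied to the cdfs of the lifetime, of the censoring time and of their
    minimum. *)
Record continuous_cdf (K : R -> R) : Prop := ContinuousCdf {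
  ccdf_homo : {homo K : x y / x <= y};
  ccdf_cont : continuous K;
  ccdf_pinfty : K x @[x --> +oo] --> (1 : R);
  ccdf_ninfty : K x @[x --> -oo] --> (0 : R) }.

Variable K : R -> R.
Hypothesis HK : continuous_cdf K.

Lemma continuous_cdf_ge0 x : 0 <= K x.
Proof.
apply: (ler_cvg_to (ccdf_ninfty HK) (cvg_cst (K x))).
near=> y; apply: (ccdf_homo HK); near: y; exact: nbhs_ninfty_le (num_real _).
Unshelve. all: by end_near. Qed.

Lemma continuous_cdf_le1 x : K x <= 1.
Proof.
apply: (ler_cvg_to (cvg_cst (K x)) (ccdf_pinfty HK)).
near=> y; apply: (ccdf_homo HK); near: y; exact: nbhs_pinfty_ge (num_real _).
Unshelve. all: by end_near. Qed.

Lemma quantile_has_inf s : 0 < s < 1 -> has_inf [set x | s <= K x].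
Proof.
move=> /andP[s0 s1]; split.
  have [x [_ Hx]] := cvgr_gt _ (ccdf_pinfty HK) _ s1.
  by exists (x + 1) => /=; apply/ltW/Hx; rewrite ltrDl.
have [x [_ Hx]] := cvgr_lt _ (ccdf_ninfty HK) _ s0.
exists (x - 1) => y /= sKy; rewrite leNgt; apply/negP => yx.
have := Hx (x - 1); rewrite ltrBlDr ltrDl => /(_ ltr01).
by rewrite ltNge (le_trans sKy)// (ccdf_homo HK)// ltW.
Qed.

Lemma cdf_quantile s : 0 < s < 1 -> K (quantile K s) = s.
Proof.
move=> s01; have [S0 Slb] := quantile_has_inf s01.
set S := [set x | s <= K x] in S0 Slb.
have qE : quantile K s = inf S by [].
have Kq : K x @[x --> quantile K s] --> K (quantile K s) by exact: (ccdf_cont HK).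
apply/eqP; rewrite eq_le; apply/andP; split; rewrite leNgt; apply/negP => lt.
  have [x xq Kx] : exists2 x, x < quantile K s & s < K x.
    have /nbhs_ballP[e /= e0 He] : \forall t \near nbhs (quantile K s), s < K t.
      exact: (cvgr_gt _ Kq).
    exists (quantile K s - e / 2).
      by rewrite ltrBlDr ltrDl divr_gt0.
    apply: He; rewrite /ball/= opprB addrCA subrr addr0 gtr0_norm ?divr_gt0//.
    by rewrite ltr_pdivrMr// ltr_pMr// ltr1n.
  move: xq; rewrite ltNge => /negP; apply; rewrite qE.
  by apply: ge_inf => //; exact: ltW.
have [x xq Kx] : exists2 x, quantile K s < x & K x < s.
  have /nbhs_ballP[e /= e0 He] : \forall t \near nbhs (quantile K s), K t < s.
    exact: (cvgr_lt _ Kq).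
  exists (quantile K s + e / 2).
    by rewrite ltrDl divr_gt0.
  apply: He; rewrite /ball/= opprD addNKr normrN gtr0_norm ?divr_gt0//.
  by rewrite ltr_pdivrMr// ltr_pMr// ltr1n.
move: xq; rewrite ltNge => /negP; apply; rewrite qE; apply: lb_le_inf => // y sy.
rewrite leNgt; apply/negP => yx.
by move: Kx; rewrite ltNge (le_trans sy)// (ccdf_homo HK)// ltW.
Qed.

Lemma quantile_le s x : 0 < s < 1 -> (quantile K s <= x) = (s <= K x).
Proof.
move=> s01; apply/idP/idP => [qx|sK].
  by rewrite -(cdf_quantile s01); exact: (ccdf_homo HK).
by apply: ge_inf => //; have [] := quantile_has_inf s01.
Qed.

Lemma quantile_homo s t : 0 < s < 1 -> 0 < t < 1 -> s <= t ->
  quantile K s <= quantile K t.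
Proof. by move=> s01 t01 st; rewrite quantile_le// cdf_quantile. Qed.

Lemma survival_tail_quantile t : 1 < t -> survival K (tail_quantile K t) = t^-1.
Proof.
move=> t1; have t0 : 0 < t by exact: lt_trans t1.
rewrite /survival /tail_quantile cdf_quantile// ?subKr//.
by rewrite subr_gt0 invf_lt1// t1/= ltrBlDr ltrDl invr_gt0.
Qed.

End quantile_theory.

Section tail_expansion.
Context {R : realType}.
Variables (K : R -> R) (gamma tau : R) (A : R -> R).
Hypothesis HK : continuous_cdf K.
Hypothesis K_lt1 : forall x, K x < 1.
Hypothesis tau0 : tau < 0.
Hypothesis KA : second_order_condition (tail_quantile K) gamma tau A.
Local Notation U := (tail_quantile K).
Local Notation s := (survival K).

Let level (t : R) : 1 < t -> 0 < 1 - t^-1 < 1.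
Proof.
move=> t1; have t0 : 0 < t by exact: lt_trans t1.
by rewrite subr_gt0 invf_lt1// t1/= ltrBlDr ltrDl invr_gt0.
Qed.

Let U_homo t t' : 1 < t -> t <= t' -> U t <= U t'.
Proof.
move=> t1 tt'; have t'1 := lt_le_trans t1 tt'.
apply: (quantile_homo HK (level t1) (level t'1)).
by rewrite lerD2l lerN2 lef_pV2// posrE (lt_trans ltr01).
Qed.

Let U_pos : \forall t \near +oo, 0 < U t.
Proof.
have s1 : 0 < s 0 by rewrite /survival subr_gt0.
near=> t; rewrite ltNge; apply/negP => U0.
have t1 : 1 < t by near: t; exact: nbhs_pinfty_gt (num_real _).
have := survival_tail_quantile HK t1; apply/eqP; rewrite gt_eqF//.
apply: (@lt_le_trans _ _ (s 0)); last by rewrite /survival lerD2l lerN2 (ccdf_homo HK).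
have t0 : 0 < t by exact: lt_trans t1.
rewrite invf_plt ?posrE//.
near: t; exact: nbhs_pinfty_gt (num_real _).
Unshelve. all: by end_near. Qed.

(* The truncation at 2 makes f measurable on the whole line, as the quantile
   function is monotone only for levels in ]0, 1[. *)
Let f (t : R) : R := ln (U (Num.max t 2)) - gamma * ln t.

Let fE t : 2 <= t -> f t = ln (U t) - gamma * ln t.
Proof. by move=> t2; rewrite /f max_l. Qed.

Let measurable_f_expR : measurable_fun setT (fun u => f (expR u)).
Proof.
apply: measurable_funB.
  apply: (measurableT_comp (@measurable_ln R)).
  apply: nondecreasing_measurable => // x y xy; apply: U_homo.
    by rewrite lt_max orbC ltr1n.
  by rewrite ge_max le_max ler_expR xy/= le_max lexx orbT.
by under eq_fun do rewrite expRK; exact: measurable_funM.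
Qed.

(** The limit L of ln U t - gamma ln t exists at rate A t / tau, and the
    remainder varies regularly with index tau, uniformly by potter_negative. *)
Lemma tail_quantile_expansion : exists L : R, forall eps, 0 < eps ->
  \forall t \near +oo, forall x, 2^-1 <= x ->
    `|ln (U (t * x)) - gamma * ln (t * x) - L - A t / tau * x `^ tau| <= eps * `|A t|.
Proof.
have [Acvg sA _] := KA.
have fA x : 0 < x -> (f (t * x) - f t) / A t @[t --> +oo] --> (x `^ tau - 1) / tau.
  move=> x0; apply: (cvg_near_eq (second_order_log tau0 U_pos KA x0)) => //.
  have x2y := cvg_mulr_pinfty x0 (nbhs_pinfty_ge (num_real 2)).
  near=> t.
  have t2 : 2 <= t by near: t; exact: nbhs_pinfty_ge (num_real _).
  have tx2 : 2 <= t * x by near: t; exact: x2y.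
  by rewrite !fE.
have An0 := second_order_nonzero tau0 fA.
have [L HL] := second_order_limit tau0 Acvg sA fA.
exists L => eps eps0; pose g t := f t - L.
have tn0 : tau != 0 by rewrite lt_eqF.
have gA_neg : \forall t \near +oo, g t / A t < 0.
  by apply: (cvgr_lt _ HL); rewrite invr_lt0.
have sg : (\forall t \near +oo, 0 < g t) \/ (\forall t \near +oo, g t < 0).
  case: sA => sA; [right|left]; apply: filterS3 An0 sA gA_neg => t At At0 gAt.
    have A0 : 0 < A t by rewrite lt0r At.
    by move: gAt; rewrite pmulr_llt0 ?invr_gt0.
  have A0 : A t < 0 by rewrite lt_neqAle At.
  by move: gAt; rewrite nmulr_llt0 ?invr_lt0.
have gn0 : \forall t \near +oo, g t != 0.
  by case: sg; apply: filterS => t ?; [rewrite gt_eqF|rewrite lt_eqF].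
have gx x : 0 < x -> g (t * x) / g t @[t --> +oo] --> x `^ tau.
  move=> x0.
  have h : 1 + ((f (t * x) - f t) / A t) / (g t / A t) @[t --> +oo] -->
      1 + ((x `^ tau - 1) / tau) / tau^-1.
    apply: cvgD; first exact: cvg_cst.
    by apply: cvgM; [exact: fA|apply: cvgV => //; rewrite invr_eq0].
  apply: (cvg_near_eq h); first by field.
  apply: filterS2 An0 gn0 => t At gt; rewrite /g; field.
  by rewrite gt At.
have mg : measurable_fun setT (fun u => g (expR u)) by exact: measurable_funB.
pose c : R := 2^-1 `^ tau.
have c0 : 0 < c by rewrite powR_gt0// invr_gt0.
pose e1 := Num.min 1 (eps * (- tau) / 4).
have e10 : 0 < e1 by rewrite lt_min ltr01 divr_gt0// mulr_gt0// oppr_gt0.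
pose e2 := Num.min (- tau^-1) (eps / (2 * c)).
have e20 : 0 < e2.
  by rewrite lt_min oppr_gt0 invr_lt0 tau0/= divr_gt0// mulr_gt0.
have pot := potter_negative tau0 mg sg gx e10.
move/cvgrPdist_le : (HL) => /(_ _ e20) gA.
near=> t => x x2.
have x0 : 0 < x by apply: lt_le_trans x2; rewrite invr_gt0.
have t4 : 4 <= t by near: t; exact: nbhs_pinfty_ge (num_real _).
have At : A t != 0 by near: t.
have gt0 : g t != 0 by near: t.
have k1 : `|g (t * x) / g t - x `^ tau| <= e1 by move: x x2 {x0}; near: t.
have k2 : `|tau^-1 - g t / A t| <= e2 by near: t.
have tx2 : 2 <= t * x.
  rewrite (_ : 2 = 4 * 2^-1 :> R); last by field.
  by rewrite ler_pM// invr_ge0.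
have -> : ln (U (t * x)) - gamma * ln (t * x) - L - A t / tau * x `^ tau =
    g t * (g (t * x) / g t - x `^ tau) - A t * ((tau^-1 - g t / A t) * x `^ tau).
  rewrite /g (fE tx2); rewrite /g in gt0; field.
  by rewrite At tn0 gt0.
have xc : x `^ tau <= c.
  rewrite /c !powR_expR ?invr_gt0// ler_expR ler_nM2l// ler_ln ?posrE ?invr_gt0//.
have gAt : `|g t| <= - 2 * tau^-1 * `|A t|.
  rewrite -ler_pdivrMr ?normr_gt0// -normfV -normrM.
  have : e2 <= - tau^-1 by rewrite ge_min lexx.
  have ti : tau^-1 < 0 by rewrite invr_lt0.
  move: k2; rewrite distrC => k2 e2t; have := ler_distD 0 (g t / A t) tau^-1.
  have := ler_normD (g t / A t - tau^-1) tau^-1; rewrite subrK (ltr0_norm ti); lra.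
apply: (le_trans (ler_normB _ _)); rewrite !normrM.
have p1 : `|g t| * `|g (t * x) / g t - x `^ tau| <= eps / 2 * `|A t|.
  apply: (le_trans (ler_pM (normr_ge0 _) (normr_ge0 _) gAt k1)).
  have : e1 <= eps * (- tau) / 4 by rewrite ge_min lexx orbT.
  have ti : tau^-1 < 0 by rewrite invr_lt0.
  have tti : tau * tau^-1 = 1 by rewrite divff.
  move=> e1t; rewrite mulrAC ler_wpM2r//.
  apply: (@le_trans _ _ (- 2 * tau^-1 * (eps * (- tau) / 4))).
    by rewrite ler_pM2l//; lra.
  rewrite [leLHS](_ : _ = (tau * tau^-1) * (eps / 2)); last by field.
  by rewrite tti mul1r.
have p2 : `|A t| * (`|tau^-1 - g t / A t| * `|x `^ tau|) <= eps / 2 * `|A t|.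
  rewrite [leRHS]mulrC ler_wpM2l// (ger0_norm (powR_ge0 _ _)).
  apply: (le_trans (ler_pM (normr_ge0 _) (powR_ge0 _ _) k2 xc)).
  have : e2 <= eps / (2 * c) by rewrite ge_min lexx orbT.
  by rewrite ler_pdivlMr ?mulr_gt0//; lra.
lra.
Unshelve. all: by end_near. Qed.

(** The expansion of the quantile function read at t x = 1 / s z', where
    t = 1 / s z: since z' and the quantile at level s z' may differ on a flat
    piece of the cdf, the point z' is caught between quantiles at neighbouring
    levels. The hypothesis s z' <= 2 s z is x >= 1/2. *)
Lemma tail_expansion : exists L : R, forall eps, 0 < eps ->
  \forall z \near +oo, forall z', s z' <= 2 * s z ->
    `|ln z' + gamma * ln (s z') - L - A (1 / s z) / tau * (s z' / s z) `^ (- tau)|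
    <= eps * `|A (1 / s z)|.
Proof.
have [L HL] := tail_quantile_expansion; exists L => eps eps0.
have s_gt0 z : 0 < s z by rewrite /survival subr_gt0.
have s_cvg0 : s z @[z --> +oo] --> (0 : R).
  rewrite -(subrr 1); apply: cvgB; [exact: cvg_cst|exact: (ccdf_pinfty HK)].
have sy : (s z)^-1 @[z --> +oo] --> +oo.
  apply/gtr0_cvgV0; first by near=> z; rewrite invr_gt0.
  by apply: (cvg_near_eq s_cvg0) => //; near=> z; rewrite invrK.
have q0 : 0 < 4^-1 :> R by rewrite invr_gt0.
pose E t := forall x, 2^-1 <= x ->
  `|ln (U (t * x)) - gamma * ln (t * x) - L - A t / tau * x `^ tau| <= eps * `|A t|.
have H1 : \forall z \near +oo, E (s z)^-1 by exact: (sy _ (HL _ eps0)).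
have H2 : \forall z \near +oo, s z < 4^-1 by exact: (cvgr_lt _ s_cvg0).
have UP : \forall z \near +oo, forall t, (s z)^-1 / 2 <= t -> 0 < U t.
  have [t0 [_ Ut0]] := U_pos.
  have H0 : \forall z \near +oo, 2 * t0 < (s z)^-1.
    exact: (sy _ (nbhs_pinfty_gt (num_real (2 * t0)))).
  apply: filterS H0 => z zt t tz; apply: Ut0; apply: lt_le_trans tz.
  by rewrite ltr_pdivlMr// mulrC.
apply: filterS3 H1 H2 UP => z Ez s4 {}UP z' sz'.
pose t := (s z)^-1; pose x := s z / s z'.
have x0 : 0 < x by rewrite divr_gt0.
have x2 : 2^-1 <= x by rewrite ler_pdivlMr// mulrC ler_pdivrMr// mulrC.
have tx : t * x = (s z')^-1 by rewrite /t /x mulKf// gt_eqF.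
have sz'1 : s z' < 2^-1 by lra.
have Kz' : 1 - (t * x)^-1 = K z' by rewrite tx invrK /survival opprB addrC subrK.
have lnsz' : gamma * ln (s z') = - (gamma * ln (t * x)).
  by rewrite tx lnV ?posrE// mulrN opprK.
have xtau : (s z' / s z) `^ (- tau) = x `^ tau.
  by rewrite !powR_expR ?divr_gt0// !ln_div ?posrE//; congr expR; ring.
have U0 : 0 < U (t * x) by apply: UP; rewrite ler_pM2l// invr_gt0.
have Kz'01 : 0 < 1 - (t * x)^-1 < 1.
  by rewrite Kz' K_lt1 andbT; move: sz'1; rewrite /survival; lra.
have z'0 : 0 < z'.
  by apply: lt_le_trans U0 _; rewrite /tail_quantile quantile_le// Kz'.
have lower : A t / tau * x `^ tau - eps * `|A t| <=
    ln z' + gamma * ln (s z') - L.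
  have := Ez x x2; rewrite ler_norml => /andP[E1 _].
  have : ln (U (t * x)) <= ln z'.
    by rewrite ler_ln ?posrE// /tail_quantile quantile_le// Kz'.
  rewrite lnsz' -/t in E1 *; move: E1; rewrite -/t; lra.
have upper : ln z' + gamma * ln (s z') - L <=
    A t / tau * x `^ tau + eps * `|A t|.
  have lim : A t / tau * (x * (1 + eta)) `^ tau + eps * `|A t| + gamma * ln (1 + eta)
      @[eta --> (0:R)^'+] --> A t / tau * (x * (1 + 0)) `^ tau + eps * `|A t|
        + gamma * ln (1 + 0).
    have c1 : 1 + eta @[eta --> (0:R)^'+] --> (1 + 0 : R).
      by apply: cvgD; [exact: cvg_cst|exact: cvg_at_right_filter].
    have cl : ln (1 + eta) @[eta --> (0:R)^'+] --> ln (1 + 0 : R).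
      by apply: continuous_cvg => //; apply: continuous_ln; rewrite addr0.
    apply: cvgD; last exact: cvgMl_tmp.
    apply: cvgD; last exact: cvg_cst.
    apply: cvgMl_tmp.
    have h : expR (tau * (ln x + ln (1 + eta))) @[eta --> (0:R)^'+] -->
        expR (tau * (ln x + ln (1 + 0))).
      apply: continuous_cvg; first exact: continuous_expR.
      by apply: cvgMl_tmp; apply: cvgD => //; exact: cvg_cst.
    apply: (cvg_near_eq h).
      by rewrite addr0 mulr1 ln1 addr0 powR_expR.
    near=> eta; have eta0 : 0 < eta by near: eta; exact: nbhs_right_gt.
    have e1 : 0 < 1 + eta by lra.
    have xe : 0 < x * (1 + eta) by rewrite mulr_gt0.
    by rewrite [RHS]powR_expR// lnM ?posrE.
  rewrite addr0 mulr1 ln1 mulr0 addr0 in lim.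
  apply: (ler_cvg_to (cvg_cst _) lim).
  near=> eta; have eta0 : 0 < eta by near: eta; exact: nbhs_right_gt.
  have e1 : 1 < 1 + eta by lra.
  have e10 : 0 < 1 + eta by lra.
  have tx1 : 0 < t * x by rewrite tx invr_gt0.
  have t2 : 2 < t * x by rewrite tx -[ltLHS]invrK ltf_pV2 ?posrE ?invr_gt0.
  pose v := t * (x * (1 + eta)).
  have vE : v = t * x * (1 + eta) by rewrite /v mulrA.
  have v1 : 0 < 1 - v^-1 < 1.
    apply: level; rewrite vE; nra.
  have z'U : z' <= U v.
    rewrite leNgt; apply/negP => /ltW; rewrite /tail_quantile quantile_le// -Kz'.
    have v0 : 0 < v by rewrite vE mulr_gt0.
    by rewrite lerD2l lerN2 lef_pV2 ?posrE// vE; nra.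
  have v2 : 2^-1 <= x * (1 + eta) by nra.
  have := Ez _ v2; rewrite -/t -/v ler_norml => /andP[_ E2].
  have : ln z' <= ln (U v) by rewrite ler_ln ?posrE// (lt_le_trans z'0).
  have lnv : ln v = ln (t * x) + ln (1 + eta) by rewrite vE lnM ?posrE.
  rewrite lnv mulrDr in E2; rewrite lnsz'; lra.
rewrite div1r -/t xtau ler_norml; apply/andP; split; lra.
Unshelve. all: by end_near. Qed.

End tail_expansion.

(** * First-order regular variation *)

Section regular_variation.
Context {R : realType}.
Implicit Types a b : R -> R.

(** Polya's argument: pointwise convergence of monotone functions to a
    continuous limit is uniform, by comparison at N points of the range. *)
Lemma monotone_rv_uniform a (alpha : R) : 0 < alpha ->
  {homo a : x y / x <= y >-> y <= x} -> (forall x, 0 < a x) ->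
  regularly_varying a (- alpha) ->
  forall eps, 0 < eps -> \forall t \near +oo, forall x, 1 <= x ->
    `|a (t * x) / a t - x `^ (- alpha)| <= eps.
Proof.
move=> alpha0 ah a0 rva eps eps0.
have [N N0 Ne] : exists2 N : nat, (0 < N)%N & N%:R^-1 <= eps / 2 :> R.
  exists (Num.bound (2 / eps)).+1 => //.
  rewrite -[leRHS]invrK lef_pV2 ?posrE ?ltr0n ?invr_gt0 ?divr_gt0//.
  rewrite invf_div (le_trans (ltW (archi_boundP _)))//.
    by rewrite divr_ge0// ltW.
  by rewrite ler_nat.
have NR : 0 < N%:R :> R by rewrite ltr0n.
(* the point where the limit takes the value i / N *)
pose pt (i : nat) : R := (i%:R / N%:R) `^ (- alpha^-1).
have pt_gt0 i : (0 < i)%N -> 0 < pt i.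
  by move=> i0; rewrite powR_gt0// divr_gt0// ltr0n.
have ptE i : (0 < i)%N -> pt i `^ (- alpha) = i%:R / N%:R.
  move=> i0; have iN : 0 < i%:R / N%:R :> R by rewrite divr_gt0// ltr0n.
  by rewrite /pt -powRrM mulrNN mulVf ?gt_eqF// powRr1// ltW.
have anti x y : 0 < x -> 0 < y -> (x `^ (- alpha) <= y `^ (- alpha)) = (y <= x).
  by move=> x0 y0; rewrite !powR_expR// ler_expR ler_nM2l ?oppr_lt0// ler_ln.
have e20 : 0 < eps / 2 by rewrite divr_gt0.
have grid : \forall t \near +oo, forall i : 'I_N,
    `|pt i.+1 `^ (- alpha) - a (t * pt i.+1) / a t| <= eps / 2.
  apply: filter_forall => i.
  by move/cvgrPdist_le : (rva _ (pt_gt0 i.+1 isT)); apply.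
near=> t => x x1.
have t0 : 0 < t by near: t; exact: nbhs_pinfty_gt (num_real _).
have G : forall i : 'I_N, `|pt i.+1 `^ (- alpha) - a (t * pt i.+1) / a t| <= eps / 2.
  by near: t.
have x0 : 0 < x by exact: lt_le_trans x1.
have at0 := a0 t.
set v := x `^ (- alpha).
have v0 : 0 < v by exact: powR_gt0.
have v1 : v <= 1.
  rewrite /v powR_expR// -[leRHS]expR0 ler_expR nmulr_rle0 ?oppr_lt0//.
  exact: ln_ge0.
have [i iN iv] : exists2 i : nat, (i < N)%N & i%:R / N%:R < v <= i.+1%:R / N%:R.
  have ex : exists j : nat, v * N%:R <= j.+1%:R.
    exists N; rewrite (@le_trans _ _ N%:R) ?ler_nat//.
    by rewrite ler_piMl// ltW.
  have := ex_minnP ex; case=> j vj jmin; exists j; last first.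
    rewrite ler_pdivlMr// vj andbT ltr_pdivrMr//.
    case: j vj jmin => [|j] vj jmin; first by rewrite mulr_gt0.
    by rewrite ltNge; apply/negP => /jmin; rewrite ltnn.
  rewrite ltnNge; apply/negP => Nj.
  have : (N.-1.+1 <= j)%N by rewrite prednK.
  rewrite ltnNge => /negP; apply; apply: jmin.
  by rewrite prednK// ler_piMl// ltW.
move: iv => /andP[iv vi].
have up : a (t * x) / a t <= i.+1%:R / N%:R + eps / 2.
  have xpt : pt i.+1 <= x by rewrite -anti// ?pt_gt0// ptE.
  have := G (Ordinal iN); rewrite ptE//= ler_norml => /andP[+ _].
  have : a (t * x) / a t <= a (t * pt i.+1) / a t.
    by rewrite ler_pM2r ?invr_gt0// ah// ler_pM2l.
  lra.
have dn : i%:R / N%:R - eps / 2 <= a (t * x) / a t.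
  case: i iN iv vi up => [|i] iN iv vi up.
    rewrite mul0r sub0r (@le_trans _ _ 0) ?oppr_le0 ?(ltW e20)//.
    by rewrite divr_ge0 ?ltW.
  have xpt : x <= pt i.+1 by rewrite -anti// ?pt_gt0// ptE// ltW.
  have iN' : (i < N)%N by exact: ltn_trans iN.
  have := G (Ordinal iN'); rewrite ptE//= ler_norml => /andP[_ +].
  have : a (t * pt i.+1) / a t <= a (t * x) / a t.
    by rewrite ler_pM2r ?invr_gt0// ah// ler_pM2l.
  lra.
have iS : i.+1%:R / N%:R = i%:R / N%:R + N%:R^-1 :> R.
  by rewrite -natr1 mulrDl mul1r.
rewrite iS in up vi; rewrite ler_norml; apply/andP; split; lra.
Unshelve. all: by end_near. Qed.

Lemma rv_powR a (alpha theta : R) : (forall x, 0 < a x) ->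
  regularly_varying a alpha -> regularly_varying (fun x => a x `^ theta) (alpha * theta).
Proof.
move=> a0 rva x x0.
have h : expR (theta * ln (a (t * x) / a t)) @[t --> +oo] -->
    expR (theta * ln (x `^ alpha)).
  apply: continuous_cvg; first exact: continuous_expR.
  apply: cvgMl_tmp; apply: continuous_cvg; last exact: rva.
  by apply: continuous_ln; exact: powR_gt0.
apply: (cvg_near_eq h).
  by rewrite -powR_expR ?powR_gt0// -powRrM.
near=> t; rewrite ln_div ?posrE// !powR_expR//.
by rewrite -expRN -expRD; congr expR; ring.
Unshelve. all: by end_near. Qed.

Lemma rvM a b (alpha beta : R) : regularly_varying a alpha ->
  regularly_varying b beta -> regularly_varying (fun x => a x * b x) (alpha + beta).
Proof.
move=> rva rvb x x0; apply: (cvg_near_eq (cvgM (rva x x0) (rvb x x0))).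
  by rewrite powRD//; apply/implyP => _; rewrite gt_eqF.
by near=> t; rewrite /= invfM; ring.
Unshelve. all: by end_near. Qed.

(** Both quotients are uniformly close to (z' / z)^(- alpha). *)
Lemma rv_ratio a b (alpha beta : R) : 0 < alpha -> 0 < beta ->
  {homo a : x y / x <= y >-> y <= x} -> (forall x, 0 < a x) ->
  {homo b : x y / x <= y >-> y <= x} -> (forall x, 0 < b x) ->
  regularly_varying a (- alpha) -> regularly_varying b (- beta) ->
  forall eps, 0 < eps -> \forall z \near +oo, forall z', z <= z' ->
    `|a z' / a z - (b z' / b z) `^ (alpha / beta)| <= eps.
Proof.
move=> alpha0 beta0 ah a0 bh b0 rva rvb eps eps0.
pose th := alpha / beta; have th0 : 0 < th by rewrite divr_gt0.
pose B x := b x `^ th.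
have Bh : {homo B : x y / x <= y >-> y <= x}.
  by move=> x y xy; apply: ge0_ler_powR; rewrite ?nnegrE ?(ltW th0) ?(ltW (b0 _)) ?bh.
have B0 x : 0 < B x by exact: powR_gt0.
have rvB : regularly_varying B (- alpha).
  rewrite (_ : - alpha = - beta * th); first exact: rv_powR.
  by rewrite /th; field; rewrite gt_eqF.
have e20 : 0 < eps / 2 by rewrite divr_gt0.
have Ha := monotone_rv_uniform alpha0 ah a0 rva e20.
have HB := monotone_rv_uniform alpha0 Bh B0 rvB e20.
near=> z => z' zz'.
have z0 : 0 < z by near: z; exact: nbhs_pinfty_gt (num_real _).
have ka : forall x, 1 <= x -> `|a (z * x) / a z - x `^ (- alpha)| <= eps / 2 by near: z.
have kB : forall x, 1 <= x -> `|B (z * x) / B z - x `^ (- alpha)| <= eps / 2 by near: z.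
have x1 : 1 <= z' / z by rewrite ler_pdivlMr// mul1r.
have zz : z * (z' / z) = z' by rewrite mulrC divfK// gt_eqF.
have := ka _ x1; have := kB _ x1; rewrite zz.
rewrite (_ : B z' / B z = (b z' / b z) `^ th); last first.
  by rewrite /B !powR_expR ?divr_gt0// ln_div ?posrE// -expRN -expRD; congr expR; ring.
rewrite -/th !ler_norml => /andP[? ?] /andP[? ?]; apply/andP; split; lra.
Unshelve. all: by end_near. Qed.

End regular_variation.

(** * Survival functions as uniform variables *)

Lemma measurable_inv_real {R : realType} : measurable_fun setT (@GRing.inv R).
Proof.
have -> : [set: R] = [set 0] `|` ~` [set (0 : R)] by rewrite setUv.
apply/measurable_funU => //; first exact: measurableC.
split; first exact: measurable_fun_set1.
apply: open_continuous_measurable_fun; first exact: closed_openC.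
by move=> x; rewrite inE/= => /eqP x0; exact: inv_continuous.
Qed.

Section measurable_comparisons.
Context {d : measure_display} {T : measurableType d} {R : realType}.
Implicit Types f g : T -> R.

Lemma measurable_leset f g : measurable_fun setT f -> measurable_fun setT g ->
  measurable [set w | f w <= g w].
Proof.
by move=> mf mg; rewrite -[X in measurable X]setTI; exact: measurable_fun_le.
Qed.

Lemma measurable_ltset f g : measurable_fun setT f -> measurable_fun setT g ->
  measurable [set w | f w < g w].
Proof.
move=> mf mg; rewrite (_ : [set w | _] = ~` [set w | g w <= f w]).
  by apply: measurableC; exact: measurable_leset.
by apply/seteqP; split => w /=; rewrite ltNge => /negP.
Qed.

End measurable_comparisons.

Section probability_integral_transform.
Context {d : measure_display} {T : measurableType d} {R : realType}.
Variables (P : probability T R) (Y : {RV P >-> R}).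
Hypothesis Ycont : continuous_RV P Y.
Hypothesis Ylt1 : forall x, rcdf P Y x < 1.
Local Notation mu := (@lebesgue_measure R).
Local Notation K := (rcdf P Y).
Local Notation s := (survival (rcdf P Y)).

Lemma rcdfE x : P [set w | Y w <= x] = (K x)%:E.
Proof.
rewrite /rcdf /cdf fineK ?fin_num_measure//.
Qed.

Lemma rcdf_continuous_cdf : continuous_cdf K.
Proof.
split.
- by move=> x y xy; rewrite fine_le ?fin_num_measure ?cdf_nondecreasing.
- exact: Ycont.
- by have /fine_cvgP[] := cvg_cdfy1 Y.
- by have /fine_cvgP[] := cvg_cdfNy0 Y.
Qed.
Let HK := rcdf_continuous_cdf.

Lemma survival_gt0 x : 0 < s x.
Proof. by rewrite subr_gt0. Qed.

Lemma survival_le1 x : s x <= 1.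
Proof. by rewrite gerBl continuous_cdf_ge0. Qed.

Lemma survival_anti : {homo s : x y / x <= y >-> y <= x}.
Proof. by move=> x y xy; rewrite lerD2l lerN2 (ccdf_homo HK). Qed.

Lemma measurable_survival : measurable_fun setT s.
Proof. by apply: nonincreasing_measurable => // x y; exact: survival_anti. Qed.

Lemma measurable_gt x : measurable [set w | x < Y w].
Proof. exact: measurable_ltset. Qed.

Lemma survivalE x : P [set w | x < Y w] = (s x)%:E.
Proof.
rewrite (_ : [set w | x < Y w] = ~` [set w | Y w <= x]); last first.
  by apply/seteqP; split => w /=; rewrite ltNge => /negP.
rewrite probability_setC ?rcdfE//.
exact: measurable_leset.
Qed.

Lemma measurable_survival_comp : measurable_fun setT (fun w => s (Y w)).
Proof. exact: (measurableT_comp measurable_survival). Qed.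

Lemma survival_uniform x : 0 <= x <= 1 ->
  P [set w | x < s (Y w)] = (1 - x)%:E.
Proof.
move=> /andP[]; rewrite le_eqVlt => /predU1P[<- _|x0].
  rewrite subr0 (_ : [set w | _] = setT) ?probability_setT//.
  by apply/seteqP; split => w //= _; exact: survival_gt0.
rewrite le_eqVlt => /predU1P[->|x1].
  rewrite subrr (_ : [set w | _] = set0) ?measure0//.
  by apply/seteqP; split => w //=; rewrite ltNge survival_le1.
have q01 : 0 < 1 - x < 1 by apply/andP; split; lra.
pose q := quantile K (1 - x).
have Kq : K q = 1 - x by exact: cdf_quantile.
have E : [set w | x < s (Y w)] = [set w | Y w < q].
  apply/seteqP; split => w /=; rewrite /survival !ltNge => /negP H; apply/negP.
    by move: H; apply: contra_not; rewrite /q quantile_le//; lra.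
  by move: H; apply: contra_not; rewrite /q quantile_le//; lra.
have mE : measurable [set w | Y w < q].
  exact: measurable_ltset.
have mle y : measurable [set w | Y w <= y].
  exact: measurable_leset.
rewrite E -[LHS]fineK ?fin_num_measure//; congr EFin; apply/eqP.
rewrite eq_le; apply/andP; split.
  rewrite -Kq -lee_fin -rcdfE fineK ?fin_num_measure//.
  by apply: le_measure; rewrite ?inE// => w /= /ltW.
have Kql : K y @[y --> q^'-] --> K q by apply: cvg_at_left_filter; exact: Ycont.
rewrite -Kq; apply: (ler_cvg_to Kql (cvg_cst _)).
near=> y; rewrite -lee_fin -rcdfE fineK ?fin_num_measure//.
apply: le_measure; rewrite ?inE// => w /= /le_lt_trans; apply.
by near: y; exact: nbhs_left_lt.
Unshelve. all: by end_near. Qed.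

Lemma ge0_integral_survival (q : R -> \bar R) : measurable_fun setT q ->
  (forall u, 0 <= q u)%E ->
  (\int[P]_w q (s (Y w)) = \int[mu]_(u in `[0%R, 1%R]) q u)%E.
Proof.
move=> mq q0.
have mS : measurable_fun setT (fun w => s (Y w) : measurableTypeR R).
  exact: measurable_survival_comp.
pose S : {mfun T >-> measurableTypeR R} :=
  HB.pack (fun w => s (Y w) : measurableTypeR R) (isMeasurableFun.Build _ _ _ _ _ mS).
have law A : measurable A -> distribution P S A = uniform_prob (@ltr01 R) A.
  have uE B : measurable B -> uniform_prob (@ltr01 R) B = mu (B `&` `[0, 1]%classic).
    move=> mB; rewrite -[B in LHS]setIT -integral_indic//.
    rewrite integral_uniform//; last exact/measurable_EFinP/measurable_indic.
    by rewrite subr0 invr1 mul1e integral_indic.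
  have H := @measure_unique _ R (measurableTypeR R) (@RGenOInfty.G R)
    (fun n => `]- n%:R, +oo[%classic) _ _ _ _
    (distribution P S) (uniform_prob (@ltr01 R)).
  apply: H.
  - exact: RGenOInfty.measurableE.
  - move=> _ _ [x ->] [y ->]; exists (Num.max x y).
    apply/seteqP; split => z /=; rewrite !in_itv/= !andbT gt_max.
      by move=> [-> ->].
    by move=> /andP[].
  - by move=> n; exists (- n%:R).
  - apply/seteqP; split => // x _; exists (Num.bound `|x|) => //=.
    rewrite in_itv/= andbT ltrNl (le_lt_trans (ler_norm _))// normrN.
    exact: archi_boundP.
  - move=> _ [x ->]; rewrite /=.
    have -> : distribution P S `]x, +oo[%classic = P [set w | x < s (Y w)].
      rewrite /distribution /pushforward; congr (P _).
      by apply/seteqP; split => w /=; rewrite in_itv/= andbT.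
    rewrite [RHS]uE//.
    have [x0|x0] := ltP x 0.
      rewrite (_ : [set w | _] = setT) ?probability_setT; last first.
        apply/seteqP; split => w //= _; apply: lt_trans x0 _; exact: survival_gt0.
      rewrite (_ : _ `&` _ = `[0, 1]%classic).
        by rewrite lebesgue_measure_itv/= lte_fin ltr01 sube0.
      apply/seteqP; split => u /=; rewrite !in_itv/= ?andbT; first by case.
      by move=> /andP[u0 u1]; rewrite u0 u1 (lt_le_trans x0 u0).
    have [x1|x1] := leP 1 x.
      rewrite (_ : [set w | _] = set0); last first.
        by apply/seteqP; split => w //=; rewrite ltNge (le_trans _ x1)// survival_le1.
      rewrite (_ : _ `&` _ = set0) ?measure0//.
      apply/seteqP; split => u //=; rewrite !in_itv/= andbT => -[xu /andP[_ u1]].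
      by move: xu; rewrite ltNge (le_trans u1).
    rewrite survival_uniform ?x0 ?(ltW x1)//.
    rewrite (_ : _ `&` _ = `]x, 1]%classic).
      by rewrite lebesgue_measure_itv/= lte_fin x1.
    apply/seteqP; split => u /=; rewrite !in_itv/= ?andbT.
      by move=> [-> /andP[_ ->]].
    by move=> /andP[xu u1]; rewrite xu u1 (le_trans x0 (ltW xu)).
  - by move=> n; rewrite (le_lt_trans (probability_le1 _ _)) ?ltry.
rewrite -[LHS](ge0_integral_distribution S mq q0).
rewrite (eq_measure_integral (uniform_prob (@ltr01 R))); last first.
  by move=> A mA _; exact: law.
by rewrite integral_uniform// subr0 invr1 mul1e.
Qed.

(** The uniform law of s(Y) has no atoms. *)
Lemma survival_tie (c : R) : {ae P, forall w, s (Y w) != c}.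
Proof.
exists [set w | s (Y w) = c]; split.
- have := measurable_survival_comp measurableT (measurable_set1 c).
  by rewrite setTI.
- have m1 : measurable_fun setT (fun u : R => (\1_[set c] u : R)%:E).
    exact/measurable_EFinP/measurable_indic.
  have i0 : (\int[mu]_(u in `[0%R, 1%R]) (\1_[set c] u : R)%:E = 0)%E.
    rewrite integral_indic//; apply/eqP.
    rewrite eq_le measure_ge0 andbT -(lebesgue_measure_set1 c).
    by apply: le_measure; rewrite ?inE//; exact: measurableI.
  have mc : measurable [set w | s (Y w) = c].
    by have := measurable_survival_comp measurableT (measurable_set1 c); rewrite setTI.
  rewrite -i0 -ge0_integral_survival//.
  by rewrite -[X in P X]setIT -integral_indic.
- by move=> w /= /negP; rewrite negbK => /eqP.
Qed.

(** Up to a null event, Y exceeds z when the uniform variable s(Y) is below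
    s z. *)
Lemma ge0_integral_tail (q : R -> R) z : measurable_fun setT q ->
  (forall u, 0 <= q u) ->
  (\int[P]_w (\1_[set w | z < Y w] w * q (s (Y w)))%:E =
   \int[mu]_(u in `[0%R, s z]) (q u)%:E)%E.
Proof.
move=> mq q0.
pose q' u := \1_(`]-oo, s z]%classic : set R) u * q u.
have mq' : measurable_fun setT (fun u => (q' u)%:E).
  by apply/measurable_EFinP; apply: measurable_funM.
have q'0 u : (0 <= (q' u)%:E)%E by rewrite lee_fin mulr_ge0.
transitivity (\int[P]_w (q' (s (Y w)))%:E)%E.
  apply: ae_eq_integral => //.
  - apply/measurable_EFinP; apply: measurable_funM.
      by apply: measurable_indic; exact: measurable_gt.
    exact: (measurableT_comp mq measurable_survival_comp).
  - exact: (measurableT_comp mq' measurable_survival_comp).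
  - have := survival_tie (s z); apply: filterS => w sz _; congr EFin; congr (_ * _).
    rewrite !indicE; congr ((nat_of_bool _)%:R); apply/idP/idP; rewrite !inE/= in_itv/=.
      by move=> /ltW; exact: survival_anti.
    by rewrite le_eqVlt (negbTE sz)/= => h; rewrite ltNge;
      apply/negP => /survival_anti; rewrite leNgt h.
rewrite (ge0_integral_survival mq' q'0) integral_mkcond [RHS]integral_mkcond.
apply: eq_integral => u _; rewrite !patchE !mem_setE !in_itv/= /q' indicE mem_setE in_itv/=.
have sz1 := survival_le1 z.
case: (leP 0 u) => //= u0; case: (leP u (s z)) => [usz|usz].
  by rewrite (le_trans usz sz1) mul1r.
by rewrite mul0r; case: ifP.
Qed.

End probability_integral_transform.

Section tail_integrals.
Context {R : realType}.
Local Notation mu := (@lebesgue_measure R).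

Lemma integral_antiderivative_pos (F q : R -> R) (b a : R) : 0 < b <= a ->
  (forall u : R, 0 < u -> is_derive u (1 : R) F (q u)) ->
  (forall u : R, 0 < u -> {for u, continuous q}) ->
  (\int[mu]_(u in `[b, a]) (q u)%:E = (F a - F b)%:E)%E.
Proof.
move=> /andP[b0]; rewrite le_eqVlt => /predU1P[<- _ _|ba dF cq].
  by rewrite set_itv1 integral_set1 subrr.
have u0 u : b <= u -> 0 < u by exact: lt_le_trans.
have cF u : 0 < u -> {for u, continuous F}.
  by move=> /dF [] /derivable1_diffP/differentiable_continuous.
rewrite (@continuous_FTC2 _ q F b a) ?EFinB//.
- apply: continuous_in_subspaceT => u; rewrite inE/= in_itv/= => /andP[bu _].
  exact/cq/u0.
- split.
  + by move=> u; rewrite in_itv/= => /andP[/ltW/u0/dF[]].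
  + exact/cvg_at_right_filter/cF.
  + by apply/cvg_at_left_filter/cF; exact: lt_trans ba.
- move=> u; rewrite in_itv/= => /andP[/ltW/u0 /dF du _].
  by rewrite derive1E; exact: derive_val.
Qed.

Lemma integral_powR_ratio (a th : R) : 0 < a -> 0 < th ->
  (\int[mu]_(u in `[0%R, a]) ((u / a) `^ th)%:E = (a / (1 + th))%:E)%E.
Proof.
move=> a0 th0; pose k := a^-1 `^ th.
have th10 : 0 < 1 + th by rewrite addr_gt0.
have thn0 : th != 0 by rewrite gt_eqF.
pose q u := u `^ th * k; pose F (u : R) := k / (1 + th) * u `^ (1 + th).
have dF (u : R) : 0 < u -> is_derive u (1 : R) F (q u).
  move=> u0; have ? := is_derive1_powR (1 + th) u0.
  apply: is_derive_eq; rewrite /GRing.scale/= /q addrAC subrr add0r.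
  by field; rewrite gt_eqF.
have cpow (r u : R) : 0 < u -> {for u, continuous (fun u => u `^ r)}.
  by move=> /(is_derive1_powR r) [] /derivable1_diffP/differentiable_continuous.
transitivity (\int[mu]_(u in `[0%R, a]) (q u)%:E)%E.
  apply: eq_integral => u; rewrite inE/= in_itv/= => /andP[u0 _].
  by rewrite powRM// invr_ge0 ltW.
rewrite (@continuous_FTC2 _ q F 0 a)//.
- rewrite /F powR0 ?gt_eqF// mulr0 sube0; congr EFin.
  rewrite powRD ?gt_eqF ?implybT// powRr1 ?ltW//.
  rewrite (_ : _ * _ = a / (1 + th) * (a `^ th * k)); last by ring.
  by rewrite /k -powRM ?invr_ge0 ?ltW// divff ?gt_eqF// powR1 mulr1.
- apply/continuous_within_itvP => //; split.
  + move=> u; rewrite in_itv/= => /andP[u0 _]; apply: cvgMr_tmp; exact: cpow.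
  + by rewrite /q powR0// ; apply: cvgMr_tmp; exact: powR_cvg0.
  + by apply: cvgMr_tmp; apply/cvg_at_left_filter/cpow.
- split.
  + by move=> u; rewrite in_itv/= => /andP[/dF[]].
  + by rewrite /F powR0 ?gt_eqF//; apply: cvgMl_tmp; exact: powR_cvg0.
  + by apply: cvgMl_tmp; apply/cvg_at_left_filter/cpow.
- move=> u; rewrite in_itv/= => /andP[/dF du _].
  by rewrite derive1E; exact: derive_val.
Qed.

End tail_integrals.

Section tail_means.
Context {d : measure_display} {T : measurableType d} {R : realType}.
Variables (P : probability T R) (Y : {RV P >-> R}).
Hypothesis Ycont : continuous_RV P Y.
Hypothesis Ylt1 : forall x, rcdf P Y x < 1.
Local Notation s := (survival (rcdf P Y)).

Lemma measurable_gt_indic (z : R) :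
  measurable_fun setT (\1_[set w | z < Y w] : T -> R).
Proof. by apply: measurable_indic; exact: measurable_gt. Qed.

Lemma Rintegral_gt z : (\int[P]_w \1_[set w | z < Y w] w)%R = s z.
Proof. by rewrite Rintegral_indic ?survivalE//; exact: measurable_gt. Qed.

(** By regular variation a (Y) / a z is uniformly close to (s (Y) / s z)^th,
    and s (Y) / s z is uniform on [0, 1] given Y > z: the mean of U^th is
    1 / (1 + th). *)
Lemma tail_ratio_mean (a : R -> R) (th : R) : 0 < th ->
  {homo a : x y / x <= y >-> y <= x} -> (forall x, 0 < a x) ->
  (forall eps, 0 < eps -> \forall z \near +oo, forall z', z <= z' ->
     `|a z' / a z - (s z' / s z) `^ th| <= eps) ->
  (\int[P]_w (\1_[set w | (z < Y w)%R] w * (a (Y w) / a z)))%R / s z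
    @[z --> +oo] --> (1 + th)^-1.
Proof.
move=> th0 ah a0 Ha; apply/cvgrPdist_le => eps eps0.
have := Ha _ eps0; apply: filterS => z Hz.
have sz0 : 0 < s z by exact: survival_gt0.
have ma : measurable_fun setT (fun w => a (Y w)).
  by apply: (measurableT_comp (nonincreasing_measurable _ _)).
have ms := measurable_survival_comp Ycont.
have mi := measurable_gt_indic z.
have mpow : measurable_fun setT (fun w => (s (Y w) / s z) `^ th).
  by apply: (measurableT_comp (measurable_powR th)); exact: measurable_funM.
have itv (f : T -> R) (C : R) : measurable_fun setT f -> 0 <= C ->
    (forall w, z < Y w -> `|f w| <= C) ->
    P.-integrable setT (EFin \o (fun w => \1_[set w | z < Y w] w * f w)).
  move=> mf C0 fC; apply: (@integrable_bounded _ _ _ P _ C).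
    exact: measurable_funM.
  move=> w; rewrite indicE; case: (boolP (_ \in _)); rewrite ?mul0r ?normr0// inE/=.
  by move=> /fC; rewrite mul1r.
have i1 : P.-integrable setT
    (EFin \o (fun w => \1_[set w | z < Y w] w * (a (Y w) / a z))).
  apply: (itv _ 1) => //; first exact: measurable_funM.
  move=> w zY; rewrite ger0_norm ?divr_ge0 ?(ltW (a0 _))//.
  by rewrite ler_pdivrMr// mul1r ah// ltW.
have sr1 w : z < Y w -> 0 <= s (Y w) / s z <= 1.
  move=> zY; rewrite divr_ge0 ?(ltW (survival_gt0 Ylt1 _))//= ler_pdivrMr// mul1r.
  by rewrite survival_anti// ltW.
have i2 : P.-integrable setT
    (EFin \o (fun w => \1_[set w | z < Y w] w * (s (Y w) / s z) `^ th)).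
  apply: (itv _ 1) => // w /sr1 /andP[sr0 sr1'].
  rewrite ger0_norm ?powR_ge0// [leRHS](_ : 1 = 1 `^ th); last by rewrite powR1.
  by apply: ge0_ler_powR; rewrite ?nnegrE ?(ltW th0).
have i3 : P.-integrable setT (EFin \o (\1_[set w | z < Y w] : T -> R)).
  apply: (@integrable_bounded _ _ _ P _ 1) => // w.
  by rewrite indicE; case: (_ \in _); rewrite ?normr0 ?normr1.
have E2 : (\int[P]_w (\1_[set w | z < Y w] w * (s (Y w) / s z) `^ th))%R =
    s z / (1 + th).
  rewrite /Rintegral (ge0_integral_tail Ycont Ylt1 (q := fun u => (u / s z) `^ th)).
  - by rewrite integral_powR_ratio.
  - by apply: (measurableT_comp (measurable_powR th)); exact: measurable_funM.
  - by move=> u; exact: powR_ge0.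
have diff : `|(\int[P]_w (\1_[set w | z < Y w] w * (s (Y w) / s z) `^ th))%R -
    (\int[P]_w (\1_[set w | z < Y w] w * (a (Y w) / a z)))%R| <= eps * s z.
  have i4 := integrableBr i2 i1.
  rewrite -(RintegralB measurableT i2 i1) -[in leRHS](Rintegral_gt z).
  rewrite -(RintegralZl eps measurableT i3).
  have i5 := integrable_norm i4.
  apply: (le_trans (le_normr_Rintegral measurableT i4)).
  apply: (le_Rintegral measurableT i5 (integrableZr eps i3)).
  move=> w _ /=; rewrite -mulrBr indicE; case: (boolP (_ \in _)); rewrite ?mul0r ?normr0 ?mulr0//.
  by rewrite inE/= => zY; rewrite mul1r mulr1 distrC Hz// ltW.
rewrite E2 in diff; rewrite -[(1 + th)^-1](mulfK (lt0r_neq0 sz0)).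
rewrite [_ * s z]mulrC -mulrBl normrM normfV (gtr0_norm sz0) ler_pdivrMr//.
Qed.

End tail_means.

(** * Moments of the score under random censoring *)

Lemma indic_bool {U : Type} {R : pzRingType} (b : U -> bool) (x : U) :
  \1_[set x | b x] x = (b x)%:R :> R.
Proof.
by rewrite indicE; congr ((nat_of_bool _)%:R); apply/idP/idP; rewrite inE.
Qed.

Section competing_risks.
Context {d : measure_display} {T : measurableType d} {R : realType}.
Variables (P : probability T R) (X Y : {RV P >-> R}).
Hypothesis Xcont : continuous_RV P X.
Hypothesis Xlt1 : forall x, rcdf P X x < 1.
Hypothesis XY : independent_RV P X Y.
Local Notation mu := (@lebesgue_measure R).
Local Notation s := (survival (rcdf P X)).

(** A function of (Y, X), the censoring time first, that is q1 (s X) on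
    uncensored and q2 (s Y) on censored observations later than z. *)
Definition competing_fun (z : R) (q1 q2 : R -> R) (p : R * R) : R :=
  \1_[set p : R * R | z < p.1] p *
  (\1_[set p : R * R | z < p.2] p * \1_[set p : R * R | p.2 <= p.1] p * q1 (s p.2) +
   \1_[set p : R * R | p.1 < p.2] p * q2 (s p.1)).

Variables (z : R) (q1 q2 r : R -> R).
Hypothesis mq1 : measurable_fun setT q1.
Hypothesis mq2 : measurable_fun setT q2.
Hypothesis mr : measurable_fun setT r.
Hypothesis q10 : forall u, 0 <= q1 u.
Hypothesis q20 : forall u, 0 <= q2 u.
Hypothesis q12r : forall b, 0 < b <= s z ->
  (\int[mu]_(u in `[b, s z]) (q1 u)%:E + (b * q2 b)%:E = (r b)%:E)%E.

Let ms : measurable_fun setT s. Proof. exact: measurable_survival. Qed.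

Let measurable_competing : measurable_fun setT (competing_fun z q1 q2).
Proof.
have m1 : measurable_fun setT (fun p : R * R => p.1) by exact: measurable_fst.
have m2 : measurable_fun setT (fun p : R * R => p.2) by exact: measurable_snd.
have i1 : measurable_fun setT (\1_[set p : R * R | z < p.1] : R * R -> R).
  by apply: measurable_indic; exact: measurable_ltset.
have i2 : measurable_fun setT (\1_[set p : R * R | z < p.2] : R * R -> R).
  by apply: measurable_indic; exact: measurable_ltset.
have i3 : measurable_fun setT (\1_[set p : R * R | p.2 <= p.1] : R * R -> R).
  by apply: measurable_indic; exact: measurable_leset.
have i4 : measurable_fun setT (\1_[set p : R * R | p.1 < p.2] : R * R -> R).
  by apply: measurable_indic; exact: measurable_ltset.
apply: measurable_funM => //; apply: measurable_funD.
  apply: measurable_funM; first exact: measurable_funM.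
  by apply: (measurableT_comp mq1); exact: (measurableT_comp ms).
by apply: measurable_funM => //; apply: (measurableT_comp mq2);
  exact: (measurableT_comp ms).
Qed.

Let competing_ge0 p : 0 <= competing_fun z q1 q2 p.
Proof. by rewrite mulr_ge0// addr_ge0// !mulr_ge0. Qed.

Let inner y : (\int[P]_w (competing_fun z q1 q2 (y, X w))%:E =
  (\1_[set y : R | z < y] y * r (s y))%:E)%E.
Proof.
rewrite /competing_fun; have [zy|yz] := ltP z y; last first.
  have E : (\1_[set y : R | z < y] y : R) = 0.
    by rewrite indicE memNset//= => /lt_geF; rewrite yz.
  rewrite E mul0r; apply: integral0_eq => w _.
  by rewrite indicE memNset/= ?mul0r// => /lt_geF; rewrite yz.
have E : (\1_[set y : R | z < y] y : R) = 1 by rewrite indicE mem_set.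
rewrite E mul1r.
have sy0 : 0 < s y by exact: survival_gt0.
have sysz : s y <= s z by rewrite survival_anti// ltW.
pose g1 w := \1_[set w | z < X w] w * \1_[set w | X w <= y] w * q1 (s (X w)).
pose g2 w := \1_[set w | y < X w] w * q2 (s y).
have mle : measurable [set w | X w <= y] by exact: measurable_leset.
have mi w := measurable_gt_indic X w.
have msX := measurable_survival_comp Xcont.
have mg1 : measurable_fun setT g1.
  apply: measurable_funM; last exact: (measurableT_comp mq1).
  by apply: measurable_funM => //; exact: measurable_indic.
have mg2 : measurable_fun setT g2 by exact: measurable_funM.
have g10 w : 0 <= g1 w by rewrite !mulr_ge0.
have g20 w : 0 <= g2 w by rewrite !mulr_ge0.
transitivity (\int[P]_w (g1 w)%:E + \int[P]_w (g2 w)%:E)%E.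
  rewrite -ge0_integralD//; last 4 first.
  - by move=> w _; rewrite lee_fin.
  - exact/measurable_EFinP.
  - by move=> w _; rewrite lee_fin.
  - exact/measurable_EFinP.
  apply: eq_integral => w _; rewrite -EFinD; congr EFin.
  by rewrite /g1 /g2 !indic_bool /= zy mul1r.
have G2 : (\int[P]_w (g2 w)%:E = (s y * q2 (s y))%:E)%E.
  rewrite Rintegral_fine; last first.
    apply: (@integrable_bounded _ _ _ P _ (q2 (s y))) => // w.
    by rewrite ger0_norm// /g2 indicE; case: (_ \in _); rewrite ?mul1r ?mul0r.
  congr EFin; rewrite /g2 RintegralZr ?Rintegral_gt//.
  apply: (@integrable_bounded _ _ _ P _ 1) => // w.
  by rewrite indicE; case: (_ \in _); rewrite ?normr0 ?normr1.
pose q1' u := \1_(`[s y, +oo[%classic : set R) u * q1 u.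
have mq1' : measurable_fun setT q1' by exact: measurable_funM.
have q1'0 u : 0 <= q1' u by rewrite mulr_ge0.
have G1 : (\int[P]_w (g1 w)%:E = \int[mu]_(u in `[s y, s z]) (q1 u)%:E)%E.
  transitivity (\int[P]_w (\1_[set w | z < X w] w * q1' (s (X w)))%:E)%E.
    apply: ae_eq_integral => //.
    - exact/measurable_EFinP.
    - apply/measurable_EFinP; apply: measurable_funM => //.
      exact: (measurableT_comp mq1').
    - have := survival_tie Xcont Xlt1 (s y); apply: filterS => w sy _; congr EFin.
      rewrite /g1 /q1' -mulrA; congr (_ * (_ * _)).
      rewrite !indicE; congr ((nat_of_bool _)%:R); apply/idP/idP; rewrite !inE/= in_itv/= andbT.
        exact: survival_anti.
      rewrite le_eqVlt eq_sym (negbTE sy)/= leNgt => syX; apply/negP => /ltW yX.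
      by move: syX; rewrite ltNge survival_anti.
  rewrite (ge0_integral_tail Xcont Xlt1 z mq1' q1'0).
  rewrite integral_mkcond [RHS]integral_mkcond; apply: eq_integral => u _.
  rewrite !patchE !mem_setE !in_itv/= /q1' indicE mem_setE in_itv/= andbT.
  case: (leP (s y) u) => [syu|usy] /=; last by rewrite mul0r; case: ifP.
  by rewrite (le_trans (ltW sy0) syu) mul1r.
by rewrite G1 G2 q12r// sy0.
Qed.

(** Integrating out the lifetime: given Y = y > z, the uniform variable s(X)
    runs over [s y, s z] when the observation is uncensored, and is below s y,
    with probability s y, when it is censored. *)
Lemma competing_integral :
  (\int[P]_w (competing_fun z q1 q2 (Y w, X w))%:E =
   \int[P]_w (\1_[set w | z < Y w] w * r (s (Y w)))%:E)%E.
Proof.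
have YX : independent_RV P Y X.
  by move=> A B mA mB; rewrite setIC XY// muleC.
rewrite (independent_ge0_integral YX (f := EFin \o competing_fun z q1 q2))//; last first.
  exact/measurable_EFinP.
pose g y := \1_[set y : R | z < y] y * r (s y).
have gE y : (\int[distribution P X]_x (competing_fun z q1 q2 (y, x))%:E = (g y)%:E)%E.
  rewrite (ge0_integral_distribution X
    (f := fun x => (competing_fun z q1 q2 (y, x))%:E))//; first exact: inner.
    apply/measurable_EFinP; apply: (measurableT_comp measurable_competing).
    exact: measurable_pair1.
  by move=> x; rewrite lee_fin.
have g0 y : 0 <= g y.
  rewrite -lee_fin -gE; apply: integral_ge0 => x _; by rewrite lee_fin.
have mg : measurable_fun setT g.
  apply: measurable_funM; last exact: (measurableT_comp mr).
  by apply: measurable_indic; exact: measurable_ltset.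
under eq_integral do rewrite /= gE.
rewrite (ge0_integral_distribution Y (f := fun y => (g y)%:E))//.
exact/measurable_EFinP.
Qed.

End competing_risks.

Section score_moments.
Context {d : measure_display} {T : measurableType d} {R : realType}.
Variables (P : probability T R) (X Y : {RV P >-> R}).
Hypothesis Xcont : continuous_RV P X.
Hypothesis Xlt1 : forall x, rcdf P X x < 1.
Hypothesis Ycont : continuous_RV P Y.
Hypothesis Ylt1 : forall x, rcdf P Y x < 1.
Hypothesis XY : independent_RV P X Y.
Local Notation mu := (@lebesgue_measure R).
Local Notation s := (survival (rcdf P X)).
Local Notation sY := (survival (rcdf P Y)).
Local Notation Q := (distribution P (observation X Y)).
Local Notation exceeds z := (\1_[set v : R * R | (z < v.1)%R]).

(** For an observation v = (time, indicator), this is minus the martingale of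
    the uncensored deaths after z: the cumulative hazard run since z minus the
    death count. *)
Definition score (z : R) (v : R * R) : R :=
  exceeds z v * (ln (s z / s v.1) - v.2).

(** The probability of an uncensored observation later than z, with the
    lifetime integrated out. *)
Definition uncensored_mass (z : R) : R :=
  (\int[P]_w (\1_[set w | (z < Y w)%R] w * (s z - s (Y w))))%R.

Let s0 x : 0 < s x. Proof. exact: survival_gt0. Qed.

Lemma observation_split (h : R * R -> R) (q1 q2 : R -> R) z w :
  (forall x, z < x -> h (x, 1) = q1 (s x)) ->
  (forall x, z < x -> h (x, 0) = q2 (s x)) ->
  exceeds z (observation X Y w) * h (observation X Y w) =
  competing_fun X z q1 q2 (Y w, X w).
Proof.
move=> h1 h0; rewrite /competing_fun /observation /observed_time /censoring_indicator.
rewrite !indic_bool/= lt_min.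
have [XY'|YX] := leP (X w) (Y w); last first.
  rewrite mulr0 mul0r add0r mul1r.
  have [zY|zY] := ltP z (Y w); last by rewrite andbF !mul0r.
  by rewrite (lt_trans zY YX)/= !mul1r h0.
rewrite mul0r addr0 mulr1.
have [zX|zX] := ltP z (X w); last by rewrite !mul0r mulr0.
by rewrite (lt_le_trans zX XY')/= !mul1r h1.
Qed.

Lemma measurable_time_indic z :
  measurable_fun setT (exceeds z : R * R -> R).
Proof. by apply: measurable_indic; exact: measurable_ltset. Qed.

Lemma measurable_score z : measurable_fun setT (score z).
Proof.
apply: measurable_funM; first exact: measurable_time_indic.
apply: measurable_funB => //.
apply: (measurableT_comp (@measurable_ln R)).
apply: (@measurable_comp _ _ _ _ _ _ setT (fun x : R => s z / s x)) => //.
have : {homo (fun x : R => s z / s x) : x y / x <= y}.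
  move=> x y xy; rewrite ler_pM2l// lef_pV2 ?posrE//.
  by apply: survival_anti.
by move=> hom; apply: nondecreasing_measurable.
Qed.

Let integral_split (h : R * R -> R) (q1 q2 r : R -> R) z :
  measurable_fun setT q1 -> measurable_fun setT q2 -> measurable_fun setT r ->
  (forall u, 0 <= q1 u) -> (forall u, 0 <= q2 u) ->
  (forall x, z < x -> h (x, 1) = q1 (s x)) ->
  (forall x, z < x -> h (x, 0) = q2 (s x)) ->
  (forall b, 0 < b <= s z ->
    (\int[mu]_(u in `[b, s z]) (q1 u)%:E + (b * q2 b)%:E = (r b)%:E)%E) ->
  (\int[P]_w (exceeds z (observation X Y w) *
     h (observation X Y w))%:E =
   \int[P]_w (\1_[set w | (z < Y w)%R] w * r (s (Y w)))%:E)%E.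
Proof.
move=> mq1 mq2 mr q10 q20 h1 h0 E.
rewrite -(competing_integral Xcont Xlt1 XY mq1 mq2 mr q10 q20 E).
by apply: eq_integral => w _; rewrite (observation_split w h1 h0).
Qed.

Let continuous_ln_ratio (a u : R) : 0 < u -> {for u, continuous (fun u => ln a - ln u)}.
Proof. by move=> u0; apply: cvgB; [exact: cvg_cst|exact: continuous_ln]. Qed.

Let ln_ratio_ge0 (a b u : R) : 0 < b -> u \in `[b, a]%classic ->
  0 < u /\ 0 <= ln a - ln u /\ ln (a / u) = ln a - ln u.
Proof.
move=> b0; rewrite inE/= in_itv/= => /andP[bu ua].
have u0 : 0 < u by exact: lt_le_trans bu.
split => //; split; first by rewrite subr_ge0 ler_ln ?posrE// (lt_le_trans u0).
by rewrite ln_div ?posrE// (lt_le_trans u0).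
Qed.

Let integral_ln_ratio (a b : R) : 0 < b <= a ->
  (\int[mu]_(u in `[b, a]) (`|ln (a / u)|)%:E = (a - b * (ln a - ln b + 1))%:E)%E.
Proof.
move=> ba; have /andP[b0 _] := ba.
pose F (u : R) := u * (ln a - ln u + 1).
transitivity (\int[mu]_(u in `[b, a]) (ln a - ln u)%:E)%E.
  by apply: eq_integral => u /(ln_ratio_ge0 b0) [_ [l0 ->]]; rewrite ger0_norm.
transitivity ((F a - F b)%:E); last by rewrite /F subrr add0r mulr1.
have dF (u : R) : 0 < u -> is_derive u (1 : R) F (ln a - ln u).
  move=> u0; have ? := is_derive1_ln u0; apply: is_derive_eq.
   by rewrite /GRing.scale/=; field; rewrite gt_eqF.
apply: (integral_antiderivative_pos ba dF) => u u0.
exact: continuous_ln_ratio.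
Qed.

Let integral_ln_ratio_sqr (a b : R) : 0 < b <= a ->
  (\int[mu]_(u in `[b, a]) ((ln (a / u) - 1) ^+ 2)%:E =
   (a - b * (1 + (ln a - ln b) ^+ 2))%:E)%E.
Proof.
move=> ba; have /andP[b0 _] := ba.
pose F (u : R) := u * (1 + (ln a - ln u) ^+ 2).
transitivity (\int[mu]_(u in `[b, a]) ((ln a - ln u - 1) ^+ 2)%:E)%E.
  by apply: eq_integral => u /(ln_ratio_ge0 b0) [_ [_ ->]].
transitivity ((F a - F b)%:E); last by rewrite /F subrr expr0n addr0 mulr1.
have dF (u : R) : 0 < u -> is_derive u (1 : R) F ((ln a - ln u - 1) ^+ 2).
  move=> u0; have ? := is_derive1_ln u0; apply: is_derive_eq.
   by rewrite /GRing.scale/=; field; rewrite gt_eqF.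
apply: (integral_antiderivative_pos ba dF) => u u0.
have c := @continuous_ln_ratio a u u0.
  by apply: cvgM; apply: cvgB => //; exact: cvg_cst.
Qed.

Let integral_ln_ratio_cube (a b : R) : 0 < b <= a ->
  (\int[mu]_(u in `[b, a]) (`|ln (a / u)| ^+ 3)%:E =
   (6 * a - b * ((ln a - ln b) ^+ 3 + 3 * (ln a - ln b) ^+ 2 + 6 * (ln a - ln b) + 6))%:E)%E.
Proof.
move=> ba; have /andP[b0 _] := ba.
pose F (u : R) := u * ((ln a - ln u) ^+ 3 + 3 * (ln a - ln u) ^+ 2 + 6 * (ln a - ln u) + 6).
transitivity (\int[mu]_(u in `[b, a]) ((ln a - ln u) ^+ 3)%:E)%E.
  by apply: eq_integral => u /(ln_ratio_ge0 b0) [_ [l0 ->]]; rewrite ger0_norm.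
transitivity ((F a - F b)%:E); last by rewrite /F subrr !expr0n/= !mulr0 !add0r mulrC.
have dF (u : R) : 0 < u -> is_derive u (1 : R) F ((ln a - ln u) ^+ 3).
  move=> u0; have ? := is_derive1_ln u0; apply: is_derive_eq.
   by rewrite /GRing.scale/=; field; rewrite gt_eqF.
apply: (integral_antiderivative_pos ba dF) => u u0.
have c := @continuous_ln_ratio a u u0.
  by apply: cvgM => //; apply: cvgM.
Qed.

Let mratio (a : R) : measurable_fun setT (fun u : R => ln (a / u)).
Proof.
apply: (measurableT_comp (@measurable_ln R)); apply: measurable_funM => //.
exact: measurable_inv_real.
Qed.

Let ge0_law (f : R * R -> R) (c : R) : measurable_fun setT f ->
  (forall v, 0 <= f v) -> (\int[P]_w (f (observation X Y w))%:E = c%:E)%E ->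
  Q.-integrable setT (EFin \o f) /\ (\int[Q]_v f v)%R = c.
Proof.
move=> mf f0 E.
have EQ : (\int[Q]_v (f v)%:E = c%:E)%E.
  rewrite (ge0_integral_distribution (observation X Y) (f := EFin \o f))//.
  exact/measurable_EFinP.
split; last by rewrite /Rintegral EQ.
apply/integrableP; split; first exact/measurable_EFinP.
under eq_integral => v _ do rewrite /= ger0_norm//.
by rewrite EQ ltry.
Qed.

Let mass_integral z :
  (\int[P]_w (\1_[set w | (z < Y w)%R] w * (s z - s (Y w)))%:E =
   (uncensored_mass z)%:E)%E.
Proof.
rewrite Rintegral_fine//.
have m : measurable_fun setT (fun w => s (Y w)).
  by apply: (measurableT_comp (measurable_survival _)).
apply: (@integrable_bounded _ _ _ P _ 1).
  by apply: measurable_funM; [exact: measurable_gt_indic|exact: measurable_funB].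
move=> w; rewrite indicE; case: (_ \in _); rewrite ?mul0r ?normr0 ?mul1r//.
have := s0 z; have := s0 (Y w).
have := survival_le1 Xcont z; have := survival_le1 Xcont (Y w).
by rewrite ler_norml => ? ? ? ?; apply/andP; split; lra.
Qed.

Lemma uncensored_mean (psi : R -> R) z : measurable_fun setT psi ->
  (forall u, 0 <= psi u) -> psi 1 = 1 -> psi 0 = 0 ->
  Q.-integrable setT (EFin \o (fun v => exceeds z v * psi v.2)) /\
  (\int[Q]_v (exceeds z v * psi v.2))%R = uncensored_mass z.
Proof.
move=> mpsi psi_ge0 psi1 psi0; apply: ge0_law => //.
- apply: measurable_funM; first exact: measurable_time_indic.
  exact: measurableT_comp.
- by move=> v; rewrite mulr_ge0.
rewrite -mass_integral.
apply: (integral_split (h := fun v => psi v.2) (q1 := fun=> 1) (q2 := fun=> 0) (r := fun b => s z - b)) => //.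
- exact: measurable_funB.
move=> b ba; rewrite mulr0 adde0.
rewrite (integral_antiderivative_pos (F := id) ba)// => u u0.
exact: cvg_cst.
Qed.

Let log_mean z :
  Q.-integrable setT
    (EFin \o (fun v => exceeds z v * `|ln (s z / s v.1)|)) /\
  (\int[Q]_v (exceeds z v * `|ln (s z / s v.1)|))%R =
    uncensored_mass z.
Proof.
have ms : measurable_fun setT s by exact: measurable_survival.
apply: ge0_law => //.
- apply: measurable_funM; first exact: measurable_time_indic.
  apply: measurableT_comp => //; apply: (measurableT_comp (mratio (s z))).
  exact: (measurableT_comp ms).
rewrite -mass_integral.
apply: (integral_split (h := fun v => `|ln (s z / s v.1)|)
  (q1 := fun u => `|ln (s z / u)|)
  (q2 := fun u => `|ln (s z / u)|) (r := fun b => s z - b)) => //.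
- exact: measurableT_comp.
- exact: measurableT_comp.
- exact: measurable_funB.
move=> b ba; rewrite integral_ln_ratio// -EFinD; congr EFin.
have /andP[b0 bs] := ba.
rewrite ger0_norm ln_div ?posrE ?subr_ge0 ?ler_ln ?posrE//.
by ring.
Qed.

(** With b = s Y and a = s z, integrating (ln (a / u) - 1)^2 over u in [b, a]
    and adding b (ln (a / b))^2 gives a - b: the predictable variation of the
    martingale is its compensator. *)
Lemma score_sqr_mean z :
  Q.-integrable setT (EFin \o (fun v => score z v ^+ 2)) /\
  (\int[Q]_v score z v ^+ 2)%R = uncensored_mass z.
Proof.
apply: ge0_law => //.
- by apply: measurable_funX; exact: measurable_score.
- by move=> v; exact: sqr_ge0.
rewrite -mass_integral.
have E v : score z v ^+ 2 =
    exceeds z v * (ln (s z / s v.1) - v.2) ^+ 2.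
  by rewrite /score indic_bool exprMn; case: (z < _); rewrite ?expr1n ?expr0n.
under eq_integral do rewrite E.
apply: (integral_split (h := fun v => (ln (s z / s v.1) - v.2) ^+ 2)
  (q1 := fun u => (ln (s z / u) - 1) ^+ 2)
  (q2 := fun u => ln (s z / u) ^+ 2) (r := fun b => s z - b)) => //.
- by apply: measurable_funX; exact: measurable_funB.
- exact: measurable_funX.
- exact: measurable_funB.
- by move=> u; exact: sqr_ge0.
- by move=> u; exact: sqr_ge0.
- by move=> x _ /=; rewrite subr0.
move=> b ba; rewrite integral_ln_ratio_sqr// -EFinD; congr EFin.
have /andP[b0 bs] := ba.
by rewrite ln_div ?posrE//; ring.
Qed.

(** The hazard accumulated and the uncensored deaths have the same mean. *)
Lemma score_mean z : (\int[Q]_v score z v)%R = 0.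
Proof.
have [i1 E1] := log_mean z.
have mn : measurable_fun setT (fun u : R => `|u|) by exact: measurableT_comp.
have [i2 E2] := uncensored_mean z mn (@normr_ge0 _ _) (normr1 R) (normr0 R).
have E : (\int[Q]_v (exceeds z v * `|ln (s z / s v.1)| -
    exceeds z v * `|v.2|))%R = 0.
  by rewrite (RintegralB measurableT i1 i2) E1 E2 subrr.
have i12 := integrableBr i1 i2.
have [i3 _] := score_sqr_mean z.
have i4 := integrable_sqr_integrable (measurable_score z) i3.
have law (j : nat) A : measurable A ->
    distribution P ((fun=> observation X Y : {RV P >-> (R * R)%type}) j) A = Q A by [].
have m12 : measurable_fun setT (fun v : R * R =>
    exceeds z v * `|ln (s z / s v.1)| -
    exceeds z v * `|v.2|).
  exact: integrable_measurable i12.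
rewrite -E -(iid_Rintegral law 0 (measurable_score z) i4) -(iid_Rintegral law 0 m12 i12).
congr fine; apply: eq_integral => w _; congr EFin.
rewrite /score -mulrBr !indic_bool; case: (ltP z _) => [zo|_]; last by rewrite !mul0r.
rewrite !mul1r (ger0_norm (_ : 0 <= (observation X Y w).2))//; congr (_ - _).
by rewrite ger0_norm// ln_ge0// ler_pdivlMr// mul1r survival_anti// ltW.
Qed.

Lemma survival_min z : survival (rcdf P (observed_time X Y)) z = s z * sY z.
Proof.
apply: EFin_inj; rewrite EFinM -!survivalE.
have -> : [set w | z < observed_time X Y w] =
    X @^-1` `]z, +oo[%classic `&` Y @^-1` `]z, +oo[%classic.
  apply/seteqP; split => w /=; rewrite /observed_time lt_min !in_itv/= !andbT.
    by move=> /andP[].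
  by move=> [-> ->].
rewrite XY//; congr (P _ * P _)%E; apply/seteqP; split => w /=;
  by rewrite in_itv/= andbT.
Qed.

Lemma observed_time_cont : continuous_RV P (observed_time X Y).
Proof.
rewrite /continuous_RV; have -> : rcdf P (observed_time X Y) = fun t => 1 - s t * sY t.
  by apply/funext => t; rewrite -survival_min /survival subKr.
have cs (K : R -> R) : continuous K -> continuous (survival K).
  by move=> cK t; apply: cvgB; [exact: cvg_cst|exact: cK].
move=> t; apply: cvgB; first exact: cvg_cst.
by apply: cvgM; apply: cs.
Qed.

Lemma observed_time_lt1 x : rcdf P (observed_time X Y) x < 1.
Proof.
rewrite -subr_gt0 -/(survival (rcdf P (observed_time X Y)) x) survival_min.
by rewrite mulr_gt0// survival_gt0.
Qed.

Lemma time_indic_mean z :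
  (\int[Q]_v exceeds z v)%R = s z * sY z.
Proof.
rewrite Rintegral_indic; last exact: measurable_ltset.
rewrite -survival_min; apply: EFin_inj; rewrite fineK ?fin_num_measure//; last exact: measurable_ltset.
rewrite -survivalE.
by rewrite /distribution /pushforward.
Qed.

Lemma score_cube_mean z :
  Q.-integrable setT (EFin \o (fun v => `|score z v| ^+ 3)) /\
  (\int[Q]_v `|score z v| ^+ 3)%R <= 7 * (s z * sY z).
Proof.
have ms : measurable_fun setT s by exact: measurable_survival.
have mL : measurable_fun setT (fun u : R => `|ln (s z / u)| ^+ 3).
  by apply: measurable_funX; exact: measurableT_comp.
pose c3 v := exceeds z v * `|ln (s z / s v.1)| ^+ 3.
have mc3 : measurable_fun setT c3.
  apply: measurable_funM; first exact: measurable_time_indic.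
  by apply: (measurableT_comp mL); exact: (measurableT_comp ms).
pose r b := 6 * s z -
  b * (3 * (ln (s z) - ln b) ^+ 2 + 6 * (ln (s z) - ln b) + 6).
have ml : measurable_fun setT (fun b : R => ln (s z) - ln b) by exact: measurable_funB.
have mr : measurable_fun setT r.
  apply: measurable_funB => //; apply: measurable_funM => //.
  apply: measurable_funD => //; apply: measurable_funD; last exact: measurable_funM.
  by apply: measurable_funM => //; exact: measurable_funX.
have E3 : (\int[P]_w (c3 (observation X Y w))%:E =
    \int[P]_w (\1_[set w | (z < Y w)%R] w * r (s (Y w)))%:E)%E.
  apply: (integral_split (h := fun v => `|ln (s z / s v.1)| ^+ 3) (r := r)
    (q1 := fun u => `|ln (s z / u)| ^+ 3)
    (q2 := fun u => `|ln (s z / u)| ^+ 3)) => // b ba.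
  rewrite integral_ln_ratio_cube// -EFinD; congr EFin.
  have /andP[b0 bs] := ba.
  rewrite ger0_norm ln_div ?posrE ?subr_ge0 ?ler_ln ?posrE//.
  by rewrite /r; ring.
have rle w : z < Y w -> 0 <= r (s (Y w)) <= 6 * s z.
  move=> zY; have b0 := s0 (Y w).
  have bs : s (Y w) <= s z by rewrite survival_anti// ltW.
  rewrite /r; set b := s (Y w) in b0 bs *; set l := ln (s z) - ln b.
  have l0 : 0 <= l by rewrite subr_ge0 ler_ln ?posrE.
  have := integral_ln_ratio_cube (_ : 0 < b <= s z).
  rewrite b0 bs => /(_ isT) E.
  have : (0 <= \int[mu]_(u in `[b, s z]) (`|ln (s z / u)| ^+ 3)%:E)%E.
    by apply: integral_ge0 => u _; rewrite lee_fin exprn_ge0.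
  rewrite E lee_fin -/l => pos; apply/andP; split.
    have : 0 <= b * l ^+ 3 by rewrite mulr_ge0 ?exprn_ge0// ltW.
    by move: pos; rewrite !mulrDr; lra.
  by rewrite gerBl mulr_ge0 ?(ltW b0)// !addr_ge0 ?mulr_ge0 ?exprn_ge0.
have iR : P.-integrable setT (EFin \o (fun w => \1_[set w | z < Y w] w * r (s (Y w)))).
  apply: (@integrable_bounded _ _ _ P _ (6 * s z)).
    apply: measurable_funM; first exact: measurable_gt_indic.
    by apply: (measurableT_comp mr); exact: (measurableT_comp ms).
  move=> w; rewrite indic_bool; case: ltP => [zY|_].
    by have /andP[h1 h2] := rle w zY; rewrite mul1r ger0_norm.
  by rewrite mul0r normr0 mulr_ge0 ?(ltW (s0 _)).
have [i3 e3] : Q.-integrable setT (EFin \o c3) /\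
    (\int[Q]_v c3 v)%R = (\int[P]_w (\1_[set w | (z < Y w)%R] w * r (s (Y w))))%R.
  apply: ge0_law => //; first by move=> v; rewrite mulr_ge0 ?exprn_ge0.
  by rewrite E3 Rintegral_fine.
have le3 : (\int[Q]_v c3 v)%R <= 6 * (s z * sY z).
  rewrite e3 mulrA -(Rintegral_gt Y z).
  have ii : P.-integrable setT (EFin \o (\1_[set w | z < Y w] : T -> R)).
    apply: (@integrable_bounded _ _ _ P _ 1); first exact: measurable_gt_indic.
    by move=> w; rewrite indic_bool; case: (z < _); rewrite ?normr0 ?normr1.
  rewrite -(RintegralZl _ measurableT ii).
  apply: (le_Rintegral measurableT iR (integrableZr _ ii)) => w _.
  rewrite !indic_bool; case: ltP => [zY|_]; last by rewrite mul0r mulr0.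
  by rewrite mul1r mulr1; have /andP[] := rle w zY.
have ij : Q.-integrable setT (EFin \o (exceeds z : R * R -> R)).
  apply: (@integrable_bounded _ _ _ Q _ 1); first exact: measurable_time_indic.
  by move=> v; rewrite indic_bool; case: (z < _); rewrite ?normr0 ?normr1.
have i13 := integrableDr ij i3.
have law (j : nat) A : measurable A ->
    distribution P ((fun=> observation X Y : {RV P >-> (R * R)%type}) j) A = Q A by [].
have msc3 : measurable_fun setT (fun v => `|score z v| ^+ 3).
  by apply: measurable_funX; apply: measurableT_comp => //; exact: measurable_score.
have ptw w : `|score z (observation X Y w)| ^+ 3 <=
    exceeds z (observation X Y w) + c3 (observation X Y w).
  rewrite /score /c3 !indic_bool; case: (ltP z _) => [zo|_]; last first.
    by rewrite !mul0r normr0 expr0n addr0.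
  rewrite !mul1r; set l := ln _.
  have l0 : 0 <= l by rewrite /l ln_ge0// ler_pdivlMr// mul1r survival_anti// ltW.
  have l3 := exprn_ge0 3 l0.
  rewrite (ger0_norm l0) /observation /censoring_indicator/= indic_bool.
  case: (X w <= Y w) => /=; last by rewrite subr0 (ger0_norm l0) lerDr.
  have [l1|l1] := leP 1 l.
    rewrite ger0_norm ?subr_ge0// (@le_trans _ _ (l ^+ 3))//; last by rewrite lerDr.
    by rewrite lerXn2r ?nnegrE ?subr_ge0// gerBl.
  rewrite ler0_norm; last by rewrite subr_le0 ltW.
  rewrite opprB (@le_trans _ _ 1)//; last by rewrite lerDl.
  by rewrite exprn_ile1// ?subr_ge0 ?(ltW l1)// gerBl.
have iP := iid_integrable law 0 (integrable_measurable i13) i13.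
have isP : P.-integrable setT (EFin \o (fun w => `|score z (observation X Y w)| ^+ 3)).
  apply: (integrable_dominated _ _ iP).
    exact: (measurableT_comp msc3).
  by move=> w; rewrite ger0_norm ?exprn_ge0//; exact: ptw.
have [isQ eQ] : Q.-integrable setT (EFin \o (fun v => `|score z v| ^+ 3)) /\
    (\int[Q]_v `|score z v| ^+ 3)%R =
    (\int[P]_w `|score z (observation X Y w)| ^+ 3)%R.
  apply: ge0_law => //.
  by rewrite Rintegral_fine.
split => //; rewrite eQ (@le_trans _ _
  (\int[P]_w (exceeds z (observation X Y w) +
     c3 (observation X Y w)))%R)//.
  exact: (le_Rintegral measurableT isP iP).
rewrite (iid_Rintegral law 0 (integrable_measurable i13) i13).
rewrite (RintegralD measurableT ij i3) time_indic_mean.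
by move: le3; lra.
Qed.

(** The mass is E [(s z - s Y) ; Y > z]; on Y > z the ratio s Y / s z behaves
    like the power gamma2 / gamma1 of a uniform variable. *)
Lemma uncensored_mass_ratio (gamma1 gamma2 : R) : 0 < gamma1 -> 0 < gamma2 ->
  regularly_varying s (- gamma1^-1) -> regularly_varying sY (- gamma2^-1) ->
  uncensored_mass z / (s z * sY z) @[z --> +oo] --> gamma2 / (gamma1 + gamma2).
Proof.
move=> g10 g20 rs rsY.
pose th := gamma1^-1 / gamma2^-1.
have th0 : 0 < th by rewrite divr_gt0 ?invr_gt0.
have g1i : 0 < gamma1^-1 by rewrite invr_gt0.
have g2i : 0 < gamma2^-1 by rewrite invr_gt0.
have H := tail_ratio_mean Ycont Ylt1 th0 (survival_anti Xcont) s0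
  (rv_ratio g1i g2i (survival_anti Xcont) s0 (survival_anti Ycont)
    (survival_gt0 Ylt1) rs rsY).
have H1 : 1 - (\int[P]_w (\1_[set w | (z < Y w)%R] w * (s (Y w) / s z)))%R / sY z
   @[z --> +oo] --> 1 - (1 + th)^-1.
  by apply: cvgB; first exact: cvg_cst.
apply: (cvg_near_eq H1).
  by rewrite /th; field; rewrite !gt_eqF ?addr_gt0.
near=> z.
have ii : P.-integrable setT (EFin \o (\1_[set w | z < Y w] : T -> R)).
  apply: (@integrable_bounded _ _ _ P _ 1); first exact: measurable_gt_indic.
  by move=> w; rewrite indic_bool; case: (z < _); rewrite ?normr0 ?normr1.
have ms : measurable_fun setT (fun w => s (Y w)).
  by apply: (measurableT_comp (measurable_survival _)).
have i2 : P.-integrable setT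
    (EFin \o (fun w => \1_[set w | z < Y w] w * (s (Y w) / s z))).
  apply: (@integrable_bounded _ _ _ P _ 1).
    by apply: measurable_funM; [exact: measurable_gt_indic|exact: measurable_funM].
  move=> w; rewrite indic_bool; case: ltP => [zY|_]; last by rewrite mul0r normr0.
  rewrite mul1r ger0_norm ?divr_ge0 ?(ltW (s0 _))// ler_pdivrMr// mul1r.
  by rewrite survival_anti// ltW.
have -> : uncensored_mass z = s z * (sY z -
    (\int[P]_w (\1_[set w | (z < Y w)%R] w * (s (Y w) / s z)))%R).
  rewrite -(Rintegral_gt Y z) -(RintegralB measurableT ii i2).
  rewrite -(RintegralZl _ measurableT (integrableBr ii i2)).
  rewrite /uncensored_mass; congr fine; apply: eq_integral => w _; congr EFin.
  by field; rewrite gt_eqF.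
by field; rewrite !gt_eqF ?survival_gt0.
Unshelve. all: by end_near. Qed.

End score_moments.

(** * Convergence in probability *)

Section probability_filter.
Context {d : measure_display} {Omega : measurableType d} {R : realType}.
Variable P : probability Omega R.

(** Convergence in probability as convergence along a filter on nat * Omega: a
    set belongs to the filter when, for n large, its section at n contains all
    of Omega up to an event of arbitrarily small probability. The calculus
    of limits along filters then applies to random quantities. *)
Definition pfilter : set_system (nat * Omega) := fun S =>
  forall e : R, 0 < e -> \forall n \near \oo,
    exists2 B : set Omega, measurable B /\ (P B <= e%:E)%E &
      forall w, ~ B w -> S (n, w).

#[global] Instance pfilter_filter : Filter pfilter.
Proof.
split.
- by move=> e e0; near=> n; exists set0 => //; rewrite measure0 lee_fin ltW.
- move=> S1 S2 H1 H2 e e0; have e20 : 0 < e / 2 by rewrite divr_gt0.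
  apply: filterS2 (H1 _ e20) (H2 _ e20) => n [B1 [m1 p1] h1] [B2 [m2 p2] h2].
  exists (B1 `|` B2); last by move=> w /not_orP[? ?]; split; [exact: h1|exact: h2].
  split; first exact: measurableU.
  rewrite (le_trans (measureU2 _ _ _))// [X in (_ <= X%:E)%E]splitr EFinD.
  exact: leeD.
- move=> S1 S2 S12 H1 e e0; apply: filterS (H1 _ e0) => n [B mB h].
  by exists B => // w /h /S12.
Unshelve. all: by end_near. Qed.

Lemma pfilter_fst (S : set nat) : (\forall n \near \oo, S n) ->
  \forall x \near pfilter, S x.1.
Proof.
move=> HS e e0; apply: filterS HS => n Sn.
by exists set0 => //; rewrite measure0 lee_fin ltW.
Qed.

Lemma cvg_pfilter_fst : x.1 @[x --> pfilter] --> \oo.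
Proof. by move=> S HS; exact: pfilter_fst. Qed.

Lemma cvg_pfilter_seq (u : nat -> R) (l : R) : u n @[n --> \oo] --> l ->
  u x.1 @[x --> pfilter] --> l.
Proof. by move=> ul; exact: (cvg_comp _ _ cvg_pfilter_fst ul). Qed.

Lemma pfilter_negligible (N : nat -> set Omega) : (forall n, P.-negligible (N n)) ->
  \forall x \near pfilter, ~ N x.1 x.2.
Proof.
move=> N0 e e0; near=> n; have [B [mB PB NB]] := N0 n.
by exists B => [|w nB /NB//]; split => //; rewrite PB lee_fin ltW.
Unshelve. all: by end_near. Qed.

(** Slutsky's theorem for events: outside a set of small probability E n lies
    between the events that S is below y - eta and below y + eta, where
    y = - c / g. *)
Lemma slutsky_event (S : nat -> Omega -> R) (G : R -> R) (g c : R)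
    (E : nat -> set Omega) (r : nat -> Omega -> R) : 0 < g ->
  (forall n, measurable_fun setT (S n)) ->
  (forall n, measurable (E n)) ->
  (forall y, fine (P [set w | S n w <= y]) @[n --> \oo] --> G y) ->
  continuous G ->
  r x.1 x.2 @[x --> pfilter] --> c ->
  (\forall x \near pfilter, E x.1 x.2 <-> g * S x.1 x.2 + r x.1 x.2 <= 0) ->
  fine (P (E n)) @[n --> \oo] --> G (- c / g).
Proof.
move=> g0 mS mE Sy cG rc Er; apply/cvgrPdist_le => e e0.
have e30 : 0 < e / 3 by rewrite divr_gt0.
set y := - c / g.
have [eta eta0 Geta] : exists2 eta : R, 0 < eta & forall u, `|y - u| <= eta ->
    `|G y - G u| <= e / 3.
  have /cvgrPdist_le /(_ _ e30) /nbhs_ballP[a /= a0 Ha] := cG y.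
  exists (a / 2) => [|u yu]; first by rewrite divr_gt0.
  apply: Ha; rewrite /ball/=; apply: (le_lt_trans yu).
  by rewrite ltr_pdivrMr// ltr_pMr// ltr1n.
have ge0 : 0 < g * eta by rewrite mulr_gt0.
have near_r : \forall x \near pfilter, `|c - r x.1 x.2| <= g * eta.
  by move/cvgrPdist_le : rc; apply.
have both : \forall x \near pfilter,
    (E x.1 x.2 -> S x.1 x.2 <= y + eta) /\ (S x.1 x.2 <= y - eta -> E x.1 x.2).
  apply: filterS2 Er near_r => x [E1 E2]; rewrite ler_norml => /andP[r1 r2].
  have gy : g * y = - c by rewrite /y mulrC divfK// gt_eqF.
  split => [/E1 H|H].
    rewrite -(ler_pM2l g0) mulrDr gy; lra.
  apply: E2; rewrite -(ler_pM2l g0) mulrBr gy in H; lra.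
have H1 := both _ e30.
have K1 : \forall n \near \oo, `|G (y + eta) - fine (P [set w | S n w <= y + eta])| <= e / 3.
  by move/cvgrPdist_le : (Sy (y + eta)); apply.
have K2 : \forall n \near \oo, `|G (y - eta) - fine (P [set w | S n w <= y - eta])| <= e / 3.
  by move/cvgrPdist_le : (Sy (y - eta)); apply.
apply: filterS3 H1 K1 K2 => n [B [mB PB] HB] k1 k2.
have mle u : measurable [set w | S n w <= u] by exact: measurable_leset.
have PB' : fine (P B) <= e / 3 by rewrite -lee_fin fineK ?fin_num_measure.
have up : fine (P (E n)) <= fine (P [set w | S n w <= y + eta]) + fine (P B).
  rewrite -lee_fin EFinD !fineK ?fin_num_measure//.
  apply: (le_trans _ (measureU2 _ _ _)) => //.
  apply: le_measure; rewrite ?inE//; first exact: measurableU.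
  move=> w Ew; have [Bw|nBw] := pselect (B w); [by right|left].
  by have [h _] := HB w nBw; exact: h.
have dn : fine (P [set w | S n w <= y - eta]) <= fine (P (E n)) + fine (P B).
  rewrite -lee_fin EFinD !fineK ?fin_num_measure//.
  apply: (le_trans _ (measureU2 _ _ _)) => //.
  apply: le_measure; rewrite ?inE//; first exact: measurableU.
  move=> w Sw; have [Bw|nBw] := pselect (B w); [by right|left].
  by have [_ h] := HB w nBw; exact: h.
have g1 : `|G y - G (y + eta)| <= e / 3.
  by apply: Geta; rewrite opprD addNKr normrN gtr0_norm.
have g2 : `|G y - G (y - eta)| <= e / 3.
  by apply: Geta; rewrite opprB addrCA subrr addr0 gtr0_norm.
move: g1 g2 k1 k2; rewrite !ler_norml.
move: up dn PB'; clear; move=> up dn PB' /andP[? ?] /andP[? ?] /andP[? ?] /andP[? ?].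
by apply/andP; split; lra.
Qed.

End probability_filter.

Section law_of_large_numbers.
Context {d d' : measure_display} {Omega : measurableType d}
  {T1 : measurableType d'} {R : realType}.
Variables (P : probability Omega R) (W : nat -> {RV P >-> T1}).
Variable Q : probability T1 R.
Hypothesis Windep : mutually_independent P W.
Hypothesis Wlaw : forall j A, measurable A -> distribution P (W j) A = Q A.

(** Chebyshev's inequality, read along the filter of convergence in
    probability. *)
Lemma triangular_lln (f : nat -> T1 -> R) (l : R) :
  (forall n, measurable_fun setT (f n)) ->
  (\forall n \near \oo, Q.-integrable setT (EFin \o (fun v => f n v ^+ 2))) ->
  n%:R * (\int[Q]_v f n v ^+ 2)%R @[n --> \oo] --> (0 : R) ->
  n%:R * (\int[Q]_v f n v)%R @[n --> \oo] --> l ->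
  \sum_(j < x.1) f x.1 (W j x.2) @[x --> pfilter P] --> l.
Proof.
move=> mf if2 var mean.
have dev : \sum_(j < x.1) f x.1 (W j x.2) - x.1%:R * (\int[Q]_v f x.1 v)%R
    @[x --> pfilter P] --> (0 : R).
  apply/cvgrPdist_le => eta eta0 e e0.
  have b0 : 0 < e * eta ^+ 2 by rewrite mulr_gt0 ?exprn_gt0.
  have small : \forall n \near \oo, n%:R * (\int[Q]_v f n v ^+ 2)%R < e * eta ^+ 2.
    exact: (cvgr_lt _ var).
  apply: filterS2 if2 small => n fi sm.
  exists [set w | (eta <= `|\sum_(j < n) f n (W j w) - n%:R * \int[Q]_x f n x|)%R].
    split.
      apply: measurable_leset => //; apply: measurableT_comp => //.
      by apply: measurable_funB => //; exact: (measurable_iid_sum W n (mf n)).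
    rewrite (le_trans (iid_sum_deviation Windep Wlaw n eta0 (mf n) fi))// lee_fin.
    by rewrite ler_pdivrMr ?exprn_gt0// ltW.
  by move=> w /= /negP; rewrite -ltNge sub0r normrN => /ltW.
apply: (cvg_near_eq (cvgD dev (cvg_pfilter_seq P mean))); first by rewrite add0r.
by near=> x; rewrite /= subrK.
Unshelve. all: by end_near. Qed.

End law_of_large_numbers.

(** * Order statistics and measurability of the estimator *)

Section top_order_statistics.
Context {R : realType}.
Implicit Types (z delta : nat -> R) (n k : nat).

(** With distinct values, the last k entries of the sorted sample are exactly
    those exceeding the entry before them. *)
Lemma sum_top_order_stat z n k (F : R -> R) : (k < n)%N ->
  {in gtn n &, injective z} ->
  \sum_(1 <= i < k.+1) F (order_stat z n (n - i + 1)%N) =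
  \sum_(j < n | order_stat z n (n - k)%N < z j) F (z j).
Proof.
move=> kn inj; rewrite /order_stat.
set s := sort _ _.
have ss : size s = n by rewrite size_sort size_mkseq.
have us : uniq (mkseq z n).
  rewrite map_inj_in_uniq ?iota_uniq// => i j; rewrite !mem_iota !add0n => /andP[_ ?] /andP[_ ?].
  by apply: inj; rewrite inE.
have lts : sorted <%O s by rewrite sort_lt_sorted.
set T := nth 0 s _.
have nk : ((n - k).-1 < size s)%N by rewrite ss; lia.
have -> : \sum_(j < n | T < z j) F (z j) = \sum_(x <- s | T < x) F x.
  rewrite (perm_big (mkseq z n))/=; last by rewrite perm_sort.
  by rewrite /mkseq big_map -[in iota _ _](subn0 n) -/(index_iota 0 n) big_mkord.
have -> : \sum_(x <- s | T < x) F x = \sum_(x <- drop (n - k) s) F x.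
  have e := filter_le_nth 0 lts nk.
  have /permPl := perm_filterC (fun x => x <= T) s.
  rewrite e prednK ?subn_gt0// -[X in perm_eq _ X](cat_take_drop (n - k)) perm_cat2l => p.
  rewrite -(perm_big _ p)/= big_filter; apply: eq_bigl => x /=.
  by rewrite ltNge.
rewrite [in RHS](big_nth 0) size_drop ss subKn 1?ltnW// big_add1/= big_nat_rev/=.
apply: eq_big_nat => i /andP[_ ik]; rewrite nth_drop addn1/=; congr (F (nth _ _ _)).
by lia.
Qed.

(** With distinct values the indicator of an order statistic is a function of
    its value, so that the previous lemma applies to it. *)
Lemma sum_top_concomitant z delta n k : (k < n)%N ->
  {in gtn n &, injective z} ->
  \sum_(1 <= i < k.+1) concomitant z delta n (n - i + 1)%N =
  \sum_(j < n | order_stat z n (n - k)%N < z j) delta j.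
Proof.
move=> kn inj.
pose F x := if [pick j : 'I_n | x == z j] is Some j then delta j else 0.
rewrite (sum_top_order_stat F kn inj); apply: eq_bigr => j _.
rewrite /F; case: pickP => [i /eqP Ei|/(_ j)]; last by rewrite eqxx.
by congr delta; apply: inj; rewrite ?inE.
Qed.

Lemma count_top_order_stat z n k : (k < n)%N ->
  {in gtn n &, injective z} ->
  \sum_(j < n | order_stat z n (n - k)%N < z j) 1 = k%:R :> R.
Proof.
move=> kn inj; rewrite -(sum_top_order_stat (fun=> 1) kn inj).
by rewrite sumr_const_nat subn1.
Qed.

End top_order_statistics.

Section estimator_measurability.
Context {d : measure_display} {T : measurableType d} {R : realType}.
Implicit Types (z delta : nat -> T -> R) (n k m : nat).

(** Order statistics are measurable because counts are. *)
Lemma order_stat_lt (u : nat -> R) n m x : (m.-1 < n)%N ->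
  (order_stat u n m < x) = (m.-1%:R + 1 <= \sum_(j < n) (u j < x)%R%:R :> R).
Proof.
move=> mn; rewrite /order_stat; set s := sort _ _.
have ss : size s = n by rewrite size_sort size_mkseq.
have les : sorted <=%O s by exact: sort_le_sorted.
have <- : (count (< x) s)%:R = \sum_(j < n) (u j < x)%R%:R :> R.
  have /permP -> : perm_eq s (mkseq u n) by rewrite perm_sort.
  rewrite -sum1_count /mkseq big_map -[in iota _ _](subn0 n) -/(index_iota 0 n) big_mkord.
  rewrite natr_sum big_mkcond; apply: eq_bigr => j _ /=.
  by case: (u j < x).
rewrite natr1 ler_nat; apply/idP/idP => [|/(nth_count_lt 0 les)//].
by apply: contraTT; rewrite -leqNgt -leNgt => cm; apply: nth_count_ge; rewrite ?ss ?cm.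
Qed.

Lemma measurable_order_stat z n m : (forall j, measurable_fun setT (z j)) ->
  measurable_fun setT (fun w => order_stat (z^~ w) n m).
Proof.
move=> mz; have [mn|nm] := ltnP m.-1 n; last first.
  apply: (eq_measurable_fun (fun=> 0 : R)) => // w _.
  by rewrite /order_stat nth_default// size_sort size_mkseq.
apply: (measurability _ (RGenInftyO.measurableE R)).
move=> _ [_ [x ->] <-]; rewrite setTI.
rewrite (_ : _ @^-1` _ = [set w | m.-1%:R + 1 <= \sum_(j < n) (z j w < x)%R%:R :> R]).
  apply: measurable_leset => //; apply: measurable_sum => j.
  apply: (eq_measurable_fun (\1_[set w | z j w < x] : T -> R)) => [w _|].
    by rewrite indic_bool.
  by apply: measurable_indic; exact: measurable_ltset.
by apply/seteqP; split => w /=; rewrite in_itv/= order_stat_lt.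
Qed.

Lemma measurable_concomitant z delta n m :
  (forall j, measurable_fun setT (z j)) ->
  (forall j, measurable_fun setT (delta j)) ->
  measurable_fun setT (fun w => concomitant (z^~ w) (delta^~ w) n m).
Proof.
move=> mz md; rewrite /concomitant /pick /enum_mem.
elim: (Finite.enum _) => [|a r IH] /=; first exact: measurable_cst.
apply: (eq_measurable_fun (fun w => if order_stat (z^~ w) n m == z a w
  then delta a w else
  if ohead [seq x <- r | mem (fun j : 'I_n => order_stat (z^~ w) n m == z j w) x] is Some j
  then delta j w else 0)) => [w _|].
  by rewrite /in_mem/=; case: ifP.
apply: measurable_fun_ifT => //; apply: measurable_fun_eqr => //.
exact: measurable_order_stat.
Qed.

Lemma measurable_adapted_hill z delta n k :
  (forall j, measurable_fun setT (z j)) ->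
  (forall j, measurable_fun setT (delta j)) ->
  measurable_fun setT (fun w => adapted_hill (z^~ w) (delta^~ w) n k).
Proof.
move=> mz md.
have ml m : measurable_fun setT (fun w => ln (order_stat (z^~ w) n m)).
  by apply: (measurableT_comp (@measurable_ln R)); exact: measurable_order_stat.
apply: measurable_funM.
  apply: measurable_funB; last exact: ml.
  by apply: measurable_funM => //; apply: measurable_sum => i.
apply: (measurableT_comp measurable_inv_real); apply: measurable_funM => //.
by apply: measurable_sum => i; exact: measurable_concomitant.
Qed.

End estimator_measurability.

(** * Null events of a sample *)

Section sample_null_events.
Context {d d' : measure_display} {Omega : measurableType d}
  {T1 : measurableType d'} {R : realType}.
Variables (P : probability Omega R) (W : nat -> {RV P >-> T1}).
Variable Q : probability T1 R.
Hypothesis Windep : mutually_independent P W.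
Hypothesis Wlaw : forall j A, measurable A -> distribution P (W j) A = Q A.

Lemma pfilter_forall_negligible (N : nat -> set Omega) :
  (forall j, P.-negligible (N j)) ->
  \forall x \near pfilter P, forall j, ~ N j x.2.
Proof.
move=> N0.
have H0 := negligible_bigcup N0.
have H := @pfilter_negligible _ _ _ P (fun=> \bigcup_k N k) (fun=> H0).
by apply: (filterS _ H) => x nN j Nj; apply: nN; exists j.
Qed.

Lemma sample_avoids (B : set T1) : measurable B -> Q B = 0%E ->
  \forall x \near pfilter P, forall j, ~ B (W j x.2).
Proof.
move=> mB QB; apply: (@pfilter_forall_negligible (fun j => W j @^-1` B)) => j.
exists (W j @^-1` B); split => //; last by rewrite -QB -(Wlaw j mB).
by rewrite -[X in measurable X]setTI; exact: measurable_funP.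
Qed.

(** Conditionally on one observation, the other one meets its value with
    probability zero. *)
Lemma tie_negligible (g : T1 -> R) i j : measurable_fun setT g ->
  (forall c, Q [set v | g v = c] = 0%E) -> i != j ->
  P.-negligible [set w | g (W i w) = g (W j w)].
Proof.
move=> mg g0 ij.
have mtie : measurable [set z : T1 * T1 | g z.1 = g z.2].
  have m1 : measurable_fun setT (fun z : T1 * T1 => g z.1 - g z.2).
    by apply: measurable_funB; exact: measurableT_comp.
  have := m1 measurableT _ (measurable_set1 0); rewrite setTI.
  rewrite (_ : _ @^-1` _ = [set z : T1 * T1 | g z.1 = g z.2])//.
  by apply/seteqP; split => z /=; [move/eqP; rewrite subr_eq0 => /eqP|move=> ->; rewrite subrr].
have WW : independent_RV P (W i) (W j).
  move=> A B mA mB.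
  have u2 : uniq [:: i; j] by rewrite /= inE ij.
  have := Windep u2 (A := fun l => if l == i then A else B).
  rewrite !big_cons big_nil mule1 eqxx eq_sym (negPf ij) => <-; last first.
    by move=> l; case: ifP.
  congr (P _); apply/seteqP; split => w /=.
    move=> [Aw Bw] l /=; rewrite !inE => /orP[]/eqP ->; first by rewrite eqxx.
    by rewrite eq_sym (negPf ij).
  move=> H; split; first by have := H i; rewrite /= eqxx !inE eqxx; exact.
  by have := H j; rewrite /= eq_sym (negPf ij) !inE eqxx orbT; exact.
have mW : measurable [set w | g (W i w) = g (W j w)].
  have := measurable_pairing (W i) (W j) measurableT mtie.
  by rewrite setTI.
exists [set w | g (W i w) = g (W j w)]; split => //.
rewrite -[X in P X]setIT -integral_indic//.
transitivity (\int[P]_w (\1_[set z : T1 * T1 | g z.1 = g z.2] (W i w, W j w) : R)%:E)%E.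
  by apply: eq_integral => w _; rewrite !indicE; congr (_%:R%:E); apply/idP/idP; rewrite !inE.
rewrite (independent_ge0_integral WW (f := fun z => (\1_[set z : T1 * T1 | g z.1 = g z.2] z : R)%:E)).
- rewrite integral0_eq// => x _.
  rewrite (eq_measure_integral Q) => [|A mA _]; last exact: Wlaw.
  rewrite -[RHS](g0 (g x)) -[X in Q X]setIT -integral_indic//; last first.
    by have := mg measurableT _ (measurable_set1 (g x)); rewrite setTI.
  apply: eq_integral => y _; rewrite !indicE; congr ((nat_of_bool _)%:R%:E).
  by apply/idP/idP; rewrite !inE/= => ->.
- exact/measurable_EFinP/measurable_indic.
- by move=> z; rewrite lee_fin.
Qed.

Lemma sample_injective (g : T1 -> R) : measurable_fun setT g ->
  (forall c, Q [set v | g v = c] = 0%E) ->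
  \forall x \near pfilter P, injective (fun j => g (W j x.2)).
Proof.
move=> mg g0.
pose N i := \bigcup_j [set w | i != j /\ g (W i w) = g (W j w)].
have N0 i : P.-negligible (N i).
  apply: negligible_bigcup => j; have [->|ij] := eqVneq i j.
    by apply: (negligibleS _ (negligible_set0 P)) => w [].
  by apply: (negligibleS _ (tie_negligible mg g0 ij)) => w [].
apply: (filterS _ (pfilter_forall_negligible N0)) => x H i j /= E.
by apply/eqP; apply/negPn/negP => ij; apply: (H i); exists j.
Qed.

End sample_null_events.

(** * Intermediate levels and the limit law *)

Section intermediate_levels.
Context {d : measure_display} {T : measurableType d} {R : realType}.
Variables (P : probability T R) (X Y : {RV P >-> R}).
Hypothesis Xcont : continuous_RV P X.
Hypothesis Xlt1 : forall x, rcdf P X x < 1.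
Hypothesis Ycont : continuous_RV P Y.
Hypothesis Ylt1 : forall x, rcdf P Y x < 1.
Hypothesis XY : independent_RV P X Y.
Variable W : nat -> {RV P >-> (R * R)%type}.
Local Notation s := (survival (rcdf P X)).
Local Notation sY := (survival (rcdf P Y)).
Local Notation sH := (survival (rcdf P (observed_time X Y))).
Local Notation Q := (distribution P (observation X Y)).
Hypothesis Windep : mutually_independent P W.
Hypothesis Wlaw : forall j A, measurable A -> distribution P (W j) A = Q A.
Variables (gamma1 gamma2 : R).
Hypothesis gamma1_gt0 : 0 < gamma1.
Hypothesis gamma2_gt0 : 0 < gamma2.
Hypothesis rvX : regularly_varying s (- gamma1^-1).
Hypothesis rvY : regularly_varying sY (- gamma2^-1).
Variable k : nat -> nat.
Hypothesis k_range : \forall n \near \oo, (0 < k n < n)%N.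
Hypothesis k_infty : k n @[n --> \oo] --> \oo.
Hypothesis k_small : (k n)%:R / n%:R @[n --> \oo] --> (0 : R).
Local Notation score := (score X).
Local Notation exceeds z := (\1_[set v : R * R | (z < v.1)%R]).
Local Notation mass := (uncensored_mass X Y).
Local Notation p := (gamma2 / (gamma1 + gamma2)).

Let s0 x : 0 < s x. Proof. exact: survival_gt0. Qed.
Let sY0 x : 0 < sY x. Proof. exact: survival_gt0. Qed.
Let Zcont := observed_time_cont Xcont Ycont XY.
Let Zlt1 := observed_time_lt1 Xlt1 Ylt1 XY.
Let sH0 x : 0 < sH x. Proof. exact: survival_gt0. Qed.
Let sHE x : sH x = s x * sY x. Proof. exact: survival_min. Qed.

Lemma cvg_inv_k : (k n)%:R^-1 @[n --> \oo] --> (0 : R).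
Proof.
have kR : (k n)%:R @[n --> \oo] --> (+oo : set_system R) by exact: cvg_comp k_infty (@cvgr_idn R).
have k0 : \forall n \near \oo, 0 < (k n)%:R :> R.
  by apply: filterS k_range => n /andP[]; rewrite ltr0n.
by apply/(gtr0_cvgV0 k0).
Qed.

Lemma cvg_inv_sqrt_k : (Num.sqrt (k n)%:R)^-1 @[n --> \oo] --> (0 : R).
Proof.
have H : Num.sqrt (k n)%:R^-1 @[n --> \oo] --> Num.sqrt (0 : R).
  by apply: continuous_cvg; [exact: sqrt_continuous|exact: cvg_inv_k].
by apply: (cvg_near_eq H); [exact: sqrtr0|near=> n; rewrite sqrtrV].
Unshelve. all: by end_near. Qed.

(** Such a level is exceeded by about k of the n observations. *)
Definition intermediate_level (z : nat -> R) :=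
  n%:R / (k n)%:R * sH (z n) @[n --> \oo] --> (1 : R).

Lemma intermediate_level_pinfty z : intermediate_level z -> z n @[n --> \oo] --> +oo.
Proof.
move=> zi; apply/cvgryPgt => A.
have H : (k n)%:R / n%:R * (n%:R / (k n)%:R * sH (z n)) @[n --> \oo] --> (0 : R).
  by rewrite -(mul0r 1); apply: cvgM.
have H1 : \forall n \near \oo, (k n)%:R / n%:R * (n%:R / (k n)%:R * sH (z n)) < sH A.
  exact: (cvgr_lt _ H).
apply: filterS2 H1 k_range => n h /andP[k0 kn].
rewrite ltNge; apply/negP => zA.
have : sH A <= sH (z n) by apply: (survival_anti Zcont).
have n0 : (0 < n)%N by apply: ltn_trans kn.
rewrite leNgt => /negP; apply; apply: le_lt_trans h.
rewrite -[(k n)%:R / n%:R]invf_div mulKf//.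
by rewrite mulf_neq0 ?invr_eq0 ?pnatr_eq0 -?lt0n.
Qed.

Lemma mass_intermediate z : intermediate_level z ->
  n%:R / (k n)%:R * mass (z n) @[n --> \oo] --> p.
Proof.
move=> zi.
have H := uncensored_mass_ratio Xcont Xlt1 Ycont Ylt1 gamma1_gt0 gamma2_gt0 rvX rvY.
have H1 : mass (z n) / (s (z n) * sY (z n)) @[n --> \oo] --> p.
  exact: (cvg_comp _ _ (intermediate_level_pinfty zi) H).
have H2 : mass (z n) / (s (z n) * sY (z n)) * (n%:R / (k n)%:R * sH (z n)) @[n --> \oo] --> p * 1.
  exact: cvgM.
apply: (cvg_near_eq H2); first by rewrite mulr1.
near=> n; rewrite sHE mulrCA; congr (_ * _); rewrite mulfVK//.
by rewrite mulf_neq0 ?gt_eqF.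
Unshelve. all: by end_near. Qed.

Definition tail_sum (f : R * R -> R) (z : R) (n : nat) (w : T) : R :=
  \sum_(j < n | z < (W j w).1) f (W j w).

Lemma tail_sumE f z n w : tail_sum f z n w =
  \sum_(j < n) exceeds z (W j w) * f (W j w).
Proof.
rewrite /tail_sum big_mkcond; apply: eq_bigr => j _.
by rewrite indic_bool; case: (z < _); rewrite ?mul1r ?mul0r.
Qed.

(** The variance is of order 1/k because the summands are bounded by 1/k and
    only about k of them do not vanish. *)
Lemma tail_sum_lln (f : nat -> R * R -> R) (z : nat -> R) (l : R) : intermediate_level z ->
  (forall n, measurable_fun setT (f n)) ->
  (forall n v, z n < v.1 -> 0 <= f n v <= 1) ->
  n%:R / (k n)%:R * (\int[Q]_v (exceeds (z n) v * f n v))%R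
    @[n --> \oo] --> l ->
  tail_sum (f x.1) (z x.1) x.1 x.2 / (k x.1)%:R @[x --> pfilter P] --> l.
Proof.
move=> zi mf f01 mean.
pose g n v := (k n)%:R^-1 * (exceeds (z n) v * f n v).
have mh n : measurable_fun setT (fun v => exceeds (z n) v * f n v).
  by apply: measurable_funM => //; exact: measurable_time_indic.
have mg n : measurable_fun setT (g n) by exact: measurable_funM.
have h01 n v : 0 <= exceeds (z n) v * f n v <=
    exceeds (z n) v.
  rewrite indic_bool; case: ltP => [/f01 fv|_]; first by rewrite !mul1r.
  by rewrite !mul0r lexx.
have ind1 n (v : R * R) : exceeds (z n) v <= 1 :> R.
  by rewrite indic_bool; case: (_ < _).
have g2 n v : g n v ^+ 2 <= (k n)%:R^-1 ^+ 2 * exceeds (z n) v.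
  rewrite /g exprMn ler_wpM2l ?sqr_ge0//.
  have /andP[a0 a1] := h01 n v.
  rewrite (le_trans _ a1)// expr2 ler_piMl//.
  exact: le_trans a1 (ind1 _ _).
have i1 n : Q.-integrable setT (EFin \o (exceeds (z n) : R * R -> R)).
  apply: (@integrable_bounded _ _ _ Q _ 1); first exact: measurable_time_indic.
  by move=> v; rewrite ger0_norm.
have ig2 n : Q.-integrable setT (EFin \o (fun v => g n v ^+ 2)).
  apply: (@integrable_dominated _ _ _ Q _ (fun v => (k n)%:R^-1 ^+ 2 * exceeds (z n) v)).
  - exact: measurable_funX.
  - by move=> v; rewrite ger0_norm ?sqr_ge0.
  - exact: integrableZr.
have H : \sum_(j < x.1) g x.1 (W j x.2) @[x --> pfilter P] --> l.
  apply: (triangular_lln Windep Wlaw mg).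
  - by near=> n; exact: ig2.
  - have U : (k n)%:R^-1 * (n%:R / (k n)%:R * sH (z n)) @[n --> \oo] --> (0 : R).
      by rewrite -(mul0r 1); apply: cvgM => //; exact: cvg_inv_k.
    apply: (squeeze_cvgr _ (cvg_cst 0) U); near=> n; apply/andP; split.
      by rewrite mulr_ge0// Rintegral_ge0// => v _; exact: sqr_ge0.
    rewrite [leRHS](_ : _ = n%:R * ((k n)%:R^-1 ^+ 2 * sH (z n))); last by ring.
    rewrite ler_wpM2l// sHE -(time_indic_mean XY).
    rewrite -(RintegralZl _ measurableT (i1 n)).
    apply: (le_Rintegral measurableT (ig2 n)); last by move=> v _; exact: g2.
    exact: (integrableZr ((k n)%:R^-1 ^+ 2) (i1 n)).
  - apply: (cvg_near_eq mean) => //; near=> n; rewrite /g RintegralZl ?mulrA//.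
    apply: (@integrable_bounded _ _ _ Q _ 1) => // v; have /andP[a0 a1] := h01 n v.
    by rewrite ger0_norm// (le_trans a1).
apply: (cvg_near_eq H) => //; near=> x.
by rewrite tail_sumE /g -mulr_sumr mulrC.
Unshelve. all: by end_near. Qed.

Lemma tail_count_lln z : intermediate_level z ->
  tail_sum (fun=> 1) (z x.1) x.1 x.2 / (k x.1)%:R @[x --> pfilter P] --> (1 : R).
Proof.
move=> zi; apply: (tail_sum_lln (f := fun _ _ => 1) zi) => // [n v _|].
  by rewrite ler01 lexx.
apply: (cvg_near_eq zi) => //; near=> n; congr (_ * _).
by under [in RHS]eq_Rintegral do rewrite mulr1; rewrite time_indic_mean ?sHE.
Unshelve. all: by end_near. Qed.

Lemma tail_uncensored_lln z : intermediate_level z ->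
  tail_sum (fun v => \1_[set 1] v.2) (z x.1) x.1 x.2 / (k x.1)%:R
    @[x --> pfilter P] --> p.
Proof.
move=> zi.
have m1 : measurable_fun setT (\1_[set 1] : R -> R) by exact: measurable_indic.
apply: (tail_sum_lln (f := fun _ v => \1_[set 1] v.2) zi) => // [n|n v _|].
- exact: (measurableT_comp m1).
- by rewrite indicE; case: (_ \in _); rewrite ?lexx ?ler01.
apply: (cvg_near_eq (mass_intermediate zi)) => //; near=> n; congr (_ * _).
have e1 : (\1_[set 1] : R -> R) 1 = 1 by rewrite indicE mem_set.
have e0 : (\1_[set 1] : R -> R) 0 = 0.
  by rewrite indicE memNset//= => /esym/eqP; rewrite oner_eq0.
have [_ ->] := uncensored_mean Xcont Xlt1 XY (z n) m1 (fun u => ler0n _ _) e1 e0.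
by [].
Unshelve. all: by end_near. Qed.

(** The observed time has a survival function of index
    -(1/gamma1 + 1/gamma2), so that s Z / s z behaves like the power p of a
    uniform variable. *)
Lemma tail_power_lln z (beta : R) : intermediate_level z -> 0 < beta ->
  tail_sum (fun v => (s v.1 / s (z x.1)) `^ beta) (z x.1) x.1 x.2 / (k x.1)%:R
    @[x --> pfilter P] --> (1 + p * beta)^-1.
Proof.
move=> zi beta0.
pose a x := s x `^ beta.
have a0 x : 0 < a x by exact: powR_gt0.
have ah : {homo a : x y / x <= y >-> y <= x}.
  by move=> x y xy; rewrite ge0_ler_powR ?nnegrE ?(ltW (s0 _)) ?(ltW beta0)// (survival_anti Xcont).
have ratioE x y : (s x / s y) `^ beta = a x / a y.
  have sy0 : s y != 0 by rewrite gt_eqF.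
  rewrite /a -[in RHS](divfK sy0 (s x)) [in RHS]powRM ?divr_ge0 ?(ltW (s0 _))//.
  by rewrite mulfK// gt_eqF// powR_gt0.
have g1 : 0 < gamma1^-1 by rewrite invr_gt0.
have g2 : 0 < gamma2^-1 by rewrite invr_gt0.
have ms : measurable_fun setT s by exact: measurable_survival.
have mf n : measurable_fun setT (fun v : R * R => (s v.1 / s (z n)) `^ beta).
  apply: (measurableT_comp (measurable_powR beta)); apply: measurable_funM => //.
  exact: (measurableT_comp ms).
have f01 n (v : R * R) : z n < v.1 -> 0 <= (s v.1 / s (z n)) `^ beta <= 1.
  move=> zv; rewrite powR_ge0/= -[leRHS](_ : 1 `^ beta = 1); last by rewrite powR1.
  rewrite ge0_ler_powR ?nnegrE ?(ltW beta0)//.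
    by rewrite divr_ge0// ltW.
  by rewrite ler_pdivrMr// mul1r (survival_anti Xcont)// ltW.
apply: (tail_sum_lln (f := fun n v => (s v.1 / s (z n)) `^ beta) zi) => //.
have rva : regularly_varying a (- (gamma1^-1 * beta)).
  by rewrite -mulNr; exact: rv_powR.
have rvH : regularly_varying (fun x => s x * sY x) (- (gamma1^-1 + gamma2^-1)).
  by rewrite opprD; exact: rvM.
have Hh : {homo (fun x => s x * sY x) : x y / x <= y >-> y <= x}.
  by move=> x y xy; rewrite -!sHE (survival_anti Zcont).
have H0 x : 0 < s x * sY x by rewrite mulr_gt0.
pose th := gamma1^-1 * beta / (gamma1^-1 + gamma2^-1).
have th0 : 0 < th by rewrite divr_gt0 ?mulr_gt0 ?addr_gt0.
have Hr := rv_ratio (mulr_gt0 g1 beta0) (addr_gt0 g1 g2) ah a0 Hh H0 rva rvH.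
have Hr' eps : 0 < eps -> \forall z \near +oo, forall z', z <= z' ->
    `|a z' / a z - (sH z' / sH z) `^ th| <= eps.
  by move=> /Hr; apply: filterS => x Hx z' /Hx; rewrite !sHE.
have M := tail_ratio_mean Zcont Zlt1 th0 ah a0 Hr'.
have M1 := cvg_comp _ _ (intermediate_level_pinfty zi) M.
have M2 : (\int[P]_w (\1_[set w | (z n < observed_time X Y w)%R] w *
    (a (observed_time X Y w) / a (z n))))%R / sH (z n) * (n%:R / (k n)%:R * sH (z n))
    @[n --> \oo] --> (1 + th)^-1 * 1.
  exact: (cvgM M1 zi).
apply: (cvg_near_eq M2).
  rewrite mulr1 /th; congr (_^-1); congr (1 + _); field.
  by rewrite !gt_eqF ?addr_gt0.
near=> n; rewrite mulrCA divfK ?gt_eqF//; congr (_ * _).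
have law (j : nat) A : measurable A ->
    distribution P ((fun=> observation X Y : {RV P >-> (R * R)%type}) j) A = Q A by [].
have mh : measurable_fun setT (fun v => exceeds (z n) v * (s v.1 / s (z n)) `^ beta).
  by apply: measurable_funM => //; exact: measurable_time_indic.
rewrite -(iid_Rintegral law 0 mh).
  congr fine; apply: eq_integral => w _; congr EFin; rewrite ratioE.
  by rewrite !indic_bool.
apply: (@integrable_bounded _ _ _ Q _ 1) => // v.
rewrite indic_bool; case: ltP => [zv|_]; last by rewrite mul0r normr0.
by rewrite mul1r; have /andP[? ?] := f01 n v zv; rewrite ger0_norm.
Unshelve. all: by end_near. Qed.

Lemma score_integrable z : Q.-integrable setT (EFin \o score z).
Proof.
have [i2 _] := score_sqr_mean Xcont Xlt1 XY z.
by apply: integrable_sqr_integrable => //; exact: measurable_score.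
Qed.

(** Orthogonality of martingale increments: for a <= b the score at a is, on
    the exceedances of b, the score at b plus the constant ln (s a / s b). *)
Lemma score_increment_sqr_mean a b : a <= b ->
  Q.-integrable setT (EFin \o (fun v => (score a v - score b v) ^+ 2)) /\
  (\int[Q]_v (score a v - score b v) ^+ 2)%R = mass a - mass b.
Proof.
move=> ab; pose c := ln (s a / s b).
have E : (fun v => (score a v - score b v) ^+ 2) =
    fun v => (score a v ^+ 2 - score b v ^+ 2) - (2 * c) * score b v.
  apply/funext => v; rewrite /score.
  rewrite !indic_bool; case: (ltP b v.1) => [bv|_]; last by rewrite !mul0r; ring.
  rewrite (le_lt_trans ab bv) !mul1r.
  have -> : ln (s a / s v.1) = c + ln (s b / s v.1).
    by rewrite /c !ln_div ?posrE//; ring.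
  by ring.
have [ia Ea] := score_sqr_mean Xcont Xlt1 XY a.
have [ib Eb] := score_sqr_mean Xcont Xlt1 XY b.
have i1 := integrableBr ia ib.
have i2 := integrableZr (2 * c) (score_integrable b).
rewrite E; split; first exact: integrableBr.
rewrite (RintegralB measurableT i1 i2) (RintegralB measurableT ia ib) Ea Eb.
rewrite (RintegralZl _ measurableT (score_integrable b)).
by rewrite (score_mean Xcont Xlt1 XY) mulr0 subr0.
Qed.

Definition score_sum (z : R) (n : nat) (w : T) : R := \sum_(j < n) score z (W j w).

Lemma score_sum_increment z z' : intermediate_level z -> intermediate_level z' ->
  (score_sum (z x.1) x.1 x.2 - score_sum (z' x.1) x.1 x.2) / Num.sqrt (k x.1)%:R
    @[x --> pfilter P] --> (0 : R).
Proof.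
move=> zi zi'.
have sq n : Q.-integrable setT (EFin \o (fun v => (score (z n) v - score (z' n) v) ^+ 2)) /\
  (\int[Q]_v (score (z n) v - score (z' n) v) ^+ 2)%R = `|mass (z n) - mass (z' n)|.
  have ge0 a b : a <= b -> 0 <= mass a - mass b.
    by move=> /score_increment_sqr_mean[_ <-]; apply: Rintegral_ge0 => v _; exact: sqr_ge0.
  have [zz|/ltW zz] := leP (z n) (z' n).
    have [i ->] := score_increment_sqr_mean zz; split => //.
    by rewrite ger0_norm ?ge0.
  have [i e] := score_increment_sqr_mean zz.
  rewrite distrC ger0_norm ?ge0// -e.
  have -> : (fun v => (score (z n) v - score (z' n) v) ^+ 2) =
    (fun v => (score (z' n) v - score (z n) v) ^+ 2).
    by apply/funext => v; rewrite -sqrrN opprB.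
  by split.
have ms a : measurable_fun setT (score a) by exact: measurable_score.
pose f n v := (Num.sqrt (k n)%:R)^-1 * (score (z n) v - score (z' n) v).
have mf n : measurable_fun setT (f n) by apply: measurable_funM => //; exact: measurable_funB.
have fE n : (fun v => f n v ^+ 2) =
    fun v => (Num.sqrt (k n)%:R)^-1 ^+ 2 * (score (z n) v - score (z' n) v) ^+ 2.
  by apply/funext => v; rewrite exprMn.
have H : \sum_(j < x.1) f x.1 (W j x.2) @[x --> pfilter P] --> (0 : R).
  apply: (triangular_lln Windep Wlaw mf).
  - by near=> n; rewrite fE; apply: integrableZr; exact: (sq n).1.
  - have M : `|n%:R / (k n)%:R * mass (z n) - n%:R / (k n)%:R * mass (z' n)|
        @[n --> \oo] --> (0 : R).
      rewrite -(normr0 R) -(subrr p); apply: cvg_norm.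
      by apply: cvgB; exact: mass_intermediate.
    apply: (cvg_near_eq M) => //; near=> n.
    rewrite fE (RintegralZl _ measurableT (sq n).1) (sq n).2 exprVn sqr_sqrtr//.
    by rewrite mulrA -mulrBr normrM ger0_norm.
  - apply: (cvg_near_eq (cvg_cst 0)) => //; near=> n; rewrite /f.
    rewrite (RintegralZl _ measurableT (integrableBr (score_integrable _) (score_integrable _))).
    rewrite (RintegralB measurableT (score_integrable _) (score_integrable _)).
    by rewrite !(score_mean Xcont Xlt1 XY) subr0 !mulr0.
apply: (cvg_near_eq H) => //; near=> x.
by rewrite /f -mulr_sumr mulrC /score_sum -sumrB.
Unshelve. all: by end_near. Qed.

(** The level exceeded by k + c sqrt k observations on average. *)
Definition near_level (c : R) (n : nat) : R :=
  quantile (rcdf P (observed_time X Y))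
    (1 - (k n)%:R / n%:R * (1 + c / Num.sqrt (k n)%:R)).

Let cvg_level_factor (c : R) : 1 + c / Num.sqrt (k n)%:R @[n --> \oo] --> (1 : R).
Proof.
rewrite -[X in _ --> X]addr0 -[X in _ --> _ + X](mulr0 c).
apply: cvgD; first exact: cvg_cst.
by apply: cvgMl_tmp; exact: cvg_inv_sqrt_k.
Qed.

Let level_factor_gt0 (c : R) : \forall n \near \oo, 0 < 1 + c / Num.sqrt (k n)%:R.
Proof. exact: (cvgr_gt _ (cvg_level_factor c) _ ltr01). Qed.

Let level_range (c : R) : \forall n \near \oo,
  0 < 1 - (k n)%:R / n%:R * (1 + c / Num.sqrt (k n)%:R) < 1.
Proof.
have H : (k n)%:R / n%:R * (1 + c / Num.sqrt (k n)%:R) @[n --> \oo] --> (0 : R).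
  by rewrite -(mul0r 1); apply: cvgM => //; exact: cvg_level_factor.
have H1 : \forall n \near \oo, (k n)%:R / n%:R * (1 + c / Num.sqrt (k n)%:R) < 1.
  exact: (cvgr_lt _ H _ ltr01).
apply: filterS3 H1 (level_factor_gt0 c) k_range => n h1 h2 /andP[k0 kn].
rewrite subr_gt0 h1 gtrBl mulr_gt0// divr_gt0 ?ltr0n//.
exact: ltn_trans kn.
Qed.

Lemma survival_near_level (c : R) : \forall n \near \oo,
  sH (near_level c n) = (k n)%:R / n%:R * (1 + c / Num.sqrt (k n)%:R).
Proof.
apply: filterS (level_range c) => n r.
by rewrite /survival /near_level (cdf_quantile (rcdf_continuous_cdf Zcont) r) subKr.
Qed.

Let n_gt0 : \forall n \near \oo, 0 < n%:R :> R.
Proof. by apply: filterS k_range => n /andP[k0 kn]; rewrite ltr0n (ltn_trans k0). Qed.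

Let k_gt0 : \forall n \near \oo, 0 < (k n)%:R :> R.
Proof. by apply: filterS k_range => n /andP[k0 kn]; rewrite ltr0n. Qed.

Lemma near_level_intermediate (c : R) : intermediate_level (near_level c).
Proof.
apply: (cvg_near_eq (cvg_level_factor c)) => //.
apply: filterS3 (survival_near_level c) n_gt0 k_gt0 => n -> n0 k0.
by rewrite mulrA -[(k n)%:R / n%:R]invf_div divff ?mul1r// mulf_neq0 ?invr_eq0 ?gt_eqF.
Qed.

Lemma near_level_anti (c c' : R) : c <= c' ->
  \forall n \near \oo, near_level c' n <= near_level c n.
Proof.
move=> cc'; apply: filterS2 (level_range c) (level_range c') => n r r'.
apply: (quantile_homo (rcdf_continuous_cdf Zcont)) => //.
by rewrite lerD2l lerN2 ler_wpM2l ?divr_ge0// lerD2l ler_wpM2r// invr_ge0 sqrtr_ge0.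
Qed.

Lemma censoring_indicator_values :
  \forall x \near pfilter P, forall j, (W j x.2).2 = \1_[set 1] (W j x.2).2.
Proof.
pose g (v : R * R) := v.2 - \1_[set 1] v.2.
have mg : measurable_fun setT g.
  apply: measurable_funB => //.
  by apply: (measurableT_comp (measurable_indic (measurable_set1 (1 : R)))).
have mB : measurable (~` [set v | g v = 0]).
  by apply: measurableC; have := mg measurableT _ (measurable_set1 0); rewrite setTI.
have QB : Q (~` [set v | g v = 0]) = 0%E.
  rewrite /distribution /pushforward [X in P X](_ : _ = set0) ?measure0//.
  apply/seteqP; split => w //=; apply.
  rewrite /g /observation /= /censoring_indicator [\1_ _ w]indic_bool.
  case: (X w <= Y w) => /=; rewrite indicE.
    by rewrite mem_set// subrr.
  by rewrite memNset ?subr0//= => /esym/eqP; rewrite oner_eq0.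
apply: (filterS _ (sample_avoids Wlaw mB QB)) => x H j.
by apply/eqP; rewrite -subr_eq0; apply/eqP; exact: (contrapT (H j)).
Qed.

(** Both the hazard part and the death count of the score sum decrease with
    the level. Between z0 and z1 the hazard part varies by at most
    ln (s z0 / s z1) per exceedance of z0, and the observed time, having the
    steeper tail, gives an upper bound for that logarithm. *)
Lemma score_sum_sandwich z0 t z1 n w : (forall j, 0 <= (W j w).2) ->
  z0 <= t -> t <= z1 ->
  score_sum z0 n w - ln (sH z0 / sH z1) * tail_sum (fun=> 1) z0 n w <= score_sum t n w <=
  score_sum z1 n w + ln (sH z0 / sH z1) * tail_sum (fun=> 1) z0 n w.
Proof.
move=> d0 z0t tz1; set L := ln _.
have l0t : ln (s t) <= ln (s z0) by rewrite ler_ln ?posrE// (survival_anti Xcont).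
have lt1 : ln (s z1) <= ln (s t) by rewrite ler_ln ?posrE// (survival_anti Xcont).
have LE : ln (s z0) - ln (s z1) <= L.
  rewrite /L !sHE ln_div ?posrE ?mulr_gt0// !lnM ?posrE//.
  have : ln (sY z1) <= ln (sY z0).
    by rewrite ler_ln ?posrE// (survival_anti Ycont)// (le_trans z0t).
  by lra.
have sE z v : score z v = if z < v.1 then ln (s z) - ln (s v.1) - v.2 else 0.
  by rewrite /score indic_bool; case: ltP; rewrite ?mul0r// mul1r ln_div ?posrE.
rewrite tail_sumE mulr_sumr /score_sum -sumrB -big_split/=; apply/andP; split.
  apply: ler_sum => j _; have := d0 j; move: (W j w) => v v0.
  rewrite !sE indic_bool mulr1.
  have lv : z0 < v.1 -> v.1 <= t -> ln (s t) <= ln (s v.1).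
    by move=> _ vt; rewrite ler_ln ?posrE// (survival_anti Xcont).
  have [z0v|vz0] := ltP z0 v.1; last by rewrite ltNge (le_trans vz0 z0t)/= mulr0 subr0.
  rewrite mulr1; have [tv|vt] := ltP t v.1; first by lra.
  by have := lv z0v vt; lra.
apply: ler_sum => j _; have := d0 j; move: (W j w) => v v0.
rewrite !sE indic_bool mulr1.
have [tv|vt] := ltP t v.1.
  rewrite (le_lt_trans z0t tv) mulr1; have [z1v|vz1] := ltP z1 v.1; first by lra.
  have : ln (s z1) <= ln (s v.1) by rewrite ler_ln ?posrE// (survival_anti Xcont).
  by lra.
rewrite ltNge (le_trans vt tz1)/= add0r.
by rewrite mulr_ge0 ?ler0n//; lra.
Qed.

(** Over a band of c-levels of width c' - c the sandwich costs
    (c' - c) sqrt k; its two ends are deterministic levels, for which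
    score_sum_increment applies. *)
Lemma score_sum_modulus (h : nat -> R) (t : nat -> T -> R) (c c' eps : R) :
  intermediate_level h -> c <= c' -> c' - c < eps ->
  \forall x \near pfilter P,
    near_level c' x.1 <= t x.1 x.2 <= near_level c x.1 ->
    `|score_sum (t x.1 x.2) x.1 x.2 - score_sum (h x.1) x.1 x.2|
      <= eps * Num.sqrt (k x.1)%:R.
Proof.
move=> hi cc' ceps; pose e1 := (eps - (c' - c)) / 2.
have e10 : 0 < e1 by rewrite divr_gt0// subr_gt0.
have inc b : \forall x \near pfilter P,
    `|score_sum (near_level b x.1) x.1 x.2 - score_sum (h x.1) x.1 x.2|
      <= e1 * Num.sqrt (k x.1)%:R.
  have /cvgr0Pnorm_le /(_ _ e10) H := score_sum_increment (near_level_intermediate b) hi.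
  apply: (filterS2 _ _ H (pfilter_fst P k_gt0)) => x + k0.
  by rewrite normrM normfV [`|Num.sqrt _|]ger0_norm// ler_pdivrMr// sqrtr_gt0.
pose U (x : nat * T) := tail_sum (fun=> 1) (near_level c' x.1) x.1 x.2 / (k x.1)%:R *
  ((c' - c) / (1 + c / Num.sqrt (k x.1)%:R)).
have UE : U x @[x --> pfilter P] --> 1 * ((c' - c) / 1).
  apply: cvgM; first exact: (tail_count_lln (near_level_intermediate c')).
  apply: cvgMl_tmp; apply: cvgV; first exact: oner_neq0.
  exact: (cvg_pfilter_seq P (cvg_level_factor c)).
have U1 : \forall x \near pfilter P, U x < c' - c + e1.
  by apply: (cvgr_lt _ UE); rewrite mul1r divr1 ltrDl.
have L : \forall n \near \oo, [/\ 0 < (k n)%:R :> R, 0 < 1 + c / Num.sqrt (k n)%:R,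
    0 < 1 + c' / Num.sqrt (k n)%:R &
    sH (near_level c' n) / sH (near_level c n) =
    (1 + c' / Num.sqrt (k n)%:R) / (1 + c / Num.sqrt (k n)%:R)].
  apply: filterS2 (filterI (survival_near_level c) (survival_near_level c'))
    (filterI (filterI (level_factor_gt0 c) (level_factor_gt0 c')) (filterI n_gt0 k_gt0)).
  move=> n [-> ->] [[f0 f0'] [n0 k0]]; split => //.
  rewrite -mulf_div divff ?mul1r//.
  by rewrite mulf_neq0 ?invr_eq0 ?gt_eqF.
have I := inc c; have I' := inc c'.
apply: (filterS3 _ _ (filterI I I') U1 (filterI (pfilter_fst P L) censoring_indicator_values)).
move=> x [i i'] u [[k0 f0 f0' E] dv] /andP[t1 t2].
have d0 j : 0 <= (W j x.2).2 by rewrite dv.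
have /andP[lo up] := score_sum_sandwich x.1 d0 t1 t2.
set q := Num.sqrt (k x.1)%:R in i i' f0 f0' E *.
have q0 : 0 < q by rewrite sqrtr_gt0.
have kq : (k x.1)%:R = q * q by rewrite -expr2 sqr_sqrtr// ltW.
have N0 : 0 <= tail_sum (fun=> 1) (near_level c' x.1) x.1 x.2.
  by apply: sumr_ge0.
have Lq : ln (sH (near_level c' x.1) / sH (near_level c x.1)) <=
    (c' - c) / (1 + c / q) / q.
  rewrite E [leRHS](_ : _ = (1 + c' / q) / (1 + c / q) - 1).
    rewrite -[X in ln X](subrK 1) [X in ln X]addrC le_ln1Dx//.
    by rewrite ltrBrDr addNr divr_gt0.
  have -> : 1 + c' / q = (1 + c / q) + (c' - c) / q by ring.
  by move: f0; set f := 1 + c / q => f0; field; rewrite !gt_eqF.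
have LN : ln (sH (near_level c' x.1) / sH (near_level c x.1)) *
    tail_sum (fun=> 1) (near_level c' x.1) x.1 x.2 <= (c' - c + e1) * q.
  apply: le_trans (ler_wpM2r N0 Lq) _.
  apply: le_trans (_ : U x * q <= _); last by rewrite ler_wpM2r ?ltW.
  rewrite /U -/q kq le_eqVlt; apply/orP; left; apply/eqP.
  by move: f0; set f := 1 + c / q => f0; field; rewrite !gt_eqF.
have eE : eps * q = (c' - c + e1) * q + e1 * q by rewrite /e1; field.
clear E dv d0 kq Lq t1 t2 u N0.
move: i i' lo up LN eE; rewrite !ler_norml => /andP[? ?] /andP[? ?] ? ? ? ->.
by apply/andP; split; lra.
Qed.

(** Finitely many short bands cover a wide one. *)
Lemma score_sum_modulus_chain (h : nat -> R) (t : nat -> T -> R) (c eps : R) m :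
  intermediate_level h -> 0 < eps ->
  \forall x \near pfilter P,
    near_level (c + (eps / 2) * m%:R) x.1 <= t x.1 x.2 <= near_level c x.1 ->
    `|score_sum (t x.1 x.2) x.1 x.2 - score_sum (h x.1) x.1 x.2|
      <= eps * Num.sqrt (k x.1)%:R.
Proof.
move=> hi eps0; elim: m => [|m IH].
  have := @score_sum_modulus h t c c eps hi (lexx c).
  by rewrite subrr mulr0 addr0 => /(_ eps0).
have s1 : c + eps / 2 * m%:R <= c + eps / 2 * m.+1%:R.
  by rewrite lerD2l ler_wpM2l ?ler_nat// divr_ge0// ltW.
have s2 : c + eps / 2 * m.+1%:R - (c + eps / 2 * m%:R) < eps.
  by rewrite -[m.+1%:R]natr1 mulrDr mulr1; lra.
apply: (filterS2 _ _ IH (score_sum_modulus t hi s1 s2)) => x IHx Hx /andP[t1 t2].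
have [tm|/ltW tm] := leP (near_level (c + eps / 2 * m%:R) x.1) (t x.1 x.2).
  by apply: IHx; rewrite tm t2.
by apply: Hx; rewrite t1 tm.
Qed.

(** The count of exceedances decreases with the level, so that a level with
    exactly k of them lies between two levels whose counts are on either side of
    k, as Chebyshev's inequality ensures for a large C. *)
Lemma level_tightness (t : nat -> T -> R) (e : R) : 0 < e ->
  (\forall x \near pfilter P,
    tail_sum (fun=> 1) (t x.1 x.2) x.1 x.2 = (k x.1)%:R) ->
  exists2 C : R, 0 < C & \forall n \near \oo,
    exists2 B : set T, measurable B /\ (P B <= e%:E)%E &
      forall w, ~ B w -> near_level C n <= t n w <= near_level (- C) n.
Proof.
move=> e0 Nt.
have [C C0 Ce] : exists2 C : R, 0 < C & 4 / C ^+ 2 <= e / 2.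
  exists (1 + 8 / e); first by rewrite addr_gt0// divr_gt0.
  have a0 : 0 < 8 / e by rewrite divr_gt0.
  rewrite ler_pdivrMr ?exprn_gt0 ?addr_gt0//.
  have -> : e / 2 * (1 + 8 / e) ^+ 2 = e / 2 + 8 + 32 / e by field; rewrite gt_eqF.
  have : 0 <= e / 2 by rewrite divr_ge0// ltW.
  have : 0 <= 32 / e by rewrite divr_ge0// ltW.
  by lra.
exists C => //.
have e20 : 0 < e / 2 by rewrite divr_gt0.
pose N z n w := \sum_(j < n) exceeds z (W j w) : R.
pose A c n := [set w | C * Num.sqrt (k n)%:R <=
  `|N (near_level c n) n w - n%:R * (\int[Q]_v exceeds (near_level c n) v)%R|].
have mind z : measurable_fun setT (exceeds z : R * R -> R).
  exact: measurable_time_indic.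
have mA c n : measurable (A c n).
  apply: measurable_leset => //; apply: measurableT_comp => //.
  by apply: measurable_funB => //; exact: (measurable_iid_sum W n (mind _)).
have sqE z : (fun v : R * R => exceeds z v ^+ 2 : R) =
    exceeds z.
  by apply/funext => v; rewrite indic_bool; case: (_ < _); rewrite ?expr1n ?expr0n.
have iind z : Q.-integrable setT (EFin \o (exceeds z : R * R -> R)).
  apply: (@integrable_bounded _ _ _ Q _ 1) => // v.
  by rewrite indic_bool; case: (_ < _); rewrite ?normr1 ?normr0.
have PA c : c <= C -> \forall n \near \oo, (P (A c n) <= (2 / C ^+ 2)%:E)%E.
  move=> cC.
  have F1 : \forall n \near \oo, 1 + c / Num.sqrt (k n)%:R < 2.
    by apply: (cvgr_lt _ (cvg_level_factor c)); rewrite ltr1n.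
  apply: filterS3 (survival_near_level c) F1 (filterI n_gt0 k_gt0) => n sE f1 [n0 k0].
  have q0 : 0 < C * Num.sqrt (k n)%:R by rewrite mulr_gt0// sqrtr_gt0.
  have i2 : Q.-integrable setT
      (EFin \o (fun v => exceeds (near_level c n) v ^+ 2 : R)).
    by rewrite sqE.
  apply: (le_trans (iid_sum_deviation Windep Wlaw n q0 (mind _) i2)).
  rewrite lee_fin sqE time_indic_mean// -sHE sE exprMn sqr_sqrtr ?(ltW k0)//.
  rewrite [leLHS](_ : _ = (1 + c / Num.sqrt (k n)%:R) / C ^+ 2).
    by rewrite ler_wpM2r ?invr_ge0 ?sqr_ge0// ltW.
  by field; rewrite !gt_eqF// sqrtr_gt0.
have CC : - C <= C by rewrite ge0_cp// ltW.
have mean c : \forall n \near \oo,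
    n%:R * (\int[Q]_v exceeds (near_level c n) v)%R =
    (k n)%:R + c * Num.sqrt (k n)%:R.
  apply: filterS3 (survival_near_level c) n_gt0 k_gt0 => n sE n0 k0.
  rewrite time_indic_mean// -sHE sE.
  have q0 : 0 < Num.sqrt (k n)%:R :> R by rewrite sqrtr_gt0.
  have kq : (k n)%:R = Num.sqrt (k n)%:R * Num.sqrt (k n)%:R :> R.
    by rewrite -expr2 sqr_sqrtr// ltW.
  move: kq q0; set q := Num.sqrt _ => kq q0; rewrite kq.
  by field; rewrite !gt_eqF.
have N2 : \forall n \near \oo, exists2 B : set T,
    measurable B /\ (P B <= (e / 2)%:E)%E &
    forall w, ~ B w -> tail_sum (fun=> 1) (t n w) n w = (k n)%:R by exact: Nt.
apply: filterS3 N2 (filterI (PA C (lexx C)) (PA (- C) CC))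
  (filterI (mean C) (mean (- C))) => n [B0 [mB0 PB0] HB0] [P1 P2] [m1 m2].
exists (B0 `|` (A C n `|` A (- C) n)).
  split; first by apply: measurableU => //; exact: measurableU.
  apply: (le_trans (measureU2 _ _ _)) => //; first exact: measurableU.
  rewrite [X in (_ <= X%:E)%E]splitr EFinD leeD//.
  apply: (le_trans (measureU2 _ _ _)) => //.
  apply: (le_trans (leeD P1 P2)); rewrite -EFinD lee_fin.
  by apply: le_trans Ce; rewrite -mulrDl ler_wpM2r ?invr_ge0 ?sqr_ge0//; lra.
move=> w /not_orP[nB /not_orP[nA1 nA2]].
have Nk : tail_sum (fun=> 1) (t n w) n w = (k n)%:R by exact: HB0.
have NE z : tail_sum (fun=> 1) z n w = N z n w.
  by rewrite tail_sumE; apply: eq_bigr => j _; rewrite mulr1.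
have Nanti a b : a <= b -> N b n w <= N a n w.
  move=> ab; apply: ler_sum => j _; rewrite !indic_bool ler_nat.
  by case: (ltP b) => // bv; rewrite (le_lt_trans ab bv).
rewrite NE in Nk.
move/negP : nA1; rewrite -ltNge m1 ltr_norml => /andP[l1 _].
move/negP : nA2; rewrite -ltNge m2 ltr_norml => /andP[_ l2].
apply/andP; split; rewrite leNgt; apply/negP => /ltW /Nanti; rewrite Nk.
  by move: l1; lra.
by move: l2; lra.
Qed.

Local Notation h := (near_level 0).

Let hi : intermediate_level h. Proof. exact: near_level_intermediate. Qed.

Section random_level.

(** The (k+1)-st largest observation, characterised by its k exceedances. *)
Variable t : nat -> T -> R.
Hypothesis Nt : \forall x \near pfilter P,
    tail_sum (fun=> 1) (t x.1 x.2) x.1 x.2 = (k x.1)%:R.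

Lemma near_of_tight (S : set (nat * T)) :
  (forall C : R, 0 < C -> \forall x \near pfilter P,
     near_level C x.1 <= t x.1 x.2 <= near_level (- C) x.1 -> S x) ->
  \forall x \near pfilter P, S x.
Proof.
move=> HS e e0; have e20 : 0 < e / 2 by rewrite divr_gt0.
have [C C0 HC] := level_tightness e20 Nt.
have H : \forall n \near \oo, exists2 B : set T, measurable B /\ (P B <= (e / 2)%:E)%E &
    forall w, ~ B w -> near_level C n <= t n w <= near_level (- C) n -> S (n, w).
  exact: HS.
apply: filterS2 HC H => n [B1 [m1 p1] h1] [B2 [m2 p2] h2].
exists (B1 `|` B2).
  split; first exact: measurableU.
  apply: (le_trans (measureU2 _ _ _)) => //.
  by rewrite [X in (_ <= X%:E)%E]splitr EFinD leeD.
by move=> w /not_orP[n1 n2]; apply: h2 => //; exact: h1.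
Qed.

Lemma score_sum_random_level :
  (score_sum (t x.1 x.2) x.1 x.2 - score_sum (h x.1) x.1 x.2) / Num.sqrt (k x.1)%:R
    @[x --> pfilter P] --> (0 : R).
Proof.
apply/cvgr0Pnorm_le => eps eps0; apply: near_of_tight => C C0.
pose m := (Num.bound (4 * C / eps)).
have Cm : C <= - C + eps / 2 * m%:R.
  have : 4 * C / eps <= m%:R by apply/ltW/archi_boundP; rewrite divr_ge0 ?mulr_ge0// ltW.
  by rewrite ler_pdivrMr//; lra.
have H := score_sum_modulus_chain t (- C) m hi eps0.
have A := near_level_anti Cm.
apply: (filterS3 _ _ H (pfilter_fst P A) (pfilter_fst P k_gt0)) => x Hx Ax k0 /andP[t1 t2].
rewrite normrM normfV [`|Num.sqrt _|]ger0_norm// ler_pdivrMr ?sqrtr_gt0//.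
by apply: Hx; rewrite (le_trans Ax t1) t2.
Qed.

(** The ratio for s lies between 1 and the ratio for the observed time, which
    tightness confines to 1 +- C / sqrt k. *)
Lemma survival_random_level :
  s (t x.1 x.2) / s (h x.1) @[x --> pfilter P] --> (1 : R).
Proof.
apply/cvgrPdist_le => eps eps0; apply: near_of_tight => C C0.
have q : C / Num.sqrt (k n)%:R @[n --> \oo] --> (0 : R).
  by rewrite -[X in _ --> X](mulr0 C); apply: cvgMl_tmp; exact: cvg_inv_sqrt_k.
have q1 : \forall n \near \oo, C / Num.sqrt (k n)%:R < eps by exact: (cvgr_lt _ q).
have L c := survival_near_level c.
apply: (filterS _ (pfilter_fst P (filterI (filterI q1 k_range) (filterI (L 0) (filterI (L C) (L (- C))))))).
move=> x /= [[qe /andP[k0 kn]] [l0 [lC lNC]]] /andP[t1 t2].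
set a := (k x.1)%:R / x.1%:R in l0 lC lNC.
have a0 : 0 < a by rewrite divr_gt0// ltr0n// (ltn_trans k0).
rewrite mul0r addr0 mulr1 in l0.
set z := t x.1 x.2 in t1 t2 *.
have up : sH z <= a * (1 + C / Num.sqrt (k x.1)%:R) by rewrite -lC (survival_anti Zcont).
have lo : a * (1 - C / Num.sqrt (k x.1)%:R) <= sH z.
  by rewrite -mulNr -lNC (survival_anti Zcont).
rewrite distrC.
have ratioE : sH z / sH (h x.1) = s z / s (h x.1) * (sY z / sY (h x.1)).
  by rewrite !sHE mulf_div.
have r1 : sH z / sH (h x.1) <= 1 + eps.
  rewrite l0 ler_pdivrMr// (le_trans up)// mulrC ler_wpM2r// ?(ltW a0)//; lra.
have r2 : 1 - eps <= sH z / sH (h x.1).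
  rewrite l0 ler_pdivlMr// (le_trans _ lo)// mulrC ler_wpM2l// ?(ltW a0)//; lra.
rewrite ratioE in r1 r2.
have rpos : 0 < s z / s (h x.1) by rewrite divr_gt0.
rewrite ler_norml; apply/andP; split.
  rewrite lerBrDr addrC (_ : 1 + - eps = 1 - eps)//.
  have [zh|hz] := leP (h x.1) z.
    apply: le_trans r2 _; rewrite ler_piMr ?(ltW rpos)// ler_pdivrMr// mul1r.
    by rewrite (survival_anti Ycont).
  rewrite (@le_trans _ _ 1)//; first by lra.
  by rewrite ler_pdivlMr// mul1r (survival_anti Xcont)// ltW.
rewrite lerBlDl.
have [zh|hz] := leP z (h x.1).
  apply: le_trans _ r1; rewrite ler_peMr ?(ltW rpos)// ler_pdivlMr// mul1r.
  by rewrite (survival_anti Ycont).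
rewrite (@le_trans _ _ 1)//; last by lra.
by rewrite ler_pdivrMr// mul1r (survival_anti Xcont)// ltW.
Qed.

Lemma tail_sum_replace (f : R * R -> R) (M a b : R) n w :
  (forall j, a < (W j w).1 -> 0 <= f (W j w) <= M) ->
  (forall j, b < (W j w).1 -> 0 <= f (W j w) <= M) ->
  `|tail_sum f a n w - tail_sum f b n w| <=
  M * `|tail_sum (fun=> 1) a n w - tail_sum (fun=> 1) b n w|.
Proof.
wlog ab : a b / a <= b => [H fa fb|fa _].
  have [ab|/ltW ba] := leP a b; first exact: H.
  by rewrite distrC [X in M * X]distrC; apply: H.
rewrite !tail_sumE -!sumrB.
have E (j : 'I_n) : exceeds a (W j w) * f (W j w) -
   exceeds b (W j w) * f (W j w) =
   ((a < (W j w).1) && ((W j w).1 <= b))%:R * f (W j w).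
  rewrite -mulrBl !indic_bool leNgt; case: (ltP b) => [bw|_]; rewrite ?(le_lt_trans ab bw) ?subrr//.
  by rewrite subr0 andbT.
have E1 (j : 'I_n) : exceeds a (W j w) * 1 -
   exceeds b (W j w) * 1 =
   ((a < (W j w).1) && ((W j w).1 <= b))%:R :> R.
  rewrite !mulr1 !indic_bool leNgt; case: (ltP b) => [bw|_]; rewrite ?(le_lt_trans ab bw) ?subrr//.
  by rewrite subr0 andbT.
rewrite (eq_bigr _ (fun j _ => E j)) (eq_bigr _ (fun j _ => E1 j)).
rewrite [X in M * X]ger0_norm ?sumr_ge0// mulr_sumr.
apply: le_trans (ler_norm_sum _ _ _) _; apply: ler_sum => j _.
case: (ltP a) => [aw|_]; last by rewrite /= mul0r normr0 mulr0.
have /andP[f0 fM] := fa j aw.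
by rewrite normrM normr_nat (ger0_norm f0) mulrC ler_wpM2r.
Qed.

(** Moving the threshold from h to t adds or removes as many terms as the
    counts of exceedances differ, namely |k - N h| = o(k). *)
Lemma tail_sum_random_level (f : nat -> R * R -> R) (M l : R) :
  (\forall x \near pfilter P, forall j,
     h x.1 < (W j x.2).1 -> 0 <= f x.1 (W j x.2) <= M) ->
  (\forall x \near pfilter P, forall j,
     t x.1 x.2 < (W j x.2).1 -> 0 <= f x.1 (W j x.2) <= M) ->
  tail_sum (f x.1) (h x.1) x.1 x.2 / (k x.1)%:R @[x --> pfilter P] --> l ->
  tail_sum (f x.1) (t x.1 x.2) x.1 x.2 / (k x.1)%:R @[x --> pfilter P] --> l.
Proof.
move=> fh ft fl.
have N1 := tail_count_lln hi.
have D0 : M * `|1 - tail_sum (fun=> 1) (h x.1) x.1 x.2 / (k x.1)%:R|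
    @[x --> pfilter P] --> (0 : R).
  rewrite -[X in _ --> X](mulr0 M) -[X in _ * X](normr0 R) -[X in `|X|](subrr 1).
  by apply: cvgMl_tmp; apply: cvg_norm; apply: cvgB => //; exact: cvg_cst.
have D : tail_sum (f x.1) (t x.1 x.2) x.1 x.2 / (k x.1)%:R -
    tail_sum (f x.1) (h x.1) x.1 x.2 / (k x.1)%:R @[x --> pfilter P] --> (0 : R).
  apply/cvgr0Pnorm_le => eps eps0.
  have D1 : \forall x \near pfilter P,
      M * `|1 - tail_sum (fun=> 1) (h x.1) x.1 x.2 / (k x.1)%:R| < eps.
    exact: (cvgr_lt _ D0).
  apply: (filterS3 _ _ (filterI fh ft) D1 (filterI Nt (pfilter_fst P k_gt0))).
  move=> x [fhx ftx] lt1 [Nx k0]; apply: le_trans (ltW lt1).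
  have kk : 1 = (k x.1)%:R / (k x.1)%:R :> R by rewrite divff// gt_eqF.
  rewrite -mulrBl normrM [X in M * `|X - _|]kk -mulrBl normrM mulrA ler_wpM2r//.
  by rewrite -[X in M * `|X - _|]Nx; exact: tail_sum_replace.
apply: (cvg_near_eq (cvgD D fl)); first by rewrite add0r.
by near=> x; rewrite /= subrK.
Unshelve. all: by end_near. Qed.

Lemma uncensored_proportion_random_level :
  tail_sum (fun v => v.2) (t x.1 x.2) x.1 x.2 / (k x.1)%:R @[x --> pfilter P] --> p.
Proof.
have b (v : R * R) : 0 <= (\1_[set 1] v.2 : R) <= 1.
  by rewrite indicE; case: (_ \in _); rewrite ?lexx ?ler01.
have H := tail_uncensored_lln hi.
have H1 : tail_sum (fun v => \1_[set 1] v.2) (t x.1 x.2) x.1 x.2 / (k x.1)%:R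
    @[x --> pfilter P] --> p.
  apply: (@tail_sum_random_level (fun _ v => \1_[set 1] v.2) 1) => //.
    by near=> x => j _; exact: b.
  by near=> x => j _; exact: b.
apply: (cvg_near_eq H1) => //.
apply: (filterS _ (censoring_indicator_values)) => x dv.
by congr (_ / _); apply: eq_bigr => j _; rewrite -dv.
Unshelve. all: by end_near. Qed.

Let ratio_le2 : \forall x \near pfilter P, s (t x.1 x.2) / s (h x.1) < 2.
Proof. by apply: (cvgr_lt _ survival_random_level); rewrite ltr1n. Qed.

Lemma power_random_level (beta : R) : 0 < beta ->
  tail_sum (fun v => (s v.1 / s (h x.1)) `^ beta) (t x.1 x.2) x.1 x.2 / (k x.1)%:R
    @[x --> pfilter P] --> (1 + p * beta)^-1.
Proof.
move=> beta0.
have H := tail_power_lln hi beta0.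
have le2 x y : s x / s y <= 2 -> 0 <= (s x / s y) `^ beta <= 2 `^ beta.
  move=> r2; rewrite powR_ge0/= ge0_ler_powR ?nnegrE ?(ltW beta0)//.
  by rewrite divr_ge0// ltW.
apply: (@tail_sum_random_level (fun n v => (s v.1 / s (h n)) `^ beta) (2 `^ beta)) => //.
  near=> x => j hv; apply: le2; rewrite ler_pdivrMr//.
  have : s (W j x.2).1 <= s (h x.1) by rewrite (survival_anti Xcont)// ltW.
  by have := s0 (h x.1); lra.
apply: (filterS _ ratio_le2) => x r2 j tv; apply: le2; apply: le_trans (ltW r2).
by rewrite ler_wpM2r ?invr_ge0 ?(ltW (s0 _))// (survival_anti Xcont)// ltW.
Unshelve. all: by end_near. Qed.

(** By tail_expansion the term of an exceedance Z is A / tau times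
    (s Z / s h)^(- tau) - (s t / s h)^(- tau), with A taken at 1 / s h; the first
    powers average to 1 / (1 - p tau), and the second tends to 1. *)
Lemma bias_random_level (tau lambda : R) (A : R -> R) : tau < 0 ->
  second_order_condition (tail_quantile (rcdf P X)) gamma1 tau A ->
  Num.sqrt (k n)%:R * A (1 / s (h n)) @[n --> \oo] --> lambda ->
  tail_sum (fun v => (ln v.1 + gamma1 * ln (s v.1)) -
      (ln (t x.1 x.2) + gamma1 * ln (s (t x.1 x.2)))) (t x.1 x.2) x.1 x.2
    / Num.sqrt (k x.1)%:R @[x --> pfilter P] --> lambda * p / (1 - p * tau).
Proof.
move=> tau0 KA Al.
pose beta := - tau; have beta0 : 0 < beta by rewrite oppr_gt0.
pose q n : R := Num.sqrt (k n)%:R.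
pose a n := A (1 / s (h n)).
pose ell z := ln z + gamma1 * ln (s z).
pose V z n := (s z / s (h n)) `^ beta.
pose main (x : nat * T) := q x.1 * a x.1 / tau *
  (tail_sum (fun v => V v.1 x.1) (t x.1 x.2) x.1 x.2 / (k x.1)%:R - V (t x.1 x.2) x.1).
have Vt : V (t x.1 x.2) x.1 @[x --> pfilter P] --> (1 : R).
  have H : expR (beta * ln (s (t x.1 x.2) / s (h x.1))) @[x --> pfilter P] -->
      expR (beta * ln (1 : R)).
    apply: continuous_cvg; first exact: continuous_expR.
    apply: cvgMl_tmp; apply: continuous_cvg; last exact: survival_random_level.
    exact: continuous_ln.
  apply: (cvg_near_eq H); first by rewrite ln1 mulr0 expR0.
  by near=> x; rewrite /V powR_expR// divr_gt0.
have pg0 : 0 < p by rewrite divr_gt0// addr_gt0.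
have pt0 : 1 - p * tau != 0.
  by rewrite gt_eqF// subr_gt0 (lt_trans _ ltr01)// pmulr_rlt0.
have mainl : main x @[x --> pfilter P] --> lambda * p / (1 - p * tau).
  have H : main x @[x --> pfilter P] --> lambda / tau * ((1 + p * beta)^-1 - 1).
    apply: cvgM; last by apply: cvgB => //; exact: power_random_level.
    by apply: cvgMr_tmp; exact: (cvg_pfilter_seq P Al).
  apply: (cvg_near_eq H) => //; last by near=> x.
  move: pt0; rewrite /beta mulrN; move: p => u pt0.
  by field; rewrite pt0 lt_eqF.
have diff : tail_sum (fun v => ell v.1 - ell (t x.1 x.2)) (t x.1 x.2) x.1 x.2 / q x.1 -
    main x @[x --> pfilter P] --> (0 : R).
  apply/cvgr0Pnorm_le => eta eta0.
  pose eps := eta / (2 * (`|lambda| + 1)).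
  have l0 : 0 < `|lambda| + 1 by rewrite ltr_wpDl.
  have eps0 : 0 < eps by rewrite divr_gt0 ?mulr_gt0.
  have [L HL] := tail_expansion (rcdf_continuous_cdf Xcont) Xlt1 tau0 KA.
  have hy := intermediate_level_pinfty hi.
  have HLn : \forall n \near \oo, forall z', s z' <= 2 * s (h n) ->
      `|ell z' - L - a n / tau * V z' n| <= eps * `|a n|.
    exact: (hy _ (HL _ eps0)).
  have qa : \forall n \near \oo, `|q n * a n| < `|lambda| + 1.
    by apply: (cvgr_lt _ (cvg_norm Al)); rewrite ltrDl.
  apply: (filterS3 _ _ (pfilter_fst P (filterI HLn qa)) ratio_le2 (filterI Nt (pfilter_fst P k_gt0))).
  move=> x [E qax] r2 [Nx k0]; set w := x.2 in Nx *; set n := x.1 in E qax r2 Nx k0 *.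
  set z := t n w in r2 Nx *.
  have q0 : 0 < q n by rewrite sqrtr_gt0.
  have kq : (k n)%:R = q n * q n by rewrite -expr2 sqr_sqrtr// ltW.
  have sz2 : s z <= 2 * s (h n) by rewrite -ler_pdivrMr// ltW.
  have Ez := E _ sz2.
  have Ev (v : R * R) : z < v.1 ->
     `|ell v.1 - ell z - a n / tau * (V v.1 n - V z n)| <= 2 * eps * `|a n|.
    move=> zv; have sv2 : s v.1 <= 2 * s (h n).
      by rewrite (le_trans _ sz2)// (survival_anti Xcont)// ltW.
    have := E _ sv2; move: Ez; rewrite !ler_norml => /andP[? ?] /andP[? ?].
    by rewrite mulrBr; apply/andP; split; lra.
  have tn : tau != 0 by rewrite lt_eqF.
  have qn : q n != 0 by rewrite gt_eqF.
  have mainE : main x = tail_sum (fun v => a n / tau * (V v.1 n - V z n)) z n w / q n.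
    rewrite /main -/n -/w -/z /tail_sum -mulr_sumr sumrB.
    have -> : \sum_(i < n | z < (W i w).1) V z n = (k n)%:R * V z n.
      by rewrite -Nx /tail_sum mulr_suml; apply: eq_bigr => j _; rewrite mul1r.
    by rewrite kq; move: (\sum_(i < n | _) _) => S; field; rewrite ?tn ?qn.
  rewrite mainE -mulrBl /tail_sum -sumrB normrM normfV (gtr0_norm q0) ler_pdivrMr//.
  apply: le_trans (ler_norm_sum _ _ _) _.
  apply: le_trans (_ : \sum_(i < n | z < (W i w).1) (2 * eps * `|a n|) * 1 <= _).
    by apply: ler_sum => j zv; rewrite mulr1; exact: Ev.
  rewrite -mulr_sumr [X in _ * X]Nx kq.
  have -> : 2 * eps * `|a n| * (q n * q n) = 2 * eps * `|q n * a n| * q n.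
    by rewrite normrM (gtr0_norm q0); ring.
  rewrite ler_wpM2r ?(ltW q0)//.
  have -> : eta = 2 * eps * (`|lambda| + 1) by rewrite /eps; field; rewrite gt_eqF.
  by rewrite ler_wpM2l ?mulr_ge0 ?(ltW eps0)// ltW.
apply: (cvg_near_eq (cvgD diff mainl)); first by rewrite add0r.
by near=> x; rewrite /= subrK.
Unshelve. all: by end_near. Qed.

End random_level.

Let p0 : 0 < p. Proof. by rewrite divr_gt0// addr_gt0. Qed.

Lemma score_sum_clt (y : R) :
  fine (P [set w | score_sum (h n) n w / Num.sqrt (k n)%:R <= y]) @[n --> \oo] -->
  Phi (y / Num.sqrt p).
Proof.
pose f n v := (Num.sqrt (k n)%:R)^-1 * score (h n) v.
have ms a : measurable_fun setT (score a) by exact: measurable_score.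
have mf n : measurable_fun setT (f n) by exact: measurable_funM.
have i1 a := score_integrable a.
have sp0 : 0 < Num.sqrt p by rewrite sqrtr_gt0.
have f3E n : (fun v => `|f n v| ^+ 3) =
    fun v => (Num.sqrt (k n)%:R)^-1 ^+ 3 * `|score (h n) v| ^+ 3.
  by apply/funext => v; rewrite normrM exprMn ger0_norm// invr_ge0 sqrtr_ge0.
have f2E n : (fun v => f n v ^+ 2) =
    fun v => (Num.sqrt (k n)%:R)^-1 ^+ 2 * score (h n) v ^+ 2.
  by apply/funext => v; rewrite exprMn.
have [c3 c3l] : (forall n, Q.-integrable setT (EFin \o (fun v => `|score (h n) v| ^+ 3))) /\
    (forall n, (\int[Q]_v `|score (h n) v| ^+ 3)%R <= 7 * sH (h n)).
  by split => n; have [i l] := score_cube_mean Xcont Xlt1 XY (h n); rewrite ?sHE.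
have f3 : \forall n \near \oo, Q.-integrable setT (EFin \o (fun v => `|f n v| ^+ 3)).
  by near=> n; rewrite f3E; exact: integrableZr.
have f0 : \forall n \near \oo, (\int[Q]_v f n v)%R = 0.
  near=> n; rewrite /f (RintegralZl _ measurableT (i1 _)).
  by rewrite (score_mean Xcont Xlt1 XY) mulr0.
have lyapunov : n%:R * (\int[Q]_v `|f n v| ^+ 3)%R @[n --> \oo] --> (0 : R).
  have U : (Num.sqrt (k n)%:R)^-1 * (7 * (n%:R / (k n)%:R * sH (h n))) @[n --> \oo] --> (0 : R).
    rewrite -[X in _ --> X](mul0r (7 * 1)); apply: cvgM; first exact: cvg_inv_sqrt_k.
    by apply: cvgMl_tmp; exact: hi.
  apply: (squeeze_cvgr _ (cvg_cst 0) U); near=> n; apply/andP; split.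
    by rewrite mulr_ge0// Rintegral_ge0// => v _; rewrite exprn_ge0.
  rewrite f3E (RintegralZl _ measurableT (c3 n)).
  have k0 : 0 < (k n)%:R :> R by near: n.
  have q0 : 0 < Num.sqrt (k n)%:R :> R by rewrite sqrtr_gt0.
  have kq : (k n)%:R = Num.sqrt (k n)%:R * Num.sqrt (k n)%:R :> R.
    by rewrite -expr2 sqr_sqrtr// ltW.
  rewrite [leRHS](_ : _ = n%:R * ((Num.sqrt (k n)%:R)^-1 ^+ 3 * (7 * sH (h n)))).
    by rewrite ler_wpM2l// ler_wpM2l ?c3l// exprn_ge0// invr_ge0 sqrtr_ge0.
  move: q0 kq; set q := Num.sqrt _; move: (sH _) => u q0 ->.
  by field; rewrite gt_eqF.
have var : n%:R * (\int[Q]_v f n v ^+ 2)%R @[n --> \oo] --> Num.sqrt p ^+ 2.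
  have M := mass_intermediate hi.
  apply: (cvg_near_eq M); first by rewrite sqr_sqrtr// ltW.
  near=> n; have [i e] := score_sqr_mean Xcont Xlt1 XY (h n).
  by rewrite f2E (RintegralZl _ measurableT i) e exprVn sqr_sqrtr// mulrA.
have C : fine (P [set w | \sum_(j < n) f n (W j w) <= y]) @[n --> \oo] -->
    Phi (y / Num.sqrt p).
  exact: (triangular_clt Windep Wlaw sp0 mf f3 f0 lyapunov var).
apply: (cvg_near_eq C) => //; near=> n; congr (fine (P _)).
by apply/funext => w; rewrite /mkset /f -mulr_sumr mulrC.
Unshelve. all: by end_near. Qed.

Lemma sample_times_injective :
  \forall x \near pfilter P, injective (fun j => (W j x.2).1).
Proof.
have msH : measurable_fun setT sH by exact: measurable_survival.
have mg : measurable_fun setT (fun v : R * R => sH v.1) by exact: (measurableT_comp msH).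
have g0 c : Q [set v | sH v.1 = c] = 0%E.
  have mc : measurable [set w | sH (observed_time X Y w) = c].
    have := measurable_survival_comp Zcont measurableT (measurable_set1 c).
    by rewrite setTI.
  apply/(negligibleP P mc); apply: (negligibleS _ (survival_tie Zcont Zlt1 c)).
  by move=> w /= ->; rewrite eqxx.
apply: (filterS _ (sample_injective Windep Wlaw mg g0)) => x inj i j ij.
by apply: inj; rewrite ij.
Qed.

Definition top_level (n : nat) (w : T) : R :=
  order_stat (fun j => (W j w).1) n (n - k n)%N.

Lemma count_top_level : \forall x \near pfilter P,
  tail_sum (fun=> 1) (top_level x.1 x.2) x.1 x.2 = (k x.1)%:R.
Proof.
apply: (filterS2 _ _ sample_times_injective (pfilter_fst P k_range)) => x inj /andP[k0 kn].
by apply: (@count_top_order_stat _ (fun j => (W j x.2).1)) => // i j _ _; exact: inj.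
Qed.

(** Hill's statistic minus gamma1 times the uncensored proportion is gamma1
    times a score sum plus a bias. Multiplying by the uncensored proportion keeps
    the direction of the inequality as this proportion is eventually positive. *)
Lemma adapted_hill_le (v : R) : \forall x \near pfilter P,
  Num.sqrt (k x.1)%:R * (adapted_hill (fun j => (W j x.2).1) (fun j => (W j x.2).2)
     x.1 (k x.1) - gamma1) <= v <->
  gamma1 * (score_sum (h x.1) x.1 x.2 / Num.sqrt (k x.1)%:R) +
   (gamma1 * ((score_sum (top_level x.1 x.2) x.1 x.2 - score_sum (h x.1) x.1 x.2)
      / Num.sqrt (k x.1)%:R) +
    tail_sum (fun v => (ln v.1 + gamma1 * ln (s v.1)) -
      (ln (top_level x.1 x.2) + gamma1 * ln (s (top_level x.1 x.2))))
      (top_level x.1 x.2) x.1 x.2 / Num.sqrt (k x.1)%:R -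
    v * (tail_sum (fun v => v.2) (top_level x.1 x.2) x.1 x.2 / (k x.1)%:R)) <= 0.
Proof.
have ph := uncensored_proportion_random_level count_top_level.
have ph0 : \forall x \near pfilter P,
  0 < tail_sum (fun v => v.2) (top_level x.1 x.2) x.1 x.2 / (k x.1)%:R.
  exact: (cvgr_gt _ ph).
apply: (filterS3 _ _ ph0 (filterI sample_times_injective count_top_level)
  (pfilter_fst P k_range)).
move=> [n w] /= {ph ph0}; set z := top_level n w.
move=> ph0 [inj Nz] /andP[k0 kn].
have injn : {in gtn n &, injective (fun j => (W j w).1)} by move=> i j _ _; exact: inj.
have q0 : 0 < Num.sqrt (k n)%:R :> R by rewrite sqrtr_gt0 ltr0n.
have kq : (k n)%:R = Num.sqrt (k n)%:R * Num.sqrt (k n)%:R :> R.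
  by rewrite -expr2 sqr_sqrtr.
rewrite /adapted_hill /hill /uncensored_proportion (sum_top_order_stat (@ln R) kn injn).
rewrite (sum_top_concomitant _ kn injn) -/(top_level n w) -/z.
have -> : \sum_(j < n | z < (W j w).1) (W j w).2 = tail_sum (fun v => v.2) z n w by [].
have scoreE : score_sum z n w = tail_sum (fun v => ln (s z) - ln (s v.1) - v.2) z n w.
  rewrite tail_sumE; apply: eq_bigr => j _; congr (_ * (_ - _)).
  by rewrite ln_div ?posrE.
have biasE : tail_sum (fun v => (ln v.1 + gamma1 * ln (s v.1)) -
    (ln z + gamma1 * ln (s z))) z n w =
  \sum_(j < n | z < (W j w).1) ln (W j w).1 - (k n)%:R * ln z -
  gamma1 * tail_sum (fun v => v.2) z n w - gamma1 * score_sum z n w.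
  rewrite -Nz scoreE /tail_sum mulr_suml !mulr_sumr -!sumrB.
  by apply: eq_bigr => j _; ring.
rewrite biasE; move: ph0; move: (tail_sum _ _ _ _) (score_sum _ _ _) (score_sum _ _ _) => D G1 G2.
move: (\sum_(j < n | _) _) => L.
move: kq q0; set q := Num.sqrt _ => kq q0; rewrite kq.
have qq0 : 0 < q * q by rewrite mulr_gt0.
rewrite pmulr_lgt0 ?invr_gt0// => D0.
set lhs := q * _; set rhs := gamma1 * _ + _.
have -> : rhs = (D / (q * q)) * (lhs - v).
  by rewrite /rhs /lhs; field; rewrite !gt_eqF.
by rewrite pmulr_rle0 ?divr_gt0// subr_le0.
Qed.

(** The constant c collects the limits of the bias and of v times the
    uncensored proportion; dividing by gamma1 sqrt p standardises. *)
Lemma adapted_hill_cdf_limit (tau lambda : R) (A : R -> R) (v : R) : tau < 0 ->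
  second_order_condition (tail_quantile (rcdf P X)) gamma1 tau A ->
  Num.sqrt (k n)%:R * A (1 / s (h n)) @[n --> \oo] --> lambda ->
  fine (P [set w | Num.sqrt (k n)%:R * (adapted_hill (fun j => (W j w).1)
    (fun j => (W j w).2) n (k n) - gamma1) <= v]) @[n --> \oo] -->
  Phi ((v - lambda / (1 - p * tau)) / Num.sqrt (gamma1 ^+ 2 / p)).
Proof.
move=> tau0 KA Al.
pose c := lambda * p / (1 - p * tau) - v * p.
have pt0 : 1 - p * tau != 0.
  by rewrite gt_eqF// subr_gt0 (lt_trans _ ltr01)// pmulr_rlt0.
have -> : (v - lambda / (1 - p * tau)) / Num.sqrt (gamma1 ^+ 2 / p) =
    - c / gamma1 / Num.sqrt p.
  rewrite sqrtrM ?sqr_ge0// sqrtr_sqr gtr0_norm// sqrtrV ?(ltW p0)//.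
  have r0 : 0 < Num.sqrt p by rewrite sqrtr_gt0.
  rewrite /c; move: pt0; move: (1 - p * tau) => u u0.
  have : p = Num.sqrt p * Num.sqrt p by rewrite -expr2 sqr_sqrtr// ltW.
  move: r0; move: (Num.sqrt p) => r r0 ->.
  by field; rewrite ?u0 !gt_eqF.
apply: (@slutsky_event _ _ _ P
  (fun n w => score_sum (h n) n w / Num.sqrt (k n)%:R) (fun y => Phi (y / Num.sqrt p))
  gamma1 c _ (fun n w =>
    gamma1 * ((score_sum (top_level n w) n w - score_sum (h n) n w) / Num.sqrt (k n)%:R) +
    tail_sum (fun v => (ln v.1 + gamma1 * ln (s v.1)) -
      (ln (top_level n w) + gamma1 * ln (s (top_level n w))))
      (top_level n w) n w / Num.sqrt (k n)%:R -
    v * (tail_sum (fun v => v.2) (top_level n w) n w / (k n)%:R))).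
- exact: gamma1_gt0.
- move=> n; apply: measurable_funM => //; apply: (measurable_iid_sum W).
  exact: measurable_score.
- move=> n; apply: measurable_leset => //; apply: measurable_funM => //.
  apply: measurable_funB => //.
  by apply: (@measurable_adapted_hill _ _ _ (fun j w => (W j w).1) (fun j w => (W j w).2)) => j;
    exact: measurableT_comp.
- exact: score_sum_clt.
- move=> y; apply: continuous_cvg; first exact: continuous_Phi.
  by apply: cvgMr_tmp; exact: cvg_id.
- rewrite /c; have -> : lambda * p / (1 - p * tau) - v * p =
    gamma1 * 0 + lambda * p / (1 - p * tau) - v * p by rewrite mulr0 add0r.
  apply: cvgB; first apply: cvgD.
  + apply: cvgMl_tmp.
    exact: (score_sum_random_level count_top_level).
  + exact: (bias_random_level count_top_level tau0 KA Al).
  + apply: cvgMl_tmp.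
    exact: (uncensored_proportion_random_level count_top_level).
- exact: adapted_hill_le.
Qed.

End intermediate_levels.

(** * Asymptotic normality *)

(** If the survival function vanished at some point it would vanish beyond it,
    and the quotient defining regular variation would be 0 rather than 1 at
    x = 1. *)
Lemma regularly_varying_cdf_lt1 {R : realType} (K : R -> R) (a : R) :
  continuous_cdf K -> regularly_varying (survival K) a -> forall x, K x < 1.
Proof.
move=> HK rv x; have := rv 1 ltr01; rewrite powR1 => H.
have H1 : \forall t \near +oo, 0 < survival K (t * 1) / survival K t.
  by apply: (cvgr_gt _ H).
have [t [xt ht]] : exists t, x <= t /\ 0 < survival K (t * 1) / survival K t.
  have Hx := nbhs_pinfty_ge (num_real x).
  by have [t [? ?]] := filter_ex (filterI Hx H1); exists t.
have st0 : 0 <= survival K t by rewrite subr_ge0 continuous_cdf_le1.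
have st : 0 < survival K t.
  by rewrite lt_neqAle st0 andbT; apply/eqP => E; move: ht; rewrite -E invr0 mulr0 ltxx.
by rewrite -subr_gt0 (lt_le_trans st)// lerD2l lerN2 (ccdf_homo HK).
Qed.

Theorem corollary2p1
  (R : realType) (d : measure_display) (Omega : measurableType d)
  (P : probability Omega R)
  (X Y : {RV P >-> R})
  (X_ge0 : forall w, 0 <= X w) (Y_ge0 : forall w, 0 <= Y w)
  (X_continuous : continuous_RV P X) (Y_continuous : continuous_RV P Y)
  (XY_independent : independent_RV P X Y)
  (W : nat -> {RV P >-> (R * R)%type})
  (W_iid : iid_copies P W (observation X Y))
  (gamma1 gamma2 : R) (gamma1_gt0 : 0 < gamma1) (gamma2_gt0 : 0 < gamma2)
  (F_RV : regularly_varying (survival (rcdf P X)) (- 1 / gamma1))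
  (G_RV : regularly_varying (survival (rcdf P Y)) (- 1 / gamma2))
  (k : nat -> nat)
  (k_range : \forall n \near \oo, (1 < k n < n)%N)
  (k_infty : k n @[n --> \oo] --> \oo)
  (k_small : (k n)%:R / n%:R @[n --> \oo] --> (0 : R))
  (tau1 tau2 : R) (tau1_lt0 : tau1 < 0) (tau2_lt0 : tau2 < 0)
  (A1s A2s : R -> R)
  (F_second_order :
    second_order_condition (tail_quantile (rcdf P X)) gamma1 tau1 A1s)
  (G_second_order :
    second_order_condition (tail_quantile (rcdf P Y)) gamma2 tau2 A2s)
  (lambda1 : R) :
  let gamma := gamma1 * gamma2 / (gamma1 + gamma2) in
  let p := gamma / gamma1 in
  let h n := tail_quantile (rcdf P (observed_time X Y)) (n%:R / (k n)%:R) in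
  let A1 t := A1s (1 / survival (rcdf P X) t) in
  let A2 t := A2s (1 / survival (rcdf P Y) t) in
  let gamma1_hat n w :=
    adapted_hill (fun j => (W j w).1) (fun j => (W j w).2) n (k n) in
  (fun n => Num.sqrt (k n)%:R * A1 (h n)) =O_\oo (fun=> 1 : R) ->
  (fun n => Num.sqrt (k n)%:R * A2 (h n)) =O_\oo (fun=> 1 : R) ->
  Num.sqrt (k n)%:R * A1 (h n) @[n --> \oo] --> lambda1 ->
  cvg_in_distribution P
    (fun n w => Num.sqrt (k n)%:R * (gamma1_hat n w - gamma1))
    (normal_prob (lambda1 / (1 - p * tau1)) (Num.sqrt (gamma1 ^+ 2 / p))).
Proof.
move=> gamma p h A1 A2 gamma1_hat _ _ A1l.
have Wlaw j A : measurable A -> distribution P (W j) A = distribution P (observation X Y) A.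
  by move=> mA; apply: W_iid.2.
have rvX : regularly_varying (survival (rcdf P X)) (- gamma1^-1).
  by move: F_RV; rewrite mulNr mul1r.
have rvY : regularly_varying (survival (rcdf P Y)) (- gamma2^-1).
  by move: G_RV; rewrite mulNr mul1r.
have Xlt1 := regularly_varying_cdf_lt1 (rcdf_continuous_cdf X_continuous) rvX.
have Ylt1 := regularly_varying_cdf_lt1 (rcdf_continuous_cdf Y_continuous) rvY.
have pE : p = gamma2 / (gamma1 + gamma2).
  by rewrite /p /gamma; field; rewrite !gt_eqF// addr_gt0.
have p0 : 0 < p by rewrite pE divr_gt0// addr_gt0.
have hE n : h n = near_level X Y k 0 n.
  by rewrite /h /tail_quantile /near_level mul0r addr0 mulr1 invf_div.
have kr : \forall n \near \oo, (0 < k n < n)%N.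
  by apply: filterS k_range => n /andP[k1 ->]; rewrite (ltnW k1).
have A1l' : Num.sqrt (k n)%:R * A1s (1 / survival (rcdf P X) (near_level X Y k 0 n))
    @[n --> \oo] --> lambda1.
  by apply: (cvg_near_eq A1l) => //; apply: nearW => n; rewrite -hE.
have mV n : measurable_fun setT (fun w => Num.sqrt (k n)%:R * (gamma1_hat n w - gamma1)).
  apply: measurable_funM => //; apply: measurable_funB => //.
  by apply: (@measurable_adapted_hill _ _ _ (fun j w => (W j w).1) (fun j w => (W j w).2)) => j;
    exact: measurableT_comp.
split => // v _.
have L := adapted_hill_cdf_limit (v := v) X_continuous Xlt1 Y_continuous Ylt1 XY_independent
  W_iid.1 Wlaw gamma1_gt0 gamma2_gt0 rvX rvY kr k_infty k_small tau1_lt0 F_second_order A1l'.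
rewrite -pE in L.
have sd0 : 0 < Num.sqrt (gamma1 ^+ 2 / p) by rewrite sqrtr_gt0 divr_gt0// exprn_gt0.
rewrite [X in _ --> X](_ : _ =
  (Phi ((v - lambda1 / (1 - p * tau1)) / Num.sqrt (gamma1 ^+ 2 / p)))%:E); last first.
  exact: normal_cdf_standardize.
have E n : P ((fun w => Num.sqrt (k n)%:R * (gamma1_hat n w - gamma1)) @^-1` `]-oo, v]) =
    (fine (P [set w | Num.sqrt (k n)%:R * (gamma1_hat n w - gamma1) <= v]))%:E.
  have mE : measurable [set w | Num.sqrt (k n)%:R * (gamma1_hat n w - gamma1) <= v].
    exact: measurable_leset.
  by rewrite fineK ?fin_num_measure.
under eq_fun do rewrite E.
by apply: cvg_EFin; [near=> n|].
Unshelve. all: by end_near. Qed.
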